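(* Assume that $R$ is a symmetric Poisson-CGL extension of length $N$ and $\tau$ an element of the subset $\Xi_N$ of $S_N$. Let $y_{\tau,1},\dots,y_{\tau,N}$ be the sequence of homogeneous Poisson-prime elements associated to the P-CGL extension presentation of $R$ corresponding to $\tau$ (generators adjoined in the order $x_{\tau(1)},\dots,x_{\tau(N)}$). Let $k\in[1,N]$. (a) If $\tau(k)\ge\tau(1)$, then $y_{\tau,k}=y_{[p^m(\tau(k)),\,\tau(k)]}$, where $m=\max\{n\in\mathbb Z_{\ge0}\mid p^n(\tau(k))\in\tau([1,k])\}$. (b) If $\tau(k)\le\tau(1)$, then $y_{\tau,k}=y_{[\tau(k),\,s^m(\tau(k))]}$, where $m=\max\{n\in\mathbb Z_{\ge0}\mid s^n(\tau(k))\in\tau([1,k])\}$. In both cases, the predecessor and successor functions $p,s$ are with respect to the original P-CGL extension presentation of $R$.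
   Context: $\mathbb K$ is a field of characteristic $0$; algebras are $\mathbb K$-algebras, derivations are $\mathbb K$-linear; $[j,k]=\{j,\dots,k\}$. A Poisson algebra is a commutative algebra with a Lie bracket $\{-,-\}$ that is a derivation in each variable. A Poisson action is an action by algebra automorphisms preserving the bracket. A Poisson derivation $\sigma$ of $B$ is a derivation for both product and bracket; a Poisson $\sigma$-derivation is a derivation $\delta$ for the product with $\delta(\{a,b\})=\{\delta(a),b\}+\{a,\delta(b)\}+\sigma(a)\delta(b)-\delta(a)\sigma(b)$. The Poisson-Ore extension $B[x;\sigma,\delta]_p$ is $B[x]$ with the unique Poisson bracket extending that of $B$ with $\{x,b\}=\sigma(b)x+\delta(b)$. For a rational action of a torus $\mathcal H\cong(\mathbb K^* )^r$, homogeneous elements are the $\mathcal H$-eigenvectors and $0$; $\mathrm{Lie}\,\mathcal H\cong\mathbb K^r$ acts by the differential: if $a$ is an $\mathcal H$-eigenvector with eigenvalue $h\mapsto h_1^{u_1}\cdots h_r^{u_r}$, then $\xi\cdot a=(u_1\xi_1+\dots+u_r\xi_r)a$. A Poisson-prime element of a Poisson domain $R$ is a nonzero $c$ with $\{c,R\}\subseteq Rc$ and $R/(c)$ a domain. A Poisson-CGL (P-CGL) extension of length $N$ is an iterated Poisson-Ore extension $R=\mathbb K[x_1]_p[x_2;\sigma_2,\delta_2]_p\cdots[x_N;\sigma_N,\delta_N]_p$ ($\sigma_1=\delta_1=0$; $R_k:=\mathbb K[x_1,\dots,x_k]$, $R_0=\mathbb K$) with a rational Poisson action of a torus $\mathcal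 H$ such that (i) each $x_k$ is an $\mathcal H$-eigenvector; (ii) for $k\in[2,N]$, $\delta_k$ is a locally nilpotent Poisson $\sigma_k$-derivation of $R_{k-1}$; (iii) for $k\in[1,N]$ there is $h_k\in\mathrm{Lie}\,\mathcal H$ with $\sigma_k=(h_k\cdot)|_{R_{k-1}}$ and $h_k\cdot x_k=\lambda_kx_k$, $\lambda_k\neq0$. Write $\sigma_k(x_j)=\lambda_{kj}x_j$ for $j<k$. For $\eta:[1,N]\to\mathbb Z$: $p(k)=\max\{j<k\mid\eta(j)=\eta(k)\}$, $s(k)=\min\{j>k\mid\eta(j)=\eta(k)\}$ ($\max\varnothing=-\infty$, $\min\varnothing=+\infty$). For every P-CGL extension there exist $\eta$ and homogeneous $c_k\in R_{k-1}$ (for $p(k)\neq-\infty$) such that the elements $y_k:=y_{p(k)}x_k-c_k$ if $p(k)\ne-\infty$, $y_k:=x_k$ if $p(k)=-\infty$, are homogeneous and for every $k$ the set $\{y_j\mid j\in[1,k],\,s(j)>k\}$ is a list of the homogeneous Poisson-prime elements of $R_k$ up to scalar multiples; the $y_k$ and $p,s$ are uniquely determined. This is ''the sequence of homogeneous Poisson-prime elements'' of the presentation. Put $R_{[j,k]}=\mathbb K[x_i\mid j\le i\le k]$ ($=\mathbb K$ if $j>k$). $R$ is symmetric if (i) $\delta_k(x_j)\in R_{[j+1,k-1]}$ for all $j<k$; (ii) for every $j\in[1,N]$ there is $h_j^*\in\mathrm{Lie}\,\mathcal H$ with $h_j^*\cdot x_k=-\lambda_{kj}x_k$ for $k\in[j+1,N]$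 and $h_j^*\cdot x_j=\lambda_j^*x_j$ with $\lambda_j^*\ne0$. Put $\sigma_j^*=(h_j^*\cdot)$, $\delta_j^*(a)=\{x_j,a\}-\sigma_j^*(a)x_j$. $\Xi_N$ is the set of $\tau\in S_N$ such that $\tau([1,k])$ is an interval for all $k\in[2,N]$. For $\tau\in\Xi_N$, $R=\mathbb K[x_{\tau(1)}]_p[x_{\tau(2)};\sigma''_{\tau(2)},\delta''_{\tau(2)}]_p\cdots[x_{\tau(N)};\sigma''_{\tau(N)},\delta''_{\tau(N)}]_p$ is a P-CGL extension for the same $\mathcal H$, where $(\sigma''_{\tau(k)},\delta''_{\tau(k)})=(\sigma_{\tau(k)},\delta_{\tau(k)})$ if $\tau(k)=\max\tau([1,k-1])+1$ and $(\sigma^*_{\tau(k)},\delta^*_{\tau(k)})$ if $\tau(k)=\min\tau([1,k-1])-1$. Leading terms are taken in the basis of monomials $x^f$, $f\in\mathbb Z_{\ge0}^N$, for the reverse lexicographic order: $(m'_i)\prec(m_i)$ iff for some $j$, $m'_j<m_j$ and $m'_k=m_k$ for $k>j$. For $i\in[1,N]$, $m\ge0$ with $s^m(i)\in[1,N]$ ($s$ for the original presentation), $y_{[i,s^m(i)]}$ is the unique homogeneous Poisson-prime element of $R_{[i,s^m(i)]}$ with leading term $x_ix_{s(i)}\cdots x_{s^m(i)}$. *)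

(* Defs.v *)
From HB Require Import structures.
From mathcomp Require Import all_boot all_order all_algebra all_fingroup.
From mathcomp Require Import mpoly.

Set Implicit Arguments.
Unset Strict Implicit.
Unset Printing Implicit Defensive.

Import GRing.Theory.
Local Open Scope ring_scope.

(* Indices are 0-based: the generator x_(i+1) of the mathematical text is
   'X_i with i : 'I_N. *)

Section PoissonOre.
Variables (K : fieldType) (N : nat).
Local Notation R := {mpoly K[N]}.

(* K[x_i | i \in A], as a subset of R. *)
Definition polysub (A : {set 'I_N}) (a : R) : Prop :=
  forall (m : 'X_{1..N}) (i : 'I_N), m \in msupp a -> m i != 0%N -> i \in A.

(* The interval [i, j]; it is empty when j < i. *)
Definition iset (i j : nat) : {set 'I_N} := [set l : 'I_N | (i <= l <= j)%N].

(* o([1, k]) and o([1, k-1]), for generators adjoined in the order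
   x_o(1), ..., x_o(N). *)
Definition upto (o : 'I_N -> 'I_N) (k : 'I_N) : {set 'I_N} :=
  [set o i | i : 'I_N & (i <= k)%N].
Definition before (o : 'I_N -> 'I_N) (k : 'I_N) : {set 'I_N} :=
  [set o i | i : 'I_N & (i < k)%N].

Record poisson_bracket (br : R -> R -> R) : Prop := PoissonBracket {
  pb_linear : forall b, linear (fun a => br a b);
  pb_alt : forall a, br a a = 0;
  pb_jacobi : forall a b c, br a (br b c) + br b (br c a) + br c (br a b) = 0;
  pb_leibniz : forall a b c, br (a * b) c = a * br b c + br a c * b }.

(* In what follows B stands for a (Poisson) subalgebra of R, and a map on B is
   given by a function R -> R of which only the restriction to B matters. *)

Record derivation_on (B : R -> Prop) (d : R -> R) : Prop := DerivationOn {
  der_stable : forall a, B a -> B (d a);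
  der_linear : forall (c : K) a b, B a -> B b -> d (c *: a + b) = c *: d a + d b;
  der_leibniz : forall a b, B a -> B b -> d (a * b) = d a * b + a * d b }.

Definition poisson_derivation_on (br : R -> R -> R) (B : R -> Prop)
    (sigma : R -> R) : Prop :=
  derivation_on B sigma /\
  forall a b, B a -> B b -> sigma (br a b) = br (sigma a) b + br a (sigma b).

Definition poisson_sderivation_on (br : R -> R -> R) (B : R -> Prop)
    (sigma delta : R -> R) : Prop :=
  derivation_on B delta /\
  forall a b, B a -> B b ->
    delta (br a b) = br (delta a) b + br a (delta b)
                     + sigma a * delta b - delta a * sigma b.

(* R = K[x_1]_p[x_2; sigma_2, delta_2]_p ... [x_N; sigma_N, delta_N]_p.  For
   the first generator the conditions force sigma_1 = delta_1 = 0 on K. *)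
Record iterated_poisson_ore (br : R -> R -> R) (sigma delta : 'I_N -> R -> R) :
  Prop := IteratedPoissonOre {
  ipo_poisson : poisson_bracket br;
  ipo_sigma : forall k,
    poisson_derivation_on br (polysub (before id k)) (sigma k);
  ipo_delta : forall k,
    poisson_sderivation_on br (polysub (before id k)) (sigma k) (delta k);
  ipo_bracket : forall k b, polysub (before id k) b ->
    br 'X_k b = sigma k b * 'X_k + delta k b }.

Definition dvd_in (B : R -> Prop) (c a : R) : Prop :=
  exists b, B b /\ a = b * c.

(* The last two fields say that B / cB is a domain. *)
Record poisson_prime (br : R -> R -> R) (B : R -> Prop) (c : R) : Prop :=
  PoissonPrime {
  pp_mem : B c;
  pp_neq0 : c != 0;
  pp_normal : forall a, B a -> dvd_in B c (br c a);
  pp_proper : ~ dvd_in B c 1;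
  pp_prime : forall a b, B a -> B b ->
    dvd_in B c (a * b) -> dvd_in B c a \/ dvd_in B c b }.

End PoissonOre.

Section Torus.
Variables (K : fieldType) (N r : nat).
Local Notation R := {mpoly K[N]}.

(* The torus (K^* )^r consists of the h : {ffun 'I_r -> K} with in_torus h; the
   values of an action outside of it are irrelevant. *)
Definition in_torus (h : {ffun 'I_r -> K}) : Prop := forall i, h i != 0.

Definition character (u : 'I_r -> int) (h : {ffun 'I_r -> K}) : K :=
  \prod_(i < r) h i ^ u i.

(* Rationality is expressed through the coaction R -> R (x) K[H]: the orbit
   map of a has finitely many Laurent monomial components. *)
Record rational_poisson_action (br : R -> R -> R)
    (act : {ffun 'I_r -> K} -> R -> R) : Prop := RationalPoissonAction {
  act_one : forall a, act [ffun => 1] a = a;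
  act_mul : forall g h a, in_torus g -> in_torus h ->
    act [ffun i => g i * h i] a = act g (act h a);
  act_linear : forall h, in_torus h -> linear (act h);
  act_ring1 : forall h, in_torus h -> act h 1 = 1;
  act_ringM : forall h a b, in_torus h -> act h (a * b) = act h a * act h b;
  act_bracket : forall h a b, in_torus h ->
    act h (br a b) = br (act h a) (act h b);
  act_rational : forall a, exists s : seq (('I_r -> int) * R),
    forall h, in_torus h -> act h a = \sum_(t <- s) character t.1 h *: t.2 }.

Definition homogeneous (act : {ffun 'I_r -> K} -> R -> R) (a : R) : Prop :=
  forall h, in_torus h -> exists c : K, act h a = c *: a.

Definition eigenvector (act : {ffun 'I_r -> K} -> R -> R) (a : R) : Prop :=
  a != 0 /\ homogeneous act a.

(* lie xi a is xi . a, for xi in Lie H = K^r.  A rational action makes R the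
   sum of its weight spaces, so this determines lie. *)
Record differential (act : {ffun 'I_r -> K} -> R -> R)
    (lie : {ffun 'I_r -> K} -> R -> R) : Prop := Differential {
  diff_linear : forall xi, linear (lie xi);
  diff_weight : forall xi (u : 'I_r -> int) a,
    (forall h, in_torus h -> act h a = character u h *: a) ->
    lie xi a = (\sum_(i < r) (u i)%:~R * xi i) *: a }.

(* lam k j is the scalar lambda_kj, and is only relevant for j < k. *)
Record pcgl (br : R -> R -> R) (act lie : {ffun 'I_r -> K} -> R -> R)
    (sigma delta : 'I_N -> R -> R) (lam : 'I_N -> 'I_N -> K) : Prop := PCGL {
  pcgl_ore : iterated_poisson_ore br sigma delta;
  pcgl_action : rational_poisson_action br act;
  pcgl_lie : differential act lie;
  pcgl_eigen : forall k, eigenvector act 'X_k;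
  pcgl_nilp : forall k a, polysub (before id k) a ->
    exists n, iter n (delta k) a = 0;
  pcgl_h : forall k, exists h : {ffun 'I_r -> K},
    (forall a, polysub (before id k) a -> sigma k a = lie h a) /\
    exists l : K, l != 0 /\ lie h 'X_k = l *: 'X_k;
  pcgl_lam : forall k j : 'I_N, (j < k)%N ->
    sigma k 'X_j = lam k j *: 'X_j }.

Record symmetric_pcgl (lie : {ffun 'I_r -> K} -> R -> R)
    (delta : 'I_N -> R -> R) (lam : 'I_N -> 'I_N -> K) : Prop := SymmetricPCGL {
  sym_delta : forall j k : 'I_N, (j < k)%N ->
    polysub (iset N j.+1 k.-1) (delta k 'X_j);
  sym_h : forall j : 'I_N, exists h : {ffun 'I_r -> K},
    (forall k : 'I_N, (j < k)%N -> lie h 'X_k = - lam k j *: 'X_k) /\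
    exists l : K, l != 0 /\ lie h 'X_j = l *: 'X_j }.

Definition homogeneous_poisson_prime (br : R -> R -> R)
    (act : {ffun 'I_r -> K} -> R -> R) (B : R -> Prop) (c : R) : Prop :=
  homogeneous act c /\ poisson_prime br B c.

End Torus.

Section PredSucc.
Variables (N : nat) (eta : 'I_N -> int).

(* None stands for -oo in pred_eta and for +oo in succ_eta. *)
Definition pred_eta (k : 'I_N) : option 'I_N :=
  [pick j : 'I_N | [&& (j < k)%N, eta j == eta k &
     [forall i : 'I_N, ((i < k)%N && (eta i == eta k)) ==> (i <= j)%N]]].

Definition succ_eta (k : 'I_N) : option 'I_N :=
  [pick j : 'I_N | [&& (k < j)%N, eta j == eta k &
     [forall i : 'I_N, ((k < i)%N && (eta i == eta k)) ==> (j <= i)%N]]].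

Definition pred_iter (n : nat) (k : 'I_N) : option 'I_N :=
  iter n (obind pred_eta) (Some k).

Definition succ_iter (n : nat) (k : 'I_N) : option 'I_N :=
  iter n (obind succ_eta) (Some k).

Definition succ_gt (j k : 'I_N) : bool :=
  if succ_eta j is Some i then (k < i)%N else true.

(* The exponent of x_i x_s(i) ... x_(s^m(i)). *)
Definition chain_mnm (i : 'I_N) (m : nat) : 'X_{1..N} :=
  (\sum_(n < m.+1)
     (if succ_iter n i is Some j then U_(j) else 0))%MM.

End PredSucc.

Section HomogeneousPrimes.
Variables (K : fieldType) (N r : nat).
Local Notation R := {mpoly K[N]}.

(* y is the sequence of homogeneous Poisson-prime elements, and eta a function
   defining its p and s, for the generators adjoined in the order
   x_o(1), ..., x_o(N).  Only this order, the bracket and the torus action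
   enter, since sigma and delta are determined by them. *)
Record prime_sequence (br : R -> R -> R) (act : {ffun 'I_r -> K} -> R -> R)
    (o : 'I_N -> 'I_N) (eta : 'I_N -> int) (y : 'I_N -> R) : Prop :=
  PrimeSequence {
  ps_homog : forall k, homogeneous act (y k);
  ps_first : forall k, pred_eta eta k = None -> y k = 'X_(o k);
  ps_next : forall k j, pred_eta eta k = Some j ->
    exists c, [/\ polysub (before o k) c, homogeneous act c
                & y k = y j * 'X_(o k) - c];
  ps_list : forall k c,
    homogeneous_poisson_prime br act (polysub (upto o k)) c <->
    exists (j : 'I_N) (l : K),
      [/\ (j <= k)%N, succ_gt eta j k, l != 0 & c = l *: y j] }.

Definition revlex_lt (m' m : 'X_{1..N}) : Prop :=
  exists j : 'I_N, (m' j < m j)%N /\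
    forall k : 'I_N, (j < k)%N -> m' k = m k.

Definition leading_term (a : R) (c : K) (m : 'X_{1..N}) : Prop :=
  [/\ c != 0, a@_m = c &
      forall m', m' \in msupp a -> m' != m -> revlex_lt m' m].

(* The property characterizing y_[i, j], where j = s^m(i) for some m >= 0. *)
Definition interval_prime (br : R -> R -> R)
    (act : {ffun 'I_r -> K} -> R -> R) (eta : 'I_N -> int)
    (i j : 'I_N) (z : R) : Prop :=
  exists m : nat, [/\ succ_iter eta m i = Some j,
    homogeneous_poisson_prime br act (polysub (iset N i j)) z
    & leading_term z 1 (chain_mnm eta i m)].

End HomogeneousPrimes.

Definition Xi (N : nat) (tau : 'S_N) : Prop :=
  forall k : 'I_N, (0 < k)%N ->
    exists i j : 'I_N, upto tau k = iset N i j.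

Definition is_max (P : nat -> Prop) (m : nat) : Prop :=
  P m /\ forall n, P n -> (n <= m)%N.

(* Main.v *)
From Stdlib Require Import Classical.
Require Import Defs.
From HB Require Import structures.
From mathcomp Require Import all_boot all_order all_algebra all_fingroup.
From mathcomp Require Import mpoly.
From mathcomp Require Import ring zify.

Set Implicit Arguments.
Unset Strict Implicit.
Unset Printing Implicit Defensive.

Import GRing.Theory.
Local Open Scope ring_scope.

(** The proof compares leading monomials. Let [pos] be an order of the generators in
    which [delta_j x_i] is lower than [x_i x_j], as is the case for the original
    order, its reverse, and every order of [Xi]. If [v] is homogeneous and divides
    its brackets with the generators, the leading monomial [x^f] of [v] for [pos]
    determines the leading term of the quotient of [{v, x_j}] by [v], which is a
    multiple of [x_j] by a scalar that is linear in [f]. The quotients do not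
    depend on [pos], nor does the weight of [v], and together they determine [f]
    (lemma [exponent_inj]). So [v] has the same leading monomial for all these
    orders (lemma [normal_lead]).

    For the order of [tau], the leading monomial of [ytau k] is the product of the
    generators of the class of [k] that have been adjoined by step [k] (lemma
    [seq_lead]). The prime elements of the whole algebra are the same for both
    presentations, so their leading monomials identify the classes of [etatau]
    with those of [eta] (lemma [classes_eq]), and the leading monomial of [ytau k] is
    the product over the part of the [eta]-class of [tau k] that lies in
    [tau([1, k])]. This is also the leading monomial for the original order and for
    its reverse, whence [ytau k] only involves generators between the smallest
    and the largest index [i] and [j] of this part. It is then a prime element of
    [R_[i, j]], and the only one with its leading term: the difference of two would
    be normal with a lower leading monomial, which must again be the same one.
    Lemma [reduction] reads off the theorem.

    All this uses [{a, b} = - {b, a}]. The bracket is alternating, but linearity and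
    the Leibniz rule are only given for its first argument, so antisymmetry has to
    come from the presentation. Call [x_k] central if it commutes with the
    generators before it. When there are two non-central generators, [rigidity]
    applies: on a non-commutative subalgebra [S] that is closed under the bracket
    and on which all [br d] are derivations, the Jacobi identity forces
    [br b c = - br c b] for [b] in [S] and every [c]. A first such [S] is found
    inside the algebra generated by the variables up to the first non-central one,
    the second non-central one being used to show that the [br d] are
    derivations on it; then the generators are added one by one (lemma
    [two_noncentral_anti]). When at most one generator [x_l] is non-central, all
    [y_k] are generators with the possible exception of [y_l = x_j x_l - g x^m],
    and the theorem is checked on these elements. There the bracket of [y_l] with
    [R_[j, l]] stays in [R_[j, l]] because it commutes with the torus elements fixing
    [R_[j, l]], and these move every other generator (lemma [pair_stable]). *)

(** * Polynomials supported on a set of monomials *)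

Section Support.
Variables (K : fieldType) (N : nat).
Local Notation R := {mpoly K[N]}.
Local Notation mon := 'X_{1..N}.
Implicit Types (a b p q : R) (m f g : mon) (A B : {set 'I_N}).

Definition inmon (P : mon -> Prop) a : Prop := forall m, m \in msupp a -> P m.

Definition linclosed (T : R -> Prop) : Prop :=
  T 0 /\ forall (c : K) a b, T a -> T b -> T (c *: a + b).

Definition mulclosed (T : R -> Prop) : Prop := forall a b, T a -> T b -> T (a * b).

Lemma linclosedD T a b : linclosed T -> T a -> T b -> T (a + b).
Proof. by case=> _ h Ta Tb; have := h 1 a b Ta Tb; rewrite scale1r. Qed.

Lemma linclosedZ T c a : linclosed T -> T a -> T (c *: a).
Proof. by case=> h0 h Ta; have := h c a 0 Ta h0; rewrite addr0. Qed.

Lemma linclosedN T a : linclosed T -> T a -> T (- a).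
Proof. by move=> h Ta; rewrite -scaleN1r; apply: linclosedZ. Qed.

Lemma linclosedB T a b : linclosed T -> T a -> T b -> T (a - b).
Proof. by move=> h Ta Tb; apply: linclosedD => //; apply: linclosedN. Qed.

Lemma linclosed_sum T (I : eqType) (r : seq I) (F : I -> R) :
  linclosed T -> (forall i, i \in r -> T (F i)) -> T (\sum_(i <- r) F i).
Proof.
move=> h TF; rewrite big_seq; elim/big_rec: _ => [|i a ir Ta]; first by case: h.
by apply: linclosedD => //; apply: TF.
Qed.

Lemma inmon_lin P : linclosed (inmon P).
Proof.
split=> [m|c a b Pa Pb m]; first by rewrite msupp0.
move/(msuppD_le); rewrite mem_cat => /orP [/msuppZ_le|]; [exact: Pa|exact: Pb].
Qed.

Lemma inmonM (P Q T : mon -> Prop) a b :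
  (forall m m', P m -> Q m' -> T (m + m')%MM) -> inmon P a -> inmon Q b ->
  inmon T (a * b).
Proof.
move=> PQT Pa Qb m /msuppM_le /allpairsP [[u v] /= [ua vb ->]].
by apply: PQT; [apply: Pa|apply: Qb].
Qed.

Lemma inmonX (P : mon -> Prop) m : P m -> inmon P 'X_[m].
Proof. by move=> Pm m'; rewrite msuppX inE => /eqP ->. Qed.

Lemma inmon_ind (P : mon -> Prop) (T : R -> Prop) a :
  linclosed T -> (forall m, P m -> T 'X_[m]) -> inmon P a -> T a.
Proof.
move=> hT TX Pa; rewrite (mpolyE a); apply: linclosed_sum => // m ma.
by apply: linclosedZ => //; apply/TX/Pa.
Qed.

Lemma polysub_inmon A a :
  polysub A a <-> inmon (fun m => forall i, m i != 0%N -> i \in A) a.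
Proof. by split=> h m => [ma i|i ma]; apply: h. Qed.

Lemma polysub_lin A : linclosed (polysub A).
Proof.
have [h0 h] := @inmon_lin (fun m => forall i, m i != 0%N -> i \in A).
split=> [|c a b /polysub_inmon Aa /polysub_inmon Ab]; first exact/polysub_inmon.
by apply/polysub_inmon/h.
Qed.

Lemma polysubM A : mulclosed (polysub A).
Proof.
move=> a b /polysub_inmon Aa /polysub_inmon Ab; apply/polysub_inmon.
apply: inmonM Aa Ab => m m' hm hm' i; rewrite mnmDE addn_eq0 negb_and.
by case/orP; [apply: hm|apply: hm'].
Qed.

Lemma polysub1 A : polysub A (1 : R).
Proof.
by move=> m i; rewrite msupp1 inE => /eqP ->; rewrite mnm0E.
Qed.

Lemma polysubX A i : i \in A -> polysub A ('X_i : R).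
Proof.
move=> iA m j; rewrite msuppX inE => /eqP ->; rewrite mnm1E.
by case: (i =P j) => [<-|] //.
Qed.

Lemma polysubS A B a : {subset A <= B} -> polysub A a -> polysub B a.
Proof. by move=> sAB Aa m i ma mi; apply/sAB/(Aa m). Qed.

Lemma mulclosedXn T a k : T 1 -> mulclosed T -> T a -> T (a ^+ k).
Proof.
move=> T1 hM Ta; elim: k => [|k IH]; first exact: T1.
by rewrite exprS; apply: hM.
Qed.

Lemma mulclosed_prod T (I : Type) (r : seq I) (P : pred I) (F : I -> R) :
  T 1 -> mulclosed T -> (forall i, P i -> T (F i)) -> T (\prod_(i <- r | P i) F i).
Proof. by move=> T1 hM TF; elim/big_rec: _ => // i a Pi Ta; apply/hM/Ta/TF. Qed.

Lemma polysub_ind A (T : R -> Prop) a :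
  linclosed T -> mulclosed T -> T 1 -> (forall i, i \in A -> T 'X_i) ->
  polysub A a -> T a.
Proof.
move=> hL hM T1 TX /polysub_inmon; apply: inmon_ind => // m mA.
rewrite mpolyXE_id; apply: mulclosed_prod => // i _.
have [->|mi] := eqVneq (m i) 0%N; first by rewrite expr0.
by apply: mulclosedXn => //; apply/TX/mA.
Qed.

Lemma polysubT a : polysub [set: 'I_N] a.
Proof. by move=> m i _ _; rewrite inE. Qed.

Lemma mpoly_alg_ind (T : R -> Prop) a :
  linclosed T -> mulclosed T -> T 1 -> (forall i, T 'X_i) -> T a.
Proof. by move=> hL hM T1 TX; apply: (@polysub_ind setT T a hL hM T1 _ (@polysubT a)) => i _. Qed.

Lemma mcoeff_polysub A a m i : polysub A a -> m i != 0%N -> i \notin A -> a@_m = 0.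
Proof.
move=> Aa mi iA; apply/eqP; rewrite mcoeff_eq0; apply: contra iA => ma.
exact: Aa ma mi.
Qed.

Lemma mcoeff_XM m a (k : mon) : ('X_[m] * a)@_(m + k)%MM = a@_k.
Proof. by rewrite mulrC mcoeffMX. Qed.

Lemma mcoeffMX0 m a (k : mon) i : (k i < m i)%N -> (a * 'X_[m])@_k = 0.
Proof.
move=> km; apply/eqP; rewrite mcoeff_eq0; apply/negP => /msuppM_le.
case/allpairsP=> [[u v] /= [_]]; rewrite msuppX inE => /eqP -> kE.
by move: km; rewrite kE mnmDE; lia.
Qed.

End Support.

(** * Leading monomials for lexicographic orders *)

Section Leading.
Variables (K : fieldType) (N : nat).
Local Notation R := {mpoly K[N]}.
Local Notation mon := 'X_{1..N}.
Implicit Types (a b p q : R) (m f g : mon) (A B : {set 'I_N}).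
Variable pos : 'I_N -> nat.

(** The variable of largest position is the most significant one, so that the
    positions [i |-> i] give the reverse lexicographic order. *)
Definition lto m' m : Prop :=
  exists j, (m' j < m j)%N /\ forall k, (pos j < pos k)%N -> m' k = m k.

Definition lead a f : Prop :=
  f \in msupp a /\ forall m, m \in msupp a -> m != f -> lto m f.

Definition low f a : Prop := inmon (lto^~ f) a.

(** [tops f a c]: the terms of [a] other than [c x^f] lie strictly below [x^f].
    Unlike [lead] this allows [c = 0], which makes it additive in [a]. *)
Definition tops f a (c : K) : Prop := low f (a - c *: 'X_[f]).

Hypothesis pos_inj : injective pos.

Lemma lto_irr m : ~ lto m m.
Proof. by case=> j; rewrite ltnn => -[]. Qed.

Lemma lto_trans m1 m2 m3 : lto m1 m2 -> lto m2 m3 -> lto m1 m3.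
Proof.
move=> [j [j1 j2]] [k [k1 k2]]; case: (ltngtP (pos j) (pos k)) => jk.
- exists k; split=> [|i ki]; first by rewrite j2.
  by rewrite j2 ?k2 //; apply: ltn_trans ki.
- exists j; split=> [|i ji]; first by rewrite -k2.
  by rewrite j2 ?k2 //; apply: ltn_trans ji.
- move/pos_inj: jk => jk; subst k; exists j; split; first exact: ltn_trans k1.
  by move=> i ji; rewrite j2 ?k2.
Qed.

Lemma lto_addr m1 m2 m : lto m1 m2 -> lto (m1 + m)%MM (m2 + m)%MM.
Proof.
case=> j [j1 j2]; exists j; split; first by rewrite !mnmDE ltn_add2r.
by move=> k /j2 e; rewrite !mnmDE e.
Qed.

Lemma lto_addl m1 m2 m : lto m1 m2 -> lto (m + m1)%MM (m + m2)%MM.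
Proof. by rewrite ![(m + _)%MM]addmC; exact: lto_addr. Qed.

Lemma lto_total m1 m2 : m1 != m2 -> lto m1 m2 \/ lto m2 m1.
Proof.
move=> ne; have [i0 hi0] : exists i, m1 i != m2 i.
  apply/existsP; rewrite -negb_forall; apply: contra ne => /forallP h.
  by apply/eqP/mnmP => i; apply/eqP.
case: (@arg_maxnP _ i0 (fun i => m1 i != m2 i) pos hi0) => j hj jmax.
have jE k : (pos j < pos k)%N -> m1 k = m2 k.
  by move=> jk; apply/eqP; apply: contraTT jk => /jmax; rewrite -leqNgt.
case: (ltngtP (m1 j) (m2 j)) hj => // h _; [left|right]; exists j; split=> //.
by move=> k /jE.
Qed.

Lemma lto_max (s : seq mon) :
  s != [::] -> exists2 f, f \in s & forall m, m \in s -> m != f -> lto m f.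
Proof.
elim: s => // x s IH _; case: (eqVneq s [::]) => [->|/IH [f fs fmax]].
  by exists x; rewrite ?inE // => m; rewrite inE => ->.
case: (eqVneq x f) => [xf|xf].
  exists f; first by rewrite inE fs orbT.
  by move=> m; rewrite inE => /orP [/eqP ->|/fmax //]; rewrite xf eqxx.
case: (lto_total xf) => h.
  exists f; first by rewrite inE fs orbT.
  by move=> m; rewrite inE => /orP [/eqP -> //|/fmax].
exists x; first by rewrite inE eqxx.
move=> m; rewrite inE => /orP [/eqP ->|ms _]; first by rewrite eqxx.
by case: (eqVneq m f) => [-> //|/(fmax _ ms) mf]; apply: lto_trans h.
Qed.

Lemma lead_ex a : a != 0 -> exists f, lead a f.
Proof.
move=> a0; have : msupp a != [::] by rewrite msupp_eq0.
by case/lto_max=> f fa fmax; exists f.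
Qed.

Lemma lead_uniq a f g : lead a f -> lead a g -> f = g.
Proof.
move=> [fa fmax] [ga gmax]; case: (eqVneq f g) => // fg.
have := lto_trans (fmax _ ga _) (gmax _ fa fg); rewrite eq_sym fg => /(_ isT).
by move/lto_irr.
Qed.

Lemma low_lin f : linclosed (low f).
Proof. exact: inmon_lin. Qed.

Lemma lowD f a b : low f a -> low f b -> low f (a + b).
Proof. exact: (linclosedD (low_lin f)). Qed.

Lemma lowZ f (c : K) a : low f a -> low f (c *: a).
Proof. exact: (linclosedZ c (low_lin f)). Qed.

Lemma topsD f a b c d : tops f a c -> tops f b d -> tops f (a + b) (c + d).
Proof.
by rewrite /tops scalerDl opprD addrACA => ha hb; apply: lowD.
Qed.

Lemma topsZ f a c t : tops f a c -> tops f (t *: a) (t * c).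
Proof.
by rewrite /tops -scalerA -scalerBr => h; apply: lowZ.
Qed.

Lemma tops0 f : tops f 0 0.
Proof. by rewrite /tops scale0r subr0 /low => m; rewrite msupp0. Qed.

Lemma topsX f : tops f 'X_[f] 1.
Proof. by rewrite /tops scale1r subrr => m; rewrite msupp0. Qed.

Lemma low_tops f a : low f a -> tops f a 0.
Proof. by rewrite /tops scale0r subr0. Qed.

Lemma topsS f g a c : lto f g -> tops f a c -> tops g a 0.
Proof.
move=> fg h; apply: low_tops; rewrite -(subrK (c *: 'X_[f]) a).
apply: lowD.
  by move=> m /h mf; apply: lto_trans mf fg.
by apply: lowZ; apply: (inmonX (P := lto^~ g)).
Qed.

Lemma tops_coef f a c : tops f a c -> a@_f = c.
Proof.
move=> h; have : (a - c *: 'X_[f])@_f = 0.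
  by apply/eqP; rewrite mcoeff_eq0; apply/negP => /h /lto_irr.
by rewrite mcoeffB mcoeffZ mcoeffX eqxx mulr1 => /eqP; rewrite subr_eq0 => /eqP.
Qed.

Lemma tops_le f a c m : tops f a c -> m \in msupp a -> m = f \/ lto m f.
Proof.
move=> h ma; case: (eqVneq m f) => [|mf]; [by left|right]; apply: h.
rewrite mcoeff_msupp mcoeffB mcoeffZ mcoeffX [f == m]eq_sym (negbTE mf) mulr0 subr0.
by rewrite -mcoeff_msupp.
Qed.

Lemma topsP f a : (forall m, m \in msupp a -> m = f \/ lto m f) -> tops f a a@_f.
Proof.
move=> h m; rewrite mcoeff_msupp mcoeffB mcoeffZ mcoeffX.
case: (eqVneq f m) => [->|fm]; first by rewrite mulr1 subrr eqxx.
by rewrite mulr0 subr0 -mcoeff_msupp => /h [mf|//]; rewrite mf eqxx in fm.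
Qed.

Lemma lead_tops a f : lead a f -> tops f a a@_f.
Proof.
by case=> _ h; apply: topsP => m ma; case: (eqVneq m f) => [->|/(h _ ma)]; [left|right].
Qed.

Lemma tops_lead a f (c : K) : c != 0 -> tops f a c -> lead a f.
Proof.
move=> c0 h; split; first by rewrite mcoeff_msupp (tops_coef h).
by move=> m /(tops_le h) [->|//]; rewrite eqxx.
Qed.

Lemma topsM f g a b c d : tops f a c -> tops g b d -> tops (f + g) (a * b) (c * d).
Proof.
move=> ha hb; rewrite /tops.
have -> : a * b - (c * d) *: 'X_[f + g] =
    (a - c *: 'X_[f]) * b + c *: ('X_[f] * (b - d *: 'X_[g])).
  rewrite mpolyXD mulrBr -scalerAr scalerBr scalerA mulrBl -scalerAl.
  by rewrite addrA subrK.
apply: lowD.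
  apply: (inmonM (P := lto^~ f) (Q := fun m => m = g \/ lto m g)) => //.
    move=> m m' mf [->|m'g]; first exact: lto_addr.
    by apply: lto_trans (lto_addl _ m'g); apply: lto_addr.
  by move=> m /(tops_le hb).
apply: lowZ.
apply: (inmonM (P := eq^~ f) (Q := lto^~ g)) => //.
  by move=> m m' -> h; apply: lto_addl.
exact: inmonX.
Qed.

Lemma leadM a b f g : lead a f -> lead b g -> lead (a * b) (f + g).
Proof.
move=> la lb; apply: (tops_lead _ (topsM (lead_tops la) (lead_tops lb))).
by rewrite mulf_neq0 // -mcoeff_msupp; [case: la|case: lb].
Qed.

Lemma lto_add2r m1 m2 m : lto (m1 + m)%MM (m2 + m)%MM -> lto m1 m2.
Proof.
case=> j [j1 j2]; exists j; split; first by move: j1; rewrite !mnmDE ltn_add2r.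
by move=> k /j2 /eqP; rewrite !mnmDE eqn_add2r => /eqP.
Qed.

(** Leading monomials multiply, so a bound on the leading monomial of a product
    bounds that of each factor. *)
Lemma tops_quot p v f g c : lead v f -> tops (g + f) (p * v) c ->
  tops g p p@_g /\ p@_g * v@_f = c.
Proof.
move=> vf h; have pg : tops g p p@_g.
  case: (eqVneq p 0) => [->|/lead_ex [u pu]]; first by rewrite mcoeff0; exact: tops0.
  apply: topsP => m mp; have : u = g \/ lto u g.
    have [uf _] := leadM pu vf.
    case: (tops_le h uf) => [/eqP|/lto_add2r]; last by right.
    by rewrite eqm_add2r => /eqP; left.
  case: (eqVneq m u) => [-> //|mu]; have mltu := pu.2 _ mp mu.
  by case=> [<-|ug]; right=> //; apply: lto_trans ug.
split=> //; rewrite -(tops_coef h); apply/esym/tops_coef/topsM => //.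
exact: lead_tops.
Qed.

Lemma lead_top0 a f i m : lead a f -> m \in msupp a ->
  (forall k, (pos i <= pos k)%N -> f k = 0%N) -> m i = 0%N.
Proof.
move=> af ma fi; case: (tops_le (lead_tops af) ma) => [->|[j [j1 j2]]].
  exact: fi.
rewrite j2 ?fi // ltnNge; apply/negP => ij; by move: j1; rewrite fi.
Qed.

End Leading.

Section Factors.
Variables (K : fieldType) (N : nat).
Local Notation R := {mpoly K[N]}.
Implicit Types (a b p q : R) (A B : {set 'I_N}).

(** Degrees in a fixed variable add up in a product. *)
Lemma polysub_factor A a b : a * b != 0 -> polysub A (a * b) -> polysub A b.
Proof.
move=> ab0 Aab m i mb mi; apply: contraR mi => iA; apply/eqP.
pose pos (j : 'I_N) : nat := if j == i then N else j.
have pinj : injective pos.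
  move=> j k; rewrite /pos; case: eqP => [->|_]; case: eqP => [->|_] // e.
  - by have := ltn_ord k; rewrite -e ltnn.
  - by have := ltn_ord j; rewrite e ltnn.
  - exact: val_inj.
have [a0 b0] : a != 0 /\ b != 0.
  by split; apply: contraNneq ab0 => ->; rewrite ?mul0r ?mulr0.
have [f af] := lead_ex pinj a0; have [g bg] := lead_ex pinj b0.
have [fg _] := leadM pinj af bg.
have gi : g i = 0%N.
  apply/eqP; apply: contraNT iA => gi; apply: Aab fg _.
  by rewrite mnmDE addn_eq0 (negbTE gi) andbF.
apply: (lead_top0 bg mb) => k; rewrite /pos eqxx.
by case: eqP => [->//|_]; rewrite leqNgt ltn_ord.
Qed.

Lemma polysub_factorl A a b : a * b != 0 -> polysub A (a * b) -> polysub A a.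
Proof. by rewrite mulrC; exact: polysub_factor. Qed.

Lemma polysub_quot A a b : b != 0 -> polysub A (a * b) -> polysub A a.
Proof.
move=> b0 ab; case: (eqVneq a 0) => [->|a0]; first by case: (polysub_lin K A).
by apply: polysub_factorl ab; rewrite mulf_neq0.
Qed.

Lemma unit_polysub0 a b : a * b = 1 -> polysub set0 b.
Proof. by move=> e; apply: (@polysub_factor _ a); rewrite e ?oner_neq0 //; exact: polysub1. Qed.

Lemma notin_polysubX A (i : 'I_N) : i \notin A -> ~ polysub A ('X_i : R).
Proof.
move=> iA /(_ U_(i)%MM i); rewrite msuppX inE eqxx mnm1E eqxx => /(_ isT isT).
by rewrite (negbTE iA).
Qed.

Lemma mX_neq0 (m : 'X_{1..N}) : 'X_[m] != 0 :> R.
Proof. by apply/negP => /eqP /(congr1 (fun p : R => p@_m)); rewrite mcoeffX eqxx mcoeff0 => /eqP; rewrite oner_eq0. Qed.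

End Factors.

(** * Weights of the torus action *)

Section Characters.
Variables (K : fieldType) (r : nat).
Local Notation T := {ffun 'I_r -> K}.
Implicit Types (u v : 'I_r -> int) (g h : T).

Definition tmul g h : T := [ffun i => g i * h i].

Lemma in_torusM g h : in_torus g -> in_torus h -> in_torus (tmul g h).
Proof. by move=> hg hh i; rewrite ffunE mulf_neq0. Qed.

Lemma in_torus1 : in_torus ([ffun => 1] : T).
Proof. by move=> i; rewrite ffunE oner_neq0. Qed.

Lemma characterM u g h :
  character u (tmul g h) = character u g * character u h.
Proof. by rewrite -big_split; apply: eq_bigr => i _; rewrite ffunE expfzMl. Qed.

Lemma character0 h : character (fun=> 0) h = 1.
Proof. by rewrite /character big1. Qed.

Lemma character_neq0 u h : in_torus h -> character u h != 0.
Proof. by move=> hh; apply/prodf_neq0 => i _; rewrite expfz_neq0. Qed.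

(** Dedekind's independence of characters: comparing the expansions of
    [c (g h)] and [psi g * c h] eliminates [psi] from a combination of
    characters. *)
Lemma dedekind (c : T -> K) (s : seq (('I_r -> int) * K)) :
  (forall g h, in_torus g -> in_torus h -> c (tmul g h) = c g * c h) ->
  c [ffun => 1] != 0 ->
  (forall h, in_torus h -> c h = \sum_(t <- s) t.2 * character t.1 h) ->
  exists u, forall h, in_torus h -> c h = character u h.
Proof.
move=> cM c1; elim: {s}(size s) {-2}s (leqnn (size s)) => [|n IH] [|[u a] s] //=.
- by move=> _ /(_ _ in_torus1); rewrite big_nil => /eqP; rewrite (negbTE c1).
- by move=> _ /(_ _ in_torus1); rewrite big_nil => /eqP; rewrite (negbTE c1).
rewrite ltnS => sn cs.
have [h|/not_all_ex_not [g]] := classic (forall h, in_torus h -> c h = character u h).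
  by exists u.
move=> ncg; have [gT /eqP cg] := imply_to_and _ _ ncg.
have d0 : c g - character u g != 0 by rewrite subr_eq0.
apply: (IH [seq (t.1, t.2 * (character t.1 g - character u g) /
                     (c g - character u g)) | t <- s]); first by rewrite size_map.
move=> h hT; rewrite big_map /=; apply: (mulfI d0).
rewrite mulrBl -(cM _ _ gT hT) (cs _ (in_torusM gT hT)) (cs _ hT) !big_cons /=.
rewrite characterM mulrDr opprD addrACA [a * _]mulrCA subrr add0r.
rewrite mulr_sumr -sumrB mulr_sumr.
by apply: eq_bigr => t _; rewrite characterM; field; exact: d0.
Qed.

End Characters.

(** * Derivations *)

Section Derivations.
Variables (K : fieldType) (N : nat).
Local Notation R := {mpoly K[N]}.
Implicit Types (a b c d p q : R) (S : R -> Prop) (f g : R -> R).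

Definition is_der S f : Prop :=
  (forall (t : K) a b, S a -> S b -> f (t *: a + b) = t *: f a + f b) /\
  (forall a b, S a -> S b -> f (a * b) = f a * b + a * f b).

Definition anyp : R -> Prop := fun=> True.

Lemma is_der_sub S S' f : (forall a, S a -> S' a) -> is_der S' f -> is_der S f.
Proof.
by move=> SS [hl hm]; split=> [t a b /SS Sa /SS Sb|a b /SS Sa /SS Sb]; [apply: hl|apply: hm].
Qed.

Lemma is_der_comb S p q f g : is_der S f -> is_der S g ->
  is_der S (fun a => p * f a + q * g a).
Proof.
move=> [fl fm] [gl gm]; split=> [t a b Sa Sb|a b Sa Sb].
  by rewrite fl // gl // !mulrDr !scalerDr -!scalerAr addrACA.
by rewrite fm // gm //; ring.
Qed.

Lemma is_der_eq S f g : (forall a, S a -> f a = g a) -> linclosed S -> mulclosed S ->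
  is_der S f -> is_der S g.
Proof.
move=> fg hL hM [fl fm]; split=> [t a b Sa Sb|a b Sa Sb].
  by rewrite -!fg // ?fl //; case: hL => _; apply.
by rewrite -!fg // ?fm //; apply: hM.
Qed.

Lemma is_der0 S f : S 0 -> is_der S f -> f 0 = 0.
Proof.
move=> S0 [_ hm]; by rewrite -{1}(mulr0 0) hm // mulr0 mul0r addr0.
Qed.

Lemma is_derD S f a b : is_der S f -> S a -> S b -> f (a + b) = f a + f b.
Proof. by move=> [h _] Sa Sb; have := h 1 a b Sa Sb; rewrite !scale1r. Qed.

Lemma is_derZ S f (t : K) a : S 0 -> is_der S f -> S a -> f (t *: a) = t *: f a.
Proof.
move=> S0 hf Sa; have := hf.1 t a 0 Sa S0.
by rewrite addr0 (is_der0 S0 hf) addr0.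
Qed.

Lemma is_derN S f a : S 0 -> is_der S f -> S a -> f (- a) = - f a.
Proof. by move=> S0 hf Sa; rewrite -scaleN1r (is_derZ _ S0 hf) // scaleN1r. Qed.

Lemma is_der1 S f : S 1 -> is_der S f -> f 1 = 0.
Proof.
move=> S1 [_ hm]; have := hm 1 1 S1 S1; rewrite !mulr1 mul1r => /eqP.
by rewrite -subr_eq subrr eq_sym => /eqP.
Qed.

Lemma is_der_ext A f g a : is_der (polysub A) f -> is_der (polysub A) g ->
  (forall i, i \in A -> f 'X_i = g 'X_i) -> polysub A a -> f a = g a.
Proof.
move=> hf hg fg Aa; have S0 := (polysub_lin K A).1; have S1 := @polysub1 K N A.
suff [] : polysub A a /\ f a = g a by [].
move: Aa; apply: (@polysub_ind _ _ A (fun a => polysub A a /\ f a = g a)).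
- split=> [|t b c [Ab eb] [Ac ec]]; first by rewrite !(is_der0 S0).
  by split; [apply: (polysub_lin K A).2|rewrite hf.1 // hg.1 // eb ec].
- move=> b c [Ab eb] [Ac ec].
  by split; [apply: polysubM|rewrite hf.2 // hg.2 // eb ec].
- by rewrite (is_der1 S1 hf) (is_der1 S1 hg).
- by move=> i iA; split; [apply: polysubX|apply: fg].
Qed.

Lemma is_der_extT f g a : is_der anyp f -> is_der anyp g ->
  (forall i, f 'X_i = g 'X_i) -> f a = g a.
Proof.
move=> hf hg fg; apply: (@is_der_ext [set: 'I_N]) => //; last exact: polysubT.
  exact: is_der_sub hf.
exact: is_der_sub hg.
Qed.

Lemma is_der_stable A (B : {set 'I_N}) f a : is_der (polysub A) f -> {subset A <= B} ->
  (forall i, i \in A -> polysub B (f 'X_i)) -> polysub A a -> polysub B (f a).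
Proof.
move=> hf AB fX Aa; have S0 := (polysub_lin K A).1; have S1 := @polysub1 K N A.
suff [] : polysub A a /\ polysub B (f a) by [].
move: Aa; apply: (@polysub_ind _ _ A (fun a => polysub A a /\ polysub B (f a))).
- split=> [|t b c [Ab eb] [Ac ec]].
    by split=> //; rewrite (is_der0 S0 hf); case: (polysub_lin K B).
  by split; [apply: (polysub_lin K A).2|rewrite hf.1 //; apply: (polysub_lin K B).2].
- move=> b c [Ab eb] [Ac ec]; split; first exact: polysubM.
  rewrite hf.2 //; apply: (linclosedD (polysub_lin K B)).
    by apply: polysubM => //; apply: polysubS Ac.
  by apply: polysubM => //; apply: polysubS Ab.
- by split=> //; rewrite (is_der1 S1 hf); case: (polysub_lin K B).
- by move=> i iA; split; [apply: polysubX|apply: fX].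
Qed.

Lemma is_der_mderiv i : is_der anyp (mderiv i).
Proof.
split=> [t a b _ _|a b _ _]; first by rewrite mderivD mderivZ.
exact: mderivM.
Qed.

Lemma is_der_sum S (I : Type) (s : seq I) (F : I -> R -> R) :
  (forall i, is_der S (F i)) -> is_der S (fun a => \sum_(i <- s) F i a).
Proof.
move=> hF; split=> [t a b Sa Sb|a b Sa Sb].
  by rewrite scaler_sumr -big_split; apply: eq_bigr => i _; rewrite (hF i).1.
rewrite mulr_suml mulr_sumr -big_split; apply: eq_bigr => i _; exact: (hF i).2.
Qed.

Lemma is_der_scale S p f : is_der S f -> is_der S (fun a => p * f a).
Proof.
move=> [fl fm]; split=> [t a b Sa Sb|a b Sa Sb].
  by rewrite fl // mulrDr scalerAr.
by rewrite fm //; ring.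
Qed.

Lemma mderivXX (i j : 'I_N) : mderiv i 'X_j = (i == j)%:R :> R.
Proof.
rewrite mderivX mnm1E eq_sym; case: eqP => [->|_]; last by rewrite scale0r.
rewrite scale1r -(mpolyX0 N K); congr 'X_[_]; apply/mnmP => k.
by rewrite mnmBE subnn mnm0E.
Qed.

Lemma is_derE f a : is_der anyp f -> f a = \sum_i mderiv i a * f 'X_i.
Proof.
move=> hf; apply: (is_der_extT (g := fun a => \sum_i mderiv i a * f 'X_i)) => //.
  have h : is_der anyp (fun a => \sum_i f 'X_i * mderiv i a).
    by apply: is_der_sum => i; apply/is_der_scale/is_der_mderiv.
  apply: is_der_eq h => // b _; apply: eq_bigr => i _; exact: mulrC.
move=> i; rewrite (bigD1 i) //= mderivXX eqxx mul1r big1 ?addr0 // => j ji.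
by rewrite mderivXX (negbTE ji) mul0r.
Qed.

Lemma mderiv_polysub0 A i a : polysub A a -> i \notin A -> mderiv i a = 0.
Proof.
move=> Aa iA; apply/mpolyP => m; rewrite mcoeff_deriv mcoeff0.
by rewrite (mcoeff_polysub Aa _ iA) ?mul0rn // mnmDE mnm1E eqxx addn1.
Qed.

End Derivations.

Arguments anyp {K N}.

Section Bracket.
Variables (K : fieldType) (N : nat).
Local Notation R := {mpoly K[N]}.
Implicit Types (a b c d : R).
Variable br : R -> R -> R.
Hypothesis hbr : poisson_bracket br.

Lemma br_der d : is_der anyp (br^~ d).
Proof.
split=> [t a b _ _|a b _ _]; first exact: (pb_linear hbr).
by rewrite (pb_leibniz hbr) addrC.
Qed.

Lemma br0l d : br 0 d = 0. Proof. exact: (is_der0 (S := anyp) I (br_der d)). Qed.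
Lemma br1l d : br 1 d = 0. Proof. exact: (is_der1 (S := anyp) I (br_der d)). Qed.
Lemma brDl a b d : br (a + b) d = br a d + br b d.
Proof. exact: (is_derD (br_der d)). Qed.
Lemma brZl t a d : br (t *: a) d = t *: br a d.
Proof. exact: (is_derZ t (S := anyp) I (br_der d)). Qed.
Lemma brNl a d : br (- a) d = - br a d.
Proof. exact: (is_derN (S := anyp) I (br_der d)). Qed.
Lemma brBl a b d : br (a - b) d = br a d - br b d.
Proof. by rewrite brDl brNl. Qed.
Lemma brMl a b d : br (a * b) d = br a d * b + a * br b d.
Proof. exact: (br_der d).2. Qed.

End Bracket.

(** * Brackets of generators and weights of monomials *)

Lemma natmul_inj0 (K : fieldType) (x : K) : [pchar K] =i pred0 -> x != 0 ->
  injective (GRing.natmul x).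
Proof.
move=> /pcharf0P ch x0 a b; wlog ab : a b / (a <= b)%N.
  by move=> h; case/orP: (leq_total a b) => [/h|/h e /esym /e].
rewrite -{1}(subnK ab) mulrnDr -[LHS]add0r => /addIr /esym /eqP.
rewrite -mulr_natr mulf_eq0 (negbTE x0) ch subn_eq0 /= => ba.
by apply/eqP; rewrite eqn_leq ab ba.
Qed.

Lemma mderiv0_polysub (K : fieldType) (N : nat) (A : {set 'I_N}) i (a : {mpoly K[N]}) :
  [pchar K] =i pred0 -> polysub A a -> mderiv i a = 0 -> polysub (A :\ i) a.
Proof.
move=> charK Aa di m k ma mk; rewrite !inE (Aa _ _ ma mk) andbT.
apply: contraTneq ma => ki; subst k.
have : (mderiv i a)@_(m - U_(i)) = 0 by rewrite di mcoeff0.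
have mE : (m - U_(i) + U_(i))%MM = m.
  by apply/mnmP => k; rewrite mnmDE mnmBE mnm1E; case: (i =P k) => [<-|_]; lia.
rewrite mcoeff_deriv mE -mulr_natl mcoeff_msupp negbK => /eqP; rewrite mulf_eq0.
by case/orP=> //; move/pcharf0P: charK => ->.
Qed.

Section Linear.
Variables (K : fieldType) (V : lmodType K) (f : V -> V).
Hypothesis fl : linear f.

Lemma lin0 : f 0 = 0.
Proof. by have := fl (-1) 0 0; rewrite !scaleN1r !addNr. Qed.

Lemma linZ t v : f (t *: v) = t *: f v.
Proof. by have := fl t v 0; rewrite lin0 !addr0. Qed.

Lemma lin_sum (I : Type) (s : seq I) (F : I -> V) :
  f (\sum_(i <- s) F i) = \sum_(i <- s) f (F i).
Proof.
elim: s => [|i s IH]; first by rewrite !big_nil lin0.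
by rewrite !big_cons -IH; have := fl 1 (F i) (\sum_(j <- s) F j); rewrite !scale1r.
Qed.

End Linear.

Section Below.
Variable N : nat.

Definition below (k : nat) : {set 'I_N} := [set i : 'I_N | (i < k)%N].

Lemma before_id (k : 'I_N) : before id k = below k.
Proof.
by apply/setP => i; rewrite !inE; apply/imsetP/idP => [[j]|ik];
  [rewrite inE => jk ->|exists i; rewrite ?inE].
Qed.

Lemma upto_id (k : 'I_N) : upto id k = below k.+1.
Proof.
by apply/setP => i; rewrite !inE; apply/imsetP/idP => [[j]|ik];
  [rewrite inE => jk ->|exists i; rewrite ?inE].
Qed.

Lemma belowS (k l : nat) : (k <= l)%N -> {subset below k <= below l}.
Proof. by move=> kl i; rewrite !inE => ik; apply: leq_trans ik kl. Qed.

End Below.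

Section PCGL.
Variables (K : fieldType) (N r : nat).
Hypothesis charK : [pchar K] =i pred0.
Local Notation R := {mpoly K[N]}.
Local Notation mon := 'X_{1..N}.
Variables (br : R -> R -> R) (act lie : {ffun 'I_r -> K} -> R -> R).
Variables (sigma delta : 'I_N -> R -> R) (lam : 'I_N -> 'I_N -> K).
Hypothesis Rpcgl : pcgl br act lie sigma delta lam.
Hypothesis Rsym : symmetric_pcgl lie delta lam.
Implicit Types (a b c d p q v : R) (m f g : mon) (i j k l : 'I_N).

Local Notation below := (@below N).

Lemma pbr : poisson_bracket br.
Proof. exact: (ipo_poisson (pcgl_ore Rpcgl)). Qed.

Lemma brXE k b : polysub (below k) b -> br 'X_k b = sigma k b * 'X_k + delta k b.
Proof. by rewrite -before_id; exact: (ipo_bracket (pcgl_ore Rpcgl)). Qed.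

(** Both [sigma_k] and [delta_k] are derivations. This is where linearity and the
    Leibniz rule in the second argument of the bracket come from. *)
Lemma brX_der k : is_der (polysub (below k)) (br 'X_k).
Proof.
have hs : is_der (polysub (below k)) (sigma k).
  rewrite -before_id; case: (ipo_sigma (pcgl_ore Rpcgl) k) => -[_ h1 h2] _.
  by split=> [t a b Sa Sb|a b Sa Sb]; [apply: h1|apply: h2].
have hd : is_der (polysub (below k)) (delta k).
  rewrite -before_id; case: (ipo_delta (pcgl_ore Rpcgl) k) => -[_ h1 h2] _.
  by split=> [t a b Sa Sb|a b Sa Sb]; [apply: h1|apply: h2].
apply: is_der_eq (is_der_comb 'X_k 1 hs hd).
- by move=> a Sa; rewrite brXE // mul1r mulrC.
- exact: polysub_lin.
- exact: polysubM.
Qed.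

Lemma brXX k j : (j < k)%N -> br 'X_k 'X_j = lam k j *: ('X_j * 'X_k) + delta k 'X_j.
Proof.
move=> jk; rewrite brXE ?(pcgl_lam Rpcgl) // -?scalerAl //.
by apply: polysubX; rewrite inE.
Qed.

Lemma deltaX j k : (j < k)%N -> polysub (iset N j.+1 k.-1) (delta k 'X_j).
Proof. exact: (sym_delta Rsym). Qed.

Lemma deltaX_coef j k m i : (j < k)%N -> m i != 0%N -> ~~ (j < i < k)%N ->
  (delta k 'X_j)@_m = 0.
Proof.
move=> jk mi ni; apply: (mcoeff_polysub (deltaX jk) mi).
rewrite inE; move: ni jk; lia.
Qed.

Lemma brXX_stable k j : (j < k)%N -> polysub (below k.+1) (br 'X_k 'X_j).
Proof.
move=> jk; rewrite brXX //; apply: (linclosedD (polysub_lin K _)).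
  apply: (linclosedZ _ (polysub_lin K _)); apply: polysubM; apply: polysubX;
  rewrite inE; lia.
apply: polysubS (deltaX jk) => i; rewrite !inE; lia.
Qed.

Lemma brXC k (c : K) : br 'X_k c%:MP = 0.
Proof.
have S0 : polysub (below k) (0 : R) by case: (polysub_lin K (below k)).
have S1 := @polysub1 K N (below k).
rewrite -[c%:MP]mulr1 mul_mpolyC (is_derZ c S0 (brX_der k) S1).
by rewrite (is_der1 S1 (brX_der k)) scaler0.
Qed.

Definition central k : bool :=
  [forall j : 'I_N, (j < k)%N ==> (br 'X_k 'X_j == 0)].

Lemma centralP k : reflect (forall j, (j < k)%N -> br 'X_k 'X_j = 0) (central k).
Proof.
apply: (iffP forallP) => h j; last by apply/implyP => /h ->.
by move=> jk; apply/eqP; have := h j; rewrite jk.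
Qed.

Lemma lam_coef k j : (j < k)%N -> (br 'X_k 'X_j)@_(U_(j) + U_(k)) = lam k j.
Proof.
move=> jk; rewrite brXX // mcoeffD mcoeffZ -mpolyXD mcoeffX eqxx mulr1.
rewrite (deltaX_coef (i := k)) ?addr0 //; first by rewrite mnmDE !mnm1E eqxx addn1.
by rewrite ltnn andbF.
Qed.

Lemma central_lam k j : central k -> (j < k)%N -> lam k j = 0.
Proof. by move=> /centralP h jk; rewrite -(lam_coef jk) h // mcoeff0. Qed.

Lemma act_lin h : in_torus h -> linear (act h).
Proof. exact: (act_linear (pcgl_action Rpcgl)). Qed.

Lemma weights_exist : exists w : 'I_N -> 'I_r -> int,
  forall i h, in_torus h -> act h 'X_i = character (w i) h *: 'X_i.
Proof.
have hact := pcgl_action Rpcgl.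
have key i : exists u : 'I_r -> int,
    forall h, in_torus h -> act h 'X_i = character u h *: 'X_i.
  pose c h := (act h 'X_i)@_U_(i).
  have cE h : in_torus h -> act h 'X_i = c h *: 'X_i.
    have [_ hom] := pcgl_eigen Rpcgl i.
    by move/hom=> [t e]; rewrite /c e mcoeffZ mcoeffX eqxx mulr1.
  have [s hs] := act_rational hact 'X_i.
  have [] := @dedekind K r c [seq (t.1, (t.2)@_U_(i)) | t <- s].
  - move=> g h hg hh; have e : act (tmul g h) 'X_i = (c h * c g) *: 'X_i.
      by rewrite (act_mul hact) // (cE _ hh) (linZ (act_lin hg)) (cE _ hg) scalerA.
    by rewrite {1}/c e mcoeffZ mcoeffX eqxx mulr1 mulrC.
  - by rewrite /c (act_one hact) mcoeffX eqxx oner_neq0.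
  - move=> h hh; rewrite /c hs // raddf_sum big_map; apply: eq_bigr => t _ /=.
    by rewrite mcoeffZ mulrC.
  by move=> u hu; exists u => h hh; rewrite cE // hu.
exact: (fin_all_exists key).
Qed.

(** The value at the weight of [x^m] of the linear functional that takes the
    value [om i] at the weight of [x_i]. *)
Definition wtf (om : 'I_N -> K) m : K := \sum_i om i *+ m i.

Lemma wtfD om f g : wtf om (f + g) = wtf om f + wtf om g.
Proof. by rewrite -big_split; apply: eq_bigr => i _; rewrite mnmDE mulrnDr. Qed.

Lemma wtfU om i : wtf om U_(i) = om i.
Proof.
rewrite /wtf (bigD1 i) //= mnm1E eqxx big1 ?addr0 // => j ji.
by rewrite mnm1E eq_sym (negbTE ji).
Qed.

Section Weights.
Variable w : 'I_N -> 'I_r -> int.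
Hypothesis wP : forall i h, in_torus h -> act h 'X_i = character (w i) h *: 'X_i.

Definition mchar m h : K := \prod_i character (w i) h ^+ m i.

Lemma mcharD f g h : mchar (f + g) h = mchar f h * mchar g h.
Proof. by rewrite -big_split; apply: eq_bigr => i _; rewrite mnmDE exprD. Qed.

Lemma mcharU i h : mchar U_(i) h = character (w i) h.
Proof.
rewrite /mchar (bigD1 i) //= mnm1E eqxx expr1 big1 ?mulr1 // => j ji.
by rewrite mnm1E eq_sym (negbTE ji).
Qed.

Lemma mcharE m h : in_torus h ->
  mchar m h = character (fun l : 'I_r => \sum_i w i l *+ m i) h.
Proof.
move=> hh; rewrite /mchar /character; under eq_bigr do rewrite -prodrXl.
rewrite exchange_big /=; apply: eq_bigr => l _.
have -> : h l ^ (\sum_i w i l *+ m i) = \prod_i h l ^ (w i l *+ m i).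
  elim/big_rec2: _ => [|i x y _ <-]; first by rewrite expr0z.
  by rewrite expfzDr.
apply: eq_bigr => i _; by rewrite -mulr_natr natz -exprz_exp -exprnP.
Qed.

Lemma act_mon m h : in_torus h -> act h 'X_[m] = mchar m h *: 'X_[m].
Proof.
have hact := pcgl_action Rpcgl; move=> hh; rewrite mpolyXE_id /mchar.
elim: (index_enum _) => [|i s IH]; first by rewrite !big_nil scale1r (act_ring1 hact).
have e : act h ('X_i ^+ m i) = (character (w i) h ^+ m i) *: 'X_i ^+ m i.
  elim: (m i) => [|e IHe]; first by rewrite !expr0 scale1r (act_ring1 hact).
  by rewrite !exprS (act_ringM hact) // IHe wP // -scalerAl -scalerAr scalerA.
by rewrite !big_cons (act_ringM hact) // IH e -scalerAl -scalerAr scalerA.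
Qed.

Lemma mcoeff_act v h m : in_torus h -> (act h v)@_m = mchar m h * v@_m.
Proof.
move=> hh; rewrite {1}(mpolyE v) (lin_sum (act_lin hh)) raddf_sum /=.
under eq_bigr do rewrite (linZ (act_lin hh)) act_mon // !mcoeffZ mcoeffX.
case: (boolP (m \in msupp v)) => mv.
  rewrite (bigD1_seq m) ?msupp_uniq //= eqxx mulr1 mulrC big1 ?addr0 // => f fm.
  by rewrite (negbTE fm) !mulr0.
rewrite big_seq big1 => [|f fv].
  by move: mv; rewrite mcoeff_msupp negbK => /eqP ->; rewrite mulr0.
by case: eqP mv => [<-|]; rewrite ?fv // !mulr0.
Qed.

Lemma homog_act v f h : homogeneous act v -> f \in msupp v -> in_torus h ->
  act h v = mchar f h *: v.
Proof.
move=> hv fv hh; have [c e] := hv h hh; rewrite e; congr (_ *: _).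
have := congr1 (mcoeff f) e; rewrite mcoeff_act // mcoeffZ => /mulIf -> //.
by rewrite -mcoeff_msupp.
Qed.

Lemma homogI v : (forall h, in_torus h -> exists c : K,
  forall m, m \in msupp v -> mchar m h = c) -> homogeneous act v.
Proof.
move=> H h hh; have [c hc] := H h hh; exists c; apply/mpolyP => m.
rewrite mcoeff_act // mcoeffZ; case: (boolP (m \in msupp v)) => [/hc -> //|].
by rewrite mcoeff_msupp negbK => /eqP ->; rewrite !mulr0.
Qed.

Lemma homogX m : homogeneous act 'X_[m].
Proof.
by apply: homogI => h hh; exists (mchar m h) => f; rewrite msuppX inE => /eqP ->.
Qed.

(** The eigenvalue of [xi] on [x_i]. *)
Definition pairing (xi : {ffun 'I_r -> K}) i : K := \sum_(l < r) (w i l)%:~R * xi l.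

Lemma lie_homog v f xi : homogeneous act v -> f \in msupp v ->
  lie xi v = wtf (pairing xi) f *: v.
Proof.
move=> hv fv.
rewrite (@diff_weight _ _ _ _ _ (pcgl_lie Rpcgl) xi (fun l : 'I_r => \sum_i w i l *+ f i)).
  congr (_ *: _); rewrite /wtf /pairing; under [RHS]eq_bigr do rewrite -sumrMnl.
  rewrite exchange_big /=; apply: eq_bigr => l _.
  rewrite raddf_sum /= mulr_suml; apply: eq_bigr => i _.
  by rewrite raddfMn /= mulrnAl.
by move=> h hh; rewrite -mcharE //; apply: homog_act.
Qed.

Lemma lieX i xi : lie xi 'X_i = pairing xi i *: 'X_i.
Proof.
rewrite (@lie_homog 'X_i U_(i)) ?wtfU //; first exact: homogX.
by rewrite msuppX inE.
Qed.

Lemma homog_wt v f g xi : homogeneous act v -> f \in msupp v -> g \in msupp v ->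
  wtf (pairing xi) f = wtf (pairing xi) g.
Proof.
move=> hv fv gv; have := lie_homog xi hv fv; rewrite (lie_homog xi hv gv).
move/(congr1 (mcoeff f)); rewrite !mcoeffZ => /mulIf -> //.
by rewrite -mcoeff_msupp.
Qed.

Lemma pairing_eigen i xi (t : K) : lie xi 'X_i = t *: 'X_i -> pairing xi i = t.
Proof.
rewrite lieX => /(congr1 (mcoeff U_(i))); rewrite !mcoeffZ mcoeffX eqxx.
by rewrite !mulr1.
Qed.

Lemma hk_exist : exists hs : 'I_N -> {ffun 'I_r -> K}, forall k,
  pairing (hs k) k != 0 /\ forall j, (j < k)%N -> pairing (hs k) j = lam k j.
Proof.
apply: (fin_all_exists (P := fun k (h : {ffun 'I_r -> K}) => pairing h k != 0 /\
  forall j, (j < k)%N -> pairing h j = lam k j)) => k.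
have [h [h1 [l [l0 hl]]]] := pcgl_h Rpcgl k; exists h; split.
  by rewrite (pairing_eigen hl).
move=> j jk; apply: pairing_eigen; rewrite -h1 ?(pcgl_lam Rpcgl) //.
by rewrite before_id; apply: polysubX; rewrite inE.
Qed.

Lemma hkstar_exist : exists hs : 'I_N -> {ffun 'I_r -> K}, forall j,
  pairing (hs j) j != 0 /\ forall k, (j < k)%N -> pairing (hs j) k = - lam k j.
Proof.
apply: (fin_all_exists (P := fun j (h : {ffun 'I_r -> K}) => pairing h j != 0 /\
  forall k, (j < k)%N -> pairing h k = - lam k j)) => j.
have [h [h1 [l [l0 hl]]]] := sym_h Rsym j; exists h; split.
  by rewrite (pairing_eigen hl).
by move=> k /h1 e; apply: pairing_eigen.
Qed.

Lemma character_nontrivial i :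
  exists2 h : {ffun 'I_r -> K}, in_torus h & character (w i) h != 1.
Proof.
have [hs hsP] := hk_exist; apply: NNPP => nex.
have := (hsP i).1; suff -> : pairing (hs i) i = 0 by rewrite eqxx.
apply: pairing_eigen.
have e : forall h, in_torus h -> act h 'X_i = character (fun=> 0) h *: 'X_i.
  move=> h hh; rewrite wP // character0; congr (_ *: _).
  by apply/eqP/negPn/negP => e; apply: nex; exists h.
rewrite (diff_weight (pcgl_lie Rpcgl) (hs i) e).
by rewrite big1 // => l _; rewrite mul0r.
Qed.

(** At the top index where two exponents of equal weights differ, the variable
    is not central: [h_k] has weight zero on all the variables before a central
    [x_k], and non-zero weight on [x_k]. *)
Lemma wt_top_diff f g k : (forall xi, wtf (pairing xi) f = wtf (pairing xi) g) ->
  (forall i, (k < i)%N -> f i = g i) -> central k -> f k = g k.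
Proof.
move=> efg hi ck; have [hs hsP] := hk_exist; have [k0 klam] := hsP k.
apply: (natmul_inj0 charK k0); have := efg (hs k).
rewrite /wtf (bigD1 k) //= [in RHS](bigD1 k) //=.
have -> : \sum_(i < N | i != k) pairing (hs k) i *+ f i =
    \sum_(i < N | i != k) pairing (hs k) i *+ g i.
  apply: eq_bigr => i ik; case: (ltngtP i k) => [ik'|/hi -> //|/val_inj e].
    by rewrite klam // central_lam // !mul0rn.
  by rewrite e eqxx in ik.
by move/addIr.
Qed.

Lemma wt_eq_central f g (A : {set 'I_N}) : (forall xi, wtf (pairing xi) f = wtf (pairing xi) g) ->
  (forall i, i \notin A -> f i = g i) -> (forall i, i \in A -> central i) -> f = g.
Proof.
move=> efg hA cA; case: (eqVneq f g) => // fg.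
have main f' g' : (forall xi, wtf (pairing xi) f' = wtf (pairing xi) g') ->
    (forall i, i \notin A -> f' i = g' i) -> ~ lto (@nat_of_ord N) f' g'.
  move=> e hA' [k [k1 k2]]; have kA : k \in A.
    by apply: contraLR k1 => /hA' ->; rewrite ltnn.
  by move: k1; rewrite (wt_top_diff e k2 (cA _ kA)) ltnn.
case: (lto_total (@nat_of_ord N) fg) => /main []//.
by move=> i /hA.
Qed.


End Weights.
End PCGL.

(** * Predecessors, successors and chains *)

Section Chains.
Variables (N : nat) (eta : 'I_N -> int).
Implicit Types (i j k : 'I_N) (m : nat).

Lemma pred_etaP k j : pred_eta eta k = Some j ->
  [/\ (j < k)%N, eta j = eta k & forall i, (i < k)%N -> eta i = eta k -> (i <= j)%N].
Proof.
rewrite /pred_eta; case: pickP => // x /and3P [xk /eqP ex /forallP h] [<-].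
by split=> // i ik ei; have := h i; rewrite ik ei eqxx.
Qed.

Lemma succ_etaP k j : succ_eta eta k = Some j ->
  [/\ (k < j)%N, eta j = eta k & forall i, (k < i)%N -> eta i = eta k -> (j <= i)%N].
Proof.
rewrite /succ_eta; case: pickP => // x /and3P [xk /eqP ex /forallP h] [<-].
by split=> // i ik ei; have := h i; rewrite ik ei eqxx.
Qed.

Lemma pred_etaI k j : (j < k)%N -> eta j = eta k ->
  (forall i, (i < k)%N -> eta i = eta k -> (i <= j)%N) -> pred_eta eta k = Some j.
Proof.
move=> jk ej h; rewrite /pred_eta; case: pickP => [x /and3P [xk /eqP ex /forallP hx]|].
  congr Some; apply/val_inj/eqP; rewrite /= eqn_leq h //.
  by have := hx j; rewrite jk ej eqxx.
move/(_ j); rewrite jk ej eqxx /= => /negP []; apply/forallP => i.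
by apply/implyP => /andP [ik /eqP ei]; apply: h.
Qed.

Lemma succ_etaI k j : (k < j)%N -> eta j = eta k ->
  (forall i, (k < i)%N -> eta i = eta k -> (j <= i)%N) -> succ_eta eta k = Some j.
Proof.
move=> jk ej h; rewrite /succ_eta; case: pickP => [x /and3P [xk /eqP ex /forallP hx]|].
  congr Some; apply/val_inj/eqP; rewrite /= eqn_leq andbC h //.
  by have := hx j; rewrite jk ej eqxx.
move/(_ j); rewrite jk ej eqxx /= => /negP []; apply/forallP => i.
by apply/implyP => /andP [ik /eqP ei]; apply: h.
Qed.

Lemma pred_eta_None k j : pred_eta eta k = None -> (j < k)%N -> eta j <> eta k.
Proof.
move=> hk jk ej; pose P i := (i < k)%N && (eta i == eta k).
have Pj : P j by rewrite /P jk ej eqxx.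
case: (@arg_maxnP _ j P (@nat_of_ord N) Pj) => i /andP [ik /eqP ei] imax.
rewrite (@pred_etaI k i) // in hk => l lk el; apply: imax; rewrite /P lk.
by apply/eqP.
Qed.

Lemma succ_eta_None k j : succ_eta eta k = None -> (k < j)%N -> eta j <> eta k.
Proof.
move=> hk jk ej; pose P i := (k < i)%N && (eta i == eta k).
have Pj : P j by rewrite /P jk ej eqxx.
case: (@arg_minnP _ j P (@nat_of_ord N) Pj) => i /andP [ik /eqP ei] imax.
rewrite (@succ_etaI k i) // in hk => l lk el; apply: imax; rewrite /P lk.
by apply/eqP.
Qed.

Lemma pred_succ k j : pred_eta eta k = Some j -> succ_eta eta j = Some k.
Proof.
case/pred_etaP=> jk ej h; apply: succ_etaI => // i ji ei.
by rewrite leqNgt; apply/negP => /h; rewrite ei => /(_ ej); rewrite leqNgt ji.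
Qed.

Lemma succ_pred k j : succ_eta eta j = Some k -> pred_eta eta k = Some j.
Proof.
case/succ_etaP=> jk ej h; apply: pred_etaI => // i ji ei.
by rewrite leqNgt; apply/negP => /h; rewrite ei => /(_ ej); rewrite leqNgt ji.
Qed.

Lemma class_top k : exists j, [/\ (k <= j)%N, eta j = eta k & succ_eta eta j = None].
Proof.
pose P i := eta i == eta k; have Pk : P k by rewrite /P.
case: (@arg_maxnP _ k P (@nat_of_ord N) Pk) => i /eqP ei imax.
exists i; split=> //; first exact: imax.
case e: (succ_eta eta i) => [j|] //; have [ij ej _] := succ_etaP e.
have ji : (j <= i)%N by apply: imax; rewrite /P ej ei.
by rewrite leqNgt ij in ji.
Qed.

Lemma pred_iterS l k j : pred_eta eta k = Some j ->
  pred_iter eta l.+1 k = pred_iter eta l j.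
Proof. by move=> e; rewrite /pred_iter iterSr /= e. Qed.

Lemma succ_iterS l k j : succ_eta eta k = Some j ->
  succ_iter eta l.+1 k = succ_iter eta l j.
Proof. by move=> e; rewrite /succ_iter iterSr /= e. Qed.

Lemma iter_None (f : 'I_N -> option 'I_N) l : iter l (obind f) None = None.
Proof. by elim: l => //= l ->. Qed.

Lemma pred_iter_le l k j : pred_iter eta l k = Some j ->
  eta j = eta k /\ (j + l <= k)%N.
Proof.
elim: l k => [|l IH] k; first by case=> ->; rewrite addn0.
case e: (pred_eta eta k) => [k'|]; last by rewrite /pred_iter iterSr /= e iter_None.
rewrite (pred_iterS _ e) => /IH [-> h]; have [k'k -> _] := pred_etaP e; split=> //.
lia.
Qed.

Lemma succ_iter_le l k j : succ_iter eta l k = Some j ->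
  eta j = eta k /\ (k + l <= j)%N.
Proof.
elim: l k => [|l IH] k; first by case=> ->; rewrite addn0.
case e: (succ_eta eta k) => [k'|]; last by rewrite /succ_iter iterSr /= e iter_None.
rewrite (succ_iterS _ e) => /IH [-> h]; have [k'k -> _] := succ_etaP e; split=> //.
lia.
Qed.

Lemma pred_iter_lt l l' k j j' : (l < l')%N -> pred_iter eta l k = Some j ->
  pred_iter eta l' k = Some j' -> (j' < j)%N.
Proof.
move=> ll' e; have -> : l' = ((l' - l.+1).+1 + l)%N by lia.
rewrite /pred_iter iterD -/(pred_iter eta l k) e -/(pred_iter eta _ j).
by case/pred_iter_le; lia.
Qed.

Lemma succ_iter_lt l l' k j j' : (l < l')%N -> succ_iter eta l k = Some j ->
  succ_iter eta l' k = Some j' -> (j < j')%N.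
Proof.
move=> ll' e; have -> : l' = ((l' - l.+1).+1 + l)%N by lia.
rewrite /succ_iter iterD -/(succ_iter eta l k) e -/(succ_iter eta _ j).
by case/succ_iter_le; lia.
Qed.

Lemma succ_iter_inj l l' k j : succ_iter eta l k = Some j ->
  succ_iter eta l' k = Some j -> l = l'.
Proof.
move=> e e'; case: (ltngtP l l') => // h.
  by have := succ_iter_lt h e e'; rewrite ltnn.
by have := succ_iter_lt h e' e; rewrite ltnn.
Qed.

Definition segment j k : 'X_{1..N} :=
  [multinom nat_of_bool ((j <= i <= k)%N && (eta i == eta k)) | i < N].

(** Going down from [k] by predecessors meets every earlier element of its class,
    so the product over the chain is the product over a segment of the class. *)
Lemma chainP j k : (j <= k)%N -> eta j = eta k ->
  exists m, [/\ pred_iter eta m k = Some j, succ_iter eta m j = Some k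
              & chain_mnm eta j m = segment j k].
Proof.
have [s sk] := ubnP k; elim: s k sk => // s IH k sk jk ej.
case: (ltngtP j k) jk => // [jk _|/val_inj <- _]; last first.
  exists 0%N; split=> //; rewrite /chain_mnm big_ord1 /=.
  apply/mnmP => i; rewrite mnm1E mnmE -eqn_leq.
  by rewrite -[(j == i :> nat)]/(j == i); case: eqP => [->|//]; rewrite eqxx.
case e: (pred_eta eta k) => [k'|]; last by case: (pred_eta_None e jk).
have [k'k ek' k'max] := pred_etaP e.
have jk' := k'max _ jk ej.
have [|//||m [m1 m2 m3]] := IH k'; [lia|by rewrite ek'|].
exists m.+1; split; first by rewrite (pred_iterS _ e).
  by rewrite /succ_iter iterS -/(succ_iter eta m j) m2 /= (pred_succ e).
rewrite /chain_mnm big_ord_recr /= -/(chain_mnm eta j m) m3.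
have -> : obind (succ_eta eta) (succ_iter eta m j) = Some k.
  by rewrite m2 /= (pred_succ e).
apply/mnmP => i; rewrite mnmDE mnm1E !mnmE ek'.
case: (ltngtP i k) => [ik|ik|/val_inj ->].
- rewrite (_ : (k == i) = false) ?addn0; last by apply/eqP => ki; rewrite ki ltnn in ik.
  case: (eqVneq (eta i) (eta k)) => [ei|]; last by rewrite !andbF.
  by rewrite (k'max _ ik ei).
- rewrite (_ : (k == i) = false) ?addn0; last by apply/eqP => ki; rewrite ki ltnn in ik.
  have -> : (i <= k')%N = false by lia.
  by rewrite andbF.
- by rewrite !eqxx [(k <= k')%N]leqNgt k'k andbF /= (ltnW jk).
Qed.

End Chains.

(** * Leading monomials of a sequence of prime elements *)

Section SequenceLeading.
Variables (K : fieldType) (N r : nat).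
Local Notation R := {mpoly K[N]}.
Variables (br : R -> R -> R) (act : {ffun 'I_r -> K} -> R -> R).
Variables (o q : 'I_N -> 'I_N) (eta : 'I_N -> int) (y : 'I_N -> R).
Hypotheses (oK : cancel o q) (qK : cancel q o).
Hypothesis yP : prime_sequence br act o eta y.
Implicit Types (i j k : 'I_N).

Definition opos i : nat := q i.

Lemma opos_inj : injective opos.
Proof. by move=> i j /val_inj /(congr1 o); rewrite !qK. Qed.

Lemma in_before i k : (i \in before o k) = (q i < k)%N.
Proof.
apply/imsetP/idP => [[j]|ik]; first by rewrite inE => jk ->; rewrite oK.
by exists (q i); rewrite ?inE ?qK.
Qed.

Lemma in_upto i k : (i \in upto o k) = (q i <= k)%N.
Proof.
apply/imsetP/idP => [[j]|ik]; first by rewrite inE => jk ->; rewrite oK.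
by exists (q i); rewrite ?inE ?qK.
Qed.

(** The leading exponent of [y k]: expanding [y_k = y_(p k) x_(o k) - c_k] yields
    the product of the generators of the class of [k] adjoined so far. *)
Definition class_exp k : 'X_{1..N} :=
  [multinom nat_of_bool ((q i <= k)%N && (eta (q i) == eta k)) | i < N].

Lemma class_expS j k : pred_eta eta k = Some j ->
  class_exp k = (class_exp j + U_(o k))%MM.
Proof.
case/pred_etaP=> jk ej jmax; apply/mnmP => i; rewrite mnmDE mnm1E !mnmE ej.
have -> : (o k == i) = (q i == k).
  by apply/eqP/eqP => [<-|<-]; rewrite ?oK ?qK.
case: (ltngtP (q i) k) => [ik|ik|/val_inj ->].
- rewrite (_ : (q i == k) = false) ?addn0; last by apply/eqP => ki; rewrite ki ltnn in ik.
  case: (eqVneq (eta (q i)) (eta k)) => [ei|]; last by rewrite !andbF.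
  by rewrite (jmax _ ik ei).
- rewrite (_ : (q i == k) = false) ?addn0; last by apply/eqP => ki; rewrite ki ltnn in ik.
  by rewrite leqNgt (ltn_trans jk ik).
- by rewrite !eqxx leqNgt jk.
Qed.

Lemma class_exp_first k : pred_eta eta k = None -> class_exp k = U_(o k)%MM.
Proof.
move=> e; apply/mnmP => i; rewrite mnm1E mnmE.
have -> : (o k == i) = (q i == k).
  by apply/eqP/eqP => [<-|<-]; rewrite ?oK ?qK.
case: (ltngtP (q i) k) => [ik|ik|/val_inj ->]; last by rewrite !eqxx.
- rewrite (_ : (q i == k) = false); last by apply/eqP => ki; rewrite ki ltnn in ik.
  by case: eqP => // ei; case: (pred_eta_None e ik).
- by rewrite (_ : (q i == k) = false) //; apply/eqP => ki; rewrite ki ltnn in ik.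
Qed.

Lemma seq_tops k : tops opos (class_exp k) (y k) 1.
Proof.
have [s sk] := ubnP k; elim: s k sk => // s IH k sk.
case e: (pred_eta eta k) => [j|]; last first.
  by rewrite (ps_first yP e) (class_exp_first e); exact: topsX.
have [c [cA _ ->]] := ps_next yP e.
have [jk ej jmax] := pred_etaP e.
suff : tops opos (class_exp k) (y j * 'X_(o k) - c) (1 * 1 + 0).
  by rewrite mulr1 addr0.
apply: topsD.
  rewrite (class_expS e); apply: topsM; first exact: opos_inj.
    by apply: IH; lia.
  exact: topsX.
apply: low_tops => m mc; exists (o k); split.
  have -> : m (o k) = 0%N.
    apply/eqP/negPn/negP => mk; have cs : m \in msupp c.
      by move: mc; rewrite !mcoeff_msupp mcoeffN oppr_eq0.
    by have := cA _ _ cs mk; rewrite in_before oK ltnn.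
  by rewrite mnmE oK leqnn eqxx.
move=> i; rewrite /opos oK => ki; rewrite mnmE leqNgt ki /=.
apply/eqP/negPn/negP => mi; have cs : m \in msupp c.
  by move: mc; rewrite !mcoeff_msupp mcoeffN oppr_eq0.
by have := cA _ _ cs mi; rewrite in_before ltnNge (ltnW ki).
Qed.

Lemma seq_lead k : lead opos (y k) (class_exp k).
Proof. exact: tops_lead (oner_neq0 K) (@seq_tops k). Qed.

Lemma seq_coef k : (y k)@_(class_exp k) = 1.
Proof. exact: tops_coef (@seq_tops k). Qed.

Lemma seq_prime k j : (j <= k)%N -> succ_gt eta j k ->
  homogeneous_poisson_prime br act (polysub (upto o k)) (y j).
Proof.
move=> jk sj; apply/(ps_list yP); exists j, 1.
by split; rewrite ?oner_neq0 ?scale1r.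
Qed.

Lemma seq_prime_self k : homogeneous_poisson_prime br act (polysub (upto o k)) (y k).
Proof.
apply: seq_prime => //; rewrite /succ_gt; case e: (succ_eta _ _) => [i|] //.
by case: (succ_etaP e).
Qed.

End SequenceLeading.

(** * Reduction to leading monomials *)

(** The property of an order of the generators that makes [delta_j x_i] lower than
    [x_i x_j]. The original order, its reverse and all orders of [Xi] have it. *)
Definition between (N : nat) (pos : 'I_N -> nat) : Prop :=
  forall i l j : 'I_N, (i < l)%N -> (l < j)%N -> (pos l < maxn (pos i) (pos j))%N.

Lemma id_between (N : nat) : between (@nat_of_ord N).
Proof. by move=> i l j il lj; rewrite leq_max lj orbT. Qed.

Section Reduction.
Variables (K : fieldType) (n r : nat).
Local Notation N := n.+1.
Local Notation R := {mpoly K[N]}.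
Variables (br : R -> R -> R) (act : {ffun 'I_r -> K} -> R -> R).
Variables (eta : 'I_N -> int) (y : 'I_N -> R).
Hypothesis yP : prime_sequence br act id eta y.
Variables (tau : 'S_N) (etatau : 'I_N -> int) (ytau : 'I_N -> R).
Hypothesis tauXi : Xi tau.
Hypothesis ytauP : prime_sequence br act tau etatau ytau.
Implicit Types (i j k l : 'I_N) (m : 'X_{1..N}).

Definition rk i : 'I_N := (tau^-1)%g i.

Lemma tauK : cancel tau rk. Proof. exact: permK. Qed.
Lemma rkK : cancel rk tau. Proof. exact: permKV. Qed.

Local Notation taupos := (opos rk).
Local Notation idpos := (@nat_of_ord N).

Lemma rk_inj : injective rk. Proof. exact: can_inj rkK. Qed.

(** When the later of two generators is adjoined, the adjoined generators form an
    interval, which contains all those between the two. *)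
Lemma Xi_between : between taupos.
Proof.
move=> i l j il lj.
pose k := if (rk i < rk j)%N then rk j else rk i.
have kE : nat_of_ord k = maxn (rk i) (rk j) by rewrite /k /maxn; case: ifP.
have nij : rk i != rk j by rewrite (inj_eq rk_inj); apply/eqP => e; move: il lj; rewrite e; lia.
have k0 : (0 < k)%N.
  by rewrite kE; move: nij; rewrite -val_eqE /=; lia.
have [a [b ab]] := tauXi k0.
have iu : i \in upto tau k by rewrite (in_upto tauK rkK) kE leq_maxl.
have ju : j \in upto tau k by rewrite (in_upto tauK rkK) kE leq_maxr.
have : l \in upto tau k by move: iu ju; rewrite ab !inE; lia.
rewrite (in_upto tauK rkK) leq_eqVlt /opos -kE => /orP [/eqP/val_inj e|//].
move: e; rewrite /k; case: ifP => _ /rk_inj e; move: il lj; rewrite e; lia.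
Qed.

Lemma iset_upto k (lo hi : 'I_N) : (rk lo <= k)%N -> (rk hi <= k)%N ->
  {subset iset N lo hi <= upto tau k}.
Proof.
move=> rlo rhi i; rewrite inE (in_upto tauK rkK) => /andP [li ih].
have [<-//|nli] := eqVneq lo i; have [->//|nhi] := eqVneq i hi.
have li' : (lo < i)%N by rewrite ltn_neqAle li andbT; apply: contra_neq nli => /val_inj.
have ih' : (i < hi)%N by rewrite ltn_neqAle ih andbT; apply: contra_neq nhi => /val_inj.
by have := Xi_between li' ih'; rewrite /opos; lia.
Qed.

Hypothesis same_lead : forall v f f',
  homogeneous_poisson_prime br act (polysub [set: 'I_N]) v ->
  lead idpos v f -> lead taupos v f' -> f = f'.

Lemma upto_max (o q : 'I_N -> 'I_N) : cancel o q -> cancel q o ->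
  upto o ord_max = [set: 'I_N].
Proof. by move=> oK qK; apply/setP => i; rewrite (in_upto oK qK) inE leq_ord. Qed.

(** Up to scalars the prime elements of the whole algebra belong to both sequences.
    Their leading monomials are products over whole classes of [eta] on one side, and over
    whole classes of [etatau] on the other. *)
Lemma top_class_eq j : succ_eta eta j = None ->
  exists2 k, succ_eta etatau k = None &
    (exists2 t : K, t != 0 & y j = t *: ytau k) /\
    forall i, (eta i == eta j) = (etatau (rk i) == etatau k).
Proof.
move=> sj; have idK : cancel (@id 'I_N) id by [].
have hj : homogeneous_poisson_prime br act (polysub (upto id ord_max)) (y j).
  by apply: (seq_prime yP); rewrite ?leq_ord // /succ_gt sj.
rewrite (upto_max idK idK) -(upto_max tauK rkK) in hj.
have /(ps_list ytauP) [k [t [_ sk t0 yk]]] := hj.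
have sk' : succ_eta etatau k = None.
  by move: sk; rewrite /succ_gt; case: (succ_eta _ k) => // i; rewrite ltnNge leq_ord.
exists k => //; split; first by exists t.
have e : class_exp id eta j = class_exp rk etatau k.
  apply: (same_lead (v := y j)); first by rewrite -(upto_max tauK rkK).
    exact: (seq_lead idK idK yP).
  rewrite yk; apply: (tops_lead (c := t * 1)); first by rewrite mulr1.
  by apply/topsZ/(seq_tops tauK rkK ytauP).
move=> i; move: (congr1 (fun m : 'X_{1..N} => m i) e); rewrite !mnmE.
have top (h : 'I_N -> int) (a b : 'I_N) : succ_eta h a = None ->
    ((b <= a)%N && (h b == h a)) = (h b == h a).
  move=> sa; case: (eqVneq (h b)) => [hb|]; last by rewrite andbF.
  by rewrite andbT leqNgt; apply/negP => /(succ_eta_None sa); rewrite hb.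
by rewrite !top //; do 2!case: eqP.
Qed.

Lemma classes_eq i i' : (eta i == eta i') = (etatau (rk i) == etatau (rk i')).
Proof.
have [j [_ ej sj]] := class_top eta i'.
have [k _ [_ h]] := top_class_eq sj.
by rewrite -ej h; have := h i'; rewrite ej eqxx => /esym/eqP ->.
Qed.

Lemma class_expE k i : class_exp rk etatau k i =
  ((rk i <= k)%N && (eta i == eta (tau k))) :> nat.
Proof. by rewrite mnmE classes_eq tauK. Qed.

Hypothesis interval_good : forall k (lo hi : 'I_N),
  class_exp rk etatau k lo != 0%N -> class_exp rk etatau k hi != 0%N ->
  (forall i, class_exp rk etatau k i != 0%N -> (lo <= i <= hi)%N) ->
  [/\ homogeneous_poisson_prime br act (polysub (iset N lo hi)) (ytau k),
      leading_term (ytau k) 1 (class_exp rk etatau k)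
    & forall z, homogeneous_poisson_prime br act (polysub (iset N lo hi)) z ->
        leading_term z 1 (class_exp rk etatau k) -> z = ytau k].

Lemma unique_interval_prime k (lo hi : 'I_N) :
  (rk lo <= k)%N -> (rk hi <= k)%N -> eta lo = eta (tau k) -> eta hi = eta (tau k) ->
  (lo <= hi)%N ->
  (forall i, (rk i <= k)%N -> eta i = eta (tau k) -> (lo <= i <= hi)%N) ->
  unique (interval_prime br act eta lo hi) (ytau k).
Proof.
move=> rlo rhi elo ehi lohi hmm.
have cE i : (class_exp rk etatau k i != 0%N) = ((rk i <= k)%N && (eta i == eta (tau k))).
  by rewrite class_expE; case: (_ && _).
have [] := interval_good (k := k) (lo := lo) (hi := hi).
- by rewrite cE rlo elo eqxx.
- by rewrite cE rhi ehi eqxx.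
- by move=> i; rewrite cE => /andP [ri /eqP ei]; apply: hmm.
move=> h1 h2 h3; have [m [_ m2 m3]] := chainP lohi (etrans elo (esym ehi)).
have sE : segment eta lo hi = class_exp rk etatau k.
  apply/mnmP => i; rewrite class_expE mnmE ehi; congr (nat_of_bool _).
  case: (eqVneq (eta i)) => [ei|]; rewrite ?andbF // !andbT.
  apply/idP/idP => [lih|ri]; last exact: hmm.
  by have := iset_upto rlo rhi (x := i); rewrite inE (in_upto tauK rkK); apply.
split; first by exists m; split=> //; rewrite m3 sE.
move=> z [m' [m1' m2' m3']]; apply/esym/h3 => //.
by rewrite -sE -m3 (succ_iter_inj m2 m1').
Qed.

(** The set [tau([1, k])] is an interval that grows at its ends only, so [tau k] is
    its largest or smallest element, according to the side of [tau 1] on which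
    it lies. The generators of the class of [tau k] in it thus form the chain of
    predecessors, or of successors, of [tau k]. *)
Lemma reduction k :
  ((tau ord0 <= tau k)%N ->
     exists (m : nat) (i : 'I_N),
       [/\ is_max (fun l : nat => exists2 j, pred_iter eta l (tau k) = Some j
                                       & j \in upto tau k) m,
           pred_iter eta m (tau k) = Some i
         & unique (interval_prime br act eta i (tau k)) (ytau k)])
  /\
  ((tau k <= tau ord0)%N ->
     exists (m : nat) (j : 'I_N),
       [/\ is_max (fun l : nat => exists2 i, succ_iter eta l (tau k) = Some i
                                       & i \in upto tau k) m,
           succ_iter eta m (tau k) = Some j
         & unique (interval_prime br act eta (tau k) j) (ytau k)]).
Proof.
pose P i := (rk i <= k)%N && (eta i == eta (tau k)).
have Pk : P (tau k) by rewrite /P tauK leqnn eqxx.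
have rk0 : taupos (tau ord0) = 0%N by rewrite /opos tauK.
have rkk : taupos (tau k) = k by rewrite /opos tauK.
have k0 i : tau ord0 = tau k -> (rk i <= k)%N -> i = tau k.
  move/perm_inj => <-; rewrite leqn0 => /eqP e; apply: rk_inj.
  by apply: val_inj; rewrite tauK; exact: e.
split=> h0.
- have hmax i : P i -> (i <= tau k)%N.
    move=> /andP [ri _]; rewrite leqNgt; apply/negP => ki.
    move: h0; rewrite leq_eqVlt => /orP [/eqP/val_inj e|h0].
      by move: ki; rewrite (k0 i e ri) ltnn.
    by have := Xi_between h0 ki; rewrite rk0 rkk max0n /opos; lia.
  case: (@arg_minnP _ (tau k) P (@nat_of_ord N) Pk) => i /andP [ri /eqP ei] imin.
  have ik : (i <= tau k)%N by apply: hmax; rewrite /P ri ei eqxx.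
  have [m [m1 m2 m3]] := chainP ik ei.
  exists m, i; split=> //.
    split=> [|l [j lj]]; first by exists i; rewrite ?(in_upto tauK rkK).
    rewrite (in_upto tauK rkK) => rj; rewrite leqNgt; apply/negP => ml.
    have ji := pred_iter_lt ml m1 lj; have [ej _] := pred_iter_le lj.
    have ij : (i <= j)%N by apply: imin; rewrite /P rj ej eqxx.
    by rewrite leqNgt ji in ij.
  apply: unique_interval_prime; rewrite ?tauK //.
  move=> j rj ej; have Pj : P j by rewrite /P rj ej eqxx.
  by rewrite (hmax _ Pj) andbT; apply: imin.
- have hmin i : P i -> (tau k <= i)%N.
    move=> /andP [ri _]; rewrite leqNgt; apply/negP => ki.
    move: h0; rewrite leq_eqVlt => /orP [/eqP/val_inj e|h0].
      by move: ki; rewrite (k0 i (esym e) ri) ltnn.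
    by have := Xi_between ki h0; rewrite rk0 rkk maxn0 /opos; lia.
  case: (@arg_maxnP _ (tau k) P (@nat_of_ord N) Pk) => i /andP [ri /eqP ei] imax.
  have ik : (tau k <= i)%N by apply: hmin; rewrite /P ri ei eqxx.
  have [m [m1 m2 m3]] := chainP ik (esym ei).
  exists m, i; split=> //.
    split=> [|l [j lj]]; first by exists i; rewrite ?(in_upto tauK rkK).
    rewrite (in_upto tauK rkK) => rj; rewrite leqNgt; apply/negP => ml.
    have ji := succ_iter_lt ml m2 lj; have [ej _] := succ_iter_le lj.
    have ij : (j <= i)%N by apply: imax; rewrite /P rj ej eqxx.
    by rewrite leqNgt ji in ij.
  apply: unique_interval_prime; rewrite ?tauK //.
  move=> j rj ej; have Pj : P j by rewrite /P rj ej eqxx.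
  by rewrite (hmin _ Pj) /=; apply: imax.
Qed.

End Reduction.

(** * Poisson primes of subalgebras *)

Section Primes.
Variables (K : fieldType) (N : nat).
Local Notation R := {mpoly K[N]}.
Variables (br : R -> R -> R).
Implicit Types (a b p q u v : R) (A B : {set 'I_N}) (i j k l : 'I_N).

Lemma mX_not_unit i b : b * 'X_i <> 1 :> R.
Proof. by move/unit_polysub0; apply: notin_polysubX; rewrite inE. Qed.

Lemma prime_not_unit A v b : poisson_prime br (polysub A) v -> b * v <> 1.
Proof.
move=> hv e; apply: (pp_proper hv); exists b; split=> //.
by rewrite mulrC in e; apply: polysubS (unit_polysub0 e) => i; rewrite inE.
Qed.

Lemma prime_split A p q : poisson_prime br (polysub A) (p * q) ->
  polysub A p -> polysub A q -> (exists b, b * p = 1) \/ (exists b, b * q = 1).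
Proof.
move=> hv Ap Aq; have v0 := pp_neq0 hv.
have [p0 q0] : p != 0 /\ q != 0.
  by split; apply: contraNneq v0 => ->; rewrite ?mul0r ?mulr0.
have [|[b [_ e]]|[b [_ e]]] := pp_prime hv Ap Aq.
- by exists 1; split; [exact: polysub1|rewrite mul1r].
- by right; exists b; apply: (mulfI p0); rewrite mulr1 [RHS]e; ring.
- by left; exists b; apply: (mulfI q0); rewrite mulr1 [RHS]e; ring.
Qed.

Lemma prime_restrict A B u : {subset B <= A} -> poisson_prime br (polysub A) u ->
  polysub B u -> (forall a, polysub B a -> polysub B (br u a)) ->
  poisson_prime br (polysub B) u.
Proof.
move=> BA hu Bu hbr; have u0 := pp_neq0 hu.
have AB a : polysub B a -> polysub A a by exact: polysubS.
have dvdB a : polysub B a -> dvd_in (polysub A) u a -> dvd_in (polysub B) u a.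
  by move=> Ba [b [_ e]]; exists b; split=> //; apply: polysub_quot u0 _; rewrite -e.
split=> //.
- by move=> a Ba; apply: dvdB (hbr _ Ba) (pp_normal hu (AB _ Ba)).
- by case=> b [Bb e]; apply: (pp_proper hu); exists b; split=> //; apply: AB.
- move=> a b Ba Bb [d [Bd e]].
  have [|h|h] := pp_prime hu (AB _ Ba) (AB _ Bb).
  + by exists d; split=> //; apply: AB.
  + by left; apply: dvdB.
  + by right; apply: dvdB.
Qed.

End Primes.

(** * The prime elements next to central variables *)

Section Central.
Variables (K : fieldType) (N r : nat).
Hypothesis charK : [pchar K] =i pred0.
Local Notation R := {mpoly K[N]}.
Local Notation mon := 'X_{1..N}.
Variables (br : R -> R -> R) (act lie : {ffun 'I_r -> K} -> R -> R).
Variables (sigma delta : 'I_N -> R -> R) (lam : 'I_N -> 'I_N -> K).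
Hypothesis Rpcgl : pcgl br act lie sigma delta lam.
Hypothesis Rsym : symmetric_pcgl lie delta lam.
Variable w : 'I_N -> 'I_r -> int.
Hypothesis wP : forall i h, in_torus h -> act h 'X_i = character (w i) h *: 'X_i.
Variables (eta : 'I_N -> int) (y : 'I_N -> R).
Hypothesis yP : prime_sequence br act id eta y.
Implicit Types (a b c p q v : R) (m f g : mon) (i j k l : 'I_N).

Local Notation below := (@below N).
Local Notation central := (central br).
Local Notation pairing := (pairing w).
Local Notation idpos := (@nat_of_ord N).

Let pb := pbr Rpcgl.

Lemma id_inj : injective idpos. Proof. exact: val_inj. Qed.

Lemma y_prime k : poisson_prime br (polysub (below k.+1)) (y k).
Proof.
by rewrite -upto_id; case: (seq_prime_self (o := id) yP k).
Qed.

Lemma y_frontier k l : (k <= l)%N -> succ_gt eta k l ->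
  poisson_prime br (polysub (below l.+1)) (y k).
Proof. by move=> kl s; rewrite -upto_id; case: (seq_prime (o := id) yP kl s). Qed.

Lemma y_next k j : pred_eta eta k = Some j -> exists c,
  [/\ c != 0, polysub (below k) c, homogeneous act c, y k = y j * 'X_k - c
    & forall m, m \in msupp c -> m \in msupp (y k)].
Proof.
move=> e; have [c [cA hc yk]] := ps_next yP e; rewrite before_id in cA.
have [jk _ _] := pred_etaP e; exists c; split=> //.
  apply/eqP => c0; have := y_prime k; rewrite yk c0 subr0 => hk.
  have [||[b]|[b]] := prime_split hk.
  - by apply: polysubS (pp_mem (y_prime j)); apply: belowS; lia.
  - by apply: polysubX; rewrite inE.
  - exact: prime_not_unit (y_prime j).
  - exact: mX_not_unit.
move=> m mc; rewrite mcoeff_msupp yk mcoeffB (@mcoeffMX0 _ _ _ _ _ k).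
  by rewrite sub0r oppr_eq0 -mcoeff_msupp.
rewrite mnm1E eqxx; case: (posnP (m k)) => [-> //|mk].
by have := cA m k mc; rewrite inE ltnn -lt0n => /(_ mk).
Qed.

(** A correction term [c] would have weight zero for [h_k], whereas the weight of
    [y_(p k) x_k] is non-zero. *)
Lemma central_first k : central k -> pred_eta eta k = None.
Proof.
move=> ck; case e: (pred_eta eta k) => [j|] //.
have [c [c0 cA hc yk csupp]] := y_next e.
have [m mc] : exists m, m \in msupp c.
  by case E: (msupp c) => [|m s]; [move: c0; rewrite -msupp_eq0 E|exists m; rewrite inE eqxx].
have [jk _ _] := pred_etaP e.
have idK : cancel (@id 'I_N) id by [].
have fy : class_exp id eta k \in msupp (y k) by case: (seq_lead idK idK yP k).
have [hs hsP] := hk_exist Rpcgl wP; have [k0 klam] := hsP k.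
have := homog_wt Rpcgl wP (hs k) (ps_homog yP k) fy (csupp _ mc).
have low0 g : (forall i, (k <= i)%N -> g i = 0%N) -> wtf (pairing (hs k)) g = 0.
  move=> g0; rewrite /wtf big1 // => i _; case: (ltnP i k) => ik.
    by rewrite klam // (central_lam Rpcgl Rsym ck ik) mul0rn.
  by rewrite g0.
rewrite (class_expS (o := id) idK idK e) wtfD wtfU !low0 ?add0r.
- by move/eqP; rewrite (negbTE k0).
- move=> i ki; apply/eqP/negPn/negP => mi.
  by have := cA _ _ mc mi; rewrite inE ltnNge ki.
- by move=> i ki; rewrite mnmE leqNgt (leq_trans jk ki).
Qed.

Lemma central_y k : central k -> y k = 'X_k.
Proof. by move/central_first/(ps_first yP). Qed.

(** The correction [delta_j x_i] only involves generators strictly between [x_i]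
    and [x_j], and these come before the later one of the two. *)
Lemma br_tops pos i j : injective pos -> between pos -> (i < j)%N ->
  tops pos (U_(i) + U_(j)) (br 'X_j 'X_i) (lam j i).
Proof.
move=> pinj pbet ij; rewrite (brXX Rpcgl ij) -mpolyXD -[lam j i]addr0.
apply: topsD; first by rewrite addr0 -[X in tops _ _ _ X]mulr1; apply/topsZ/topsX.
apply: low_tops => m md.
have mlt k : m k != 0%N -> (i < k < j)%N.
  by move=> mk; have := deltaX Rsym ij md mk; rewrite inE; lia.
pose t := if (pos i < pos j)%N then j else i.
have tE : pos t = maxn (pos i) (pos j) by rewrite /t /maxn; case: ifP.
exists t; split=> [|k tk].
  have -> : m t = 0%N.
    by apply/eqP/negPn/negP => /mlt; rewrite /t; case: ifP => _; rewrite ltnn ?andbF.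
  by rewrite mnmDE !mnm1E /t; case: ifP; rewrite eqxx ?addn1.
have -> : m k = 0%N.
  apply/eqP/negPn/negP => /mlt /andP [ik kj].
  by have := pbet _ _ _ ik kj; rewrite -tE ltnNge (ltnW tk).
rewrite mnmDE !mnm1E; case: eqP => [e|_]; case: eqP => [e'|_] //; move: tk;
by rewrite tE -?e -?e' ltnNge ?leq_maxl ?leq_maxr.
Qed.

Lemma br_mon0 m i l : (forall k, (k < l)%N -> central k) ->
  (forall k, m k != 0%N -> (i <= k < l)%N) -> br 'X_[m] 'X_i = 0.
Proof.
move=> cl hm; pose A := [set k : 'I_N | (i <= k < l)%N].
apply: (@is_der_ext _ _ A (br^~ 'X_i) (fun=> 0)).
- exact: is_der_sub (br_der pb 'X_i).
- by split=> *; rewrite ?scaler0 ?addr0 ?mul0r ?mulr0 ?addr0.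
- move=> k; rewrite inE => /andP [ik kl]; case: (ltngtP i k) ik => // [ik _|/val_inj -> _].
    exact/(centralP _ _ (cl k kl)).
  exact: (pb_alt pb).
- by move=> m' k; rewrite msuppX inE => /eqP -> /hm; rewrite inE.
Qed.

Lemma pair_lead j l m (g : K) pos : (j < l)%N -> injective pos -> between pos ->
  (forall k, m k != 0%N -> (j < k < l)%N) ->
  tops pos (U_(j) + U_(l)) ('X_j * 'X_l - g *: 'X_[m]) 1.
Proof.
move=> jl pinj pbet hm; rewrite -mpolyXD -[X in tops _ _ _ X]addr0.
apply: topsD; first exact: topsX.
apply: low_tops => f; rewrite -scaleNr => /msuppZ_le; rewrite msuppX inE => /eqP ->.
pose t := if (pos j < pos l)%N then l else j.
have tE : pos t = maxn (pos j) (pos l) by rewrite /t /maxn; case: ifP.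
exists t; split=> [|k tk].
  have -> : m t = 0%N.
    by apply/eqP/negPn/negP => /hm; rewrite /t; case: ifP => _; rewrite ltnn ?andbF.
  by rewrite mnmDE !mnm1E /t; case: ifP; rewrite eqxx ?addn1.
have -> : m k = 0%N.
  apply/eqP/negPn/negP => /hm /andP [ik kj].
  by have := pbet _ _ _ ik kj; rewrite -tE ltnNge (ltnW tk).
rewrite mnmDE !mnm1E; case: eqP => [e|_]; case: eqP => [e'|_] //; move: tk;
by rewrite tE -?e -?e' ltnNge ?leq_maxl ?leq_maxr.
Qed.

(** If [v = x_j x_l - g x^m] divides its bracket with [x_i], the quotient has
    leading term [lam l i x_i], which gives the coefficient of [x_i x^m]. *)
Lemma pair_normal i j l m (g : K) v p : (i <= j)%N -> (j < l)%N ->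
  (forall k, (k < l)%N -> central k) ->
  (forall k, m k != 0%N -> (i <= k < l)%N) ->
  v = 'X_j * 'X_l - g *: 'X_[m] -> br v 'X_i = p * v ->
  ('X_j * br 'X_l 'X_i)@_(m + U_(i)) = - (g * lam l i).
Proof.
move=> ij jl cl hm vE bv; have il : (i < l)%N by lia.
have ml0 : m l = 0%N by apply/eqP/negPn/negP => /hm; rewrite ltnn andbF.
have bE : 'X_j * br 'X_l 'X_i = p * v.
  rewrite -bv vE (brBl pb) (brMl pb) (brZl pb) (br_mon0 cl hm) scaler0 subr0.
  suff -> : br 'X_j 'X_i = 0 by rewrite mul0r add0r.
  case: (ltngtP i j) ij => // [ij _|/val_inj -> _]; last exact: (pb_alt pb).
  exact/(centralP _ _ (cl j jl)).
have vtop : tops idpos (U_(j) + U_(l)) v 1.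
  rewrite vE -mpolyXD -[X in tops _ _ _ X]addr0; apply: topsD; first exact: topsX.
  apply: low_tops => f; rewrite -scaleNr => /msuppZ_le; rewrite msuppX inE => /eqP ->.
  exists l; rewrite ml0 mnmDE !mnm1E eqxx addn1; split=> // k lk.
  have -> : m k = 0%N by apply/eqP/negPn/negP => /hm; lia.
  rewrite mnmDE !mnm1E; case: eqP => [e|_]; first by move: lk; rewrite -e; lia.
  by case: eqP => [e|_] //; move: lk; rewrite -e ltnn.
have [|_ pc] := tops_quot id_inj (tops_lead (oner_neq0 K) vtop) (p := p) (g := U_(i)) (c := lam l i).
  have -> : (U_(i) + (U_(j) + U_(l)) = U_(j) + (U_(i) + U_(l)))%MM.
    by rewrite !addmA [(U_(i) + U_(j))%MM]addmC.
  rewrite -bE -[lam l i]mul1r; apply: (topsM id_inj); first exact: topsX.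
  exact: (br_tops id_inj (@id_between N) il).
rewrite (tops_coef vtop) mulr1 in pc.
rewrite bE vE mulrBr -mpolyXD mcoeffB (@mcoeffMX0 _ _ _ _ _ l).
  by rewrite sub0r -scalerAr mcoeffZ mcoeffMX pc.
rewrite !mnmDE ml0 !mnm1E eqxx; case: eqP => [e|_]; last by rewrite addn1.
by move: il; rewrite e ltnn.
Qed.

(** Before [x_l] all prime elements are generators, so [y_l = x_j x_l - c]. Weights
    leave a single monomial [x^m] in [c], since distinct monomials in central
    variables have distinct weights. If [x_i] with [i < j] is the first generator
    in [x^m], then [pair_normal] forces [lam l i = 0], and the weight of [h_i^*]
    is zero on [x_j x_l] but not on [x^m]. The generator [x_j] does not divide
    [x^m], as [y_l] is prime. Finally, the weight of [h_j^*] is zero on [x^m], and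
    it is a non-zero scalar minus [lam l j] on [x_j x_l]. *)
Lemma pair_structure l j : (forall k, (k < l)%N -> central k) ->
  pred_eta eta l = Some j ->
  exists (g : K) (m : mon),
    [/\ y l = 'X_j * 'X_l - g *: 'X_[m], g != 0, lam l j != 0
      & forall k, m k != 0%N -> (j < k < l)%N].
Proof.
move=> cl e; have [jl _ _] := pred_etaP e.
have [c [c0 cA hc yl csupp]] := y_next e.
rewrite (central_y (cl j jl)) in yl.
have [m mc] : exists m, m \in msupp c.
  by case E: (msupp c) => [|m s]; [move: c0; rewrite -msupp_eq0 E|exists m; rewrite inE eqxx].
have ml k : m k != 0%N -> (k < l)%N by move=> mk; have := cA _ _ mc mk; rewrite inE.
have cE : c = c@_m *: 'X_[m].
  apply/mpolyP => f; rewrite mcoeffZ mcoeffX; case: (eqVneq m f) => [->|mf].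
    by rewrite mulr1.
  rewrite mulr0; apply/eqP; rewrite mcoeff_eq0; apply: contra mf => fc; apply/eqP.
  apply: (wt_eq_central charK Rpcgl Rsym wP (A := below l)).
  - by move=> xi; exact: (homog_wt Rpcgl wP xi hc mc fc).
  - move=> i il; have z f' : f' \in msupp c -> f' i = 0%N.
      by move=> f'c; apply/eqP; apply: contraNT il => fi; apply: cA f'c fi.
    by rewrite !z.
  - by move=> i; rewrite inE; apply: cl.
have g0 : c@_m != 0 by rewrite -mcoeff_msupp.
rewrite cE in yl; move: (c@_m) g0 yl => g g0 yl.
have ml0 : m l = 0%N by apply/eqP/negPn/negP => /ml; rewrite ltnn.
have [hs hsP] := hkstar_exist Rpcgl Rsym wP.
have wtE (xi : {ffun 'I_r -> K}) : pairing xi j + pairing xi l = wtf (pairing xi) m.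
  rewrite -(wtfU (pairing xi) j) -(wtfU (pairing xi) l) -wtfD; apply: (homog_wt Rpcgl wP _ (ps_homog yP l)).
    rewrite mcoeff_msupp yl -mpolyXD mcoeffB mcoeffZ !mcoeffX eqxx.
    rewrite (_ : (m == _) = false) ?mulr0 ?subr0 ?oner_neq0 //.
    apply/eqP => /(congr1 (fun m' : mon => m' l)).
    by rewrite ml0 mnmDE !mnm1E eqxx addn1.
  exact: csupp.
have normal i : (i < l)%N -> exists p, br (y l) 'X_i = p * y l.
  move=> il; have [|p [_ ->]] := pp_normal (y_prime l) (a := 'X_i); last by exists p.
  by apply: polysubX; rewrite inE; lia.
have m_below i : (i < j)%N -> m i = 0%N.
  have [s si] := ubnP i; elim: s i si => // s IH i si ij.
  have mi k : m k != 0%N -> (i <= k < l)%N.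
    move=> mk; rewrite (ml k mk) andbT leqNgt; apply/negP => ki.
    by move: mk; rewrite IH ?eqxx //; lia.
  have il : (i < l)%N by lia.
  have [p hp] := normal i il.
  have := pair_normal (ltnW ij) jl cl mi yl hp.
  have -> : ('X_j * br 'X_l 'X_i)@_(m + U_(i)) = 0.
    apply/eqP; rewrite mcoeff_eq0; apply/negP => /msuppM_le /allpairsP [[u v] /= []].
    rewrite msuppX inE => /eqP -> vb e'.
    have := congr1 (fun m' : mon => m' l) e'; have := congr1 (fun m' : mon => m' i) e'.
    rewrite /= !mnmDE !mnm1E eqxx ml0.
    have -> : (j == i) = false by apply/eqP => h; move: ij; rewrite h ltnn.
    have -> : (j == l) = false by apply/eqP => h; move: jl; rewrite h ltnn.
    have -> : (i == l) = false by apply/eqP => h; move: il; rewrite h ltnn.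
    rewrite !add0n => vi vl; move: vb; rewrite mcoeff_msupp (brXX Rpcgl il).
    rewrite mcoeffD mcoeffZ (deltaX_coef Rsym (i := i)) //; last 2 first.
    - by rewrite -vi addn1.
    - by rewrite ltnn.
    rewrite -mpolyXD mcoeffX; case: ((U_(i) + U_(l))%MM =P v) => [ve _|_]; last by rewrite mulr0 addr0 eqxx.
    by move: vl; rewrite -ve mnmDE !mnm1E eqxx addn1.
  move/eqP; rewrite eq_sym oppr_eq0 mulf_eq0 (negbTE g0) /= => /eqP lam0.
  have [i0 ilam] := hsP i; have := wtE (hs i).
  rewrite !ilam // lam0 (central_lam Rpcgl Rsym (cl j jl) ij) oppr0 addr0.
  rewrite /wtf (bigD1 i) //= big1 ?addr0.
    by move=> h; apply: (natmul_inj0 charK i0); rewrite -h mulr0n.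
  move=> k ki; case: (ltngtP k i) => [k_i|i_k|/val_inj e']; last by rewrite e' eqxx in ki.
    by rewrite IH ?mulr0n //; lia.
  case: (ltnP k l) => kl; last first.
    by rewrite (_ : m k = 0%N) //; apply/eqP/negPn/negP => /ml; rewrite ltnNge kl.
  by rewrite ilam // (central_lam Rpcgl Rsym (cl k kl) i_k) oppr0 mul0rn.
have mj0 : m j = 0%N.
  apply/eqP/negPn/negP => mj; pose m' := (m - U_(j))%MM.
  have mE : m = (U_(j) + m')%MM.
    by apply/mnmP => k; rewrite mnmDE mnmBE mnm1E; case: eqP => [<-|_]; lia.
  have hy := y_prime l; move: (hy); rewrite yl mE mpolyXD scalerAr -mulrBr => hq.
  have [||[b]|[b]] := prime_split hq.
  - by apply: polysubX; rewrite inE; lia.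
  - apply: (@polysub_factor _ _ _ 'X_j); first exact: (pp_neq0 hq).
    exact: (pp_mem hq).
  - exact: mX_not_unit.
  - move/unit_polysub0 => q0.
    have := mcoeff_polysub q0 (m := U_(l)%MM) (i := l).
    rewrite mnm1E eqxx inE => /(_ isT isT) /eqP.
    rewrite mcoeffB mcoeffZ !mcoeffX eqxx (_ : (m' == _) = false).
      by rewrite mulr0 subr0 oner_eq0.
    apply/eqP => /(congr1 (fun f : mon => f l)).
    by rewrite mnm1E eqxx mnmBE ml0.
have hm k : m k != 0%N -> (j < k < l)%N.
  move=> mk; rewrite (ml k mk) andbT ltnNge; apply/negP => kj.
  move: mk kj; rewrite leq_eqVlt => mk /orP [/eqP/val_inj kj|kj].
    by subst k; move: mk; rewrite mj0.
  by move: mk; rewrite m_below.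
exists g, m; split=> //.
have [j0 jlam] := hsP j; have := wtE (hs j); rewrite /wtf big1.
  by rewrite (jlam l jl) => /eqP; rewrite subr_eq0 => /eqP <-.
move=> k _; have [->|/hm /andP [jk kl]] := eqVneq (m k) 0%N; first by rewrite mulr0n.
by rewrite jlam // (central_lam Rpcgl Rsym (cl k kl) jk) oppr0 mul0rn.
Qed.

End Central.

(** * Normal elements for an antisymmetric bracket *)

Section Antisymmetric.
Variables (K : fieldType) (N r : nat).
Hypothesis charK : [pchar K] =i pred0.
Local Notation R := {mpoly K[N]}.
Local Notation mon := 'X_{1..N}.
Variables (br : R -> R -> R) (act lie : {ffun 'I_r -> K} -> R -> R).
Variables (sigma delta : 'I_N -> R -> R) (lam : 'I_N -> 'I_N -> K).
Hypothesis Rpcgl : pcgl br act lie sigma delta lam.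
Hypothesis Rsym : symmetric_pcgl lie delta lam.
Variable w : 'I_N -> 'I_r -> int.
Hypothesis wP : forall i h, in_torus h -> act h 'X_i = character (w i) h *: 'X_i.
Hypothesis anti : forall a b, br a b = - br b a.
Implicit Types (a b c p q u v z : R) (m f g : mon) (i j k l : 'I_N) (A : {set 'I_N}).

Local Notation pairing := (pairing w).
Local Notation idpos := (@nat_of_ord N).

Let pb := pbr Rpcgl.

Definition revpos (i : 'I_N) : nat := (N - i)%N.

Lemma revpos_inj : injective revpos.
Proof.
move=> i j; rewrite /revpos => e; apply: val_inj => /=.
by have := ltn_ord i; have := ltn_ord j; lia.
Qed.

Lemma revpos_between : between revpos.
Proof. by move=> i l j il lj; rewrite /revpos; have := ltn_ord l; lia. Qed.

(** [om i j] is the coefficient of [x_i x_j] in the bracket of [x_i] and [x_j]. *)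
Definition om i j : K :=
  if (j < i)%N then lam i j else if (i < j)%N then - lam j i else 0.

Definition omf f j : K := \sum_i om i j *+ f i.

Lemma brXX_tops pos i j : injective pos -> between pos ->
  tops pos (U_(i) + U_(j)) (br 'X_i 'X_j) (om i j).
Proof.
move=> pinj pbet; rewrite /om; case: (ltngtP j i) => [ji|ij|/val_inj ->].
- by rewrite addmC; apply: (br_tops Rpcgl Rsym).
- rewrite anti -scaleN1r -[- lam j i]mulN1r; apply: topsZ.
  exact: (br_tops Rpcgl Rsym).
- by rewrite (pb_alt pb); apply: tops0.
Qed.

Lemma tops_sum pos f (I : Type) (s : seq I) (F : I -> R) (C : I -> K) :
  (forall x, tops pos f (F x) (C x)) ->
  tops pos f (\sum_(x <- s) F x) (\sum_(x <- s) C x).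
Proof.
move=> h; elim: s => [|x s IH]; first by rewrite !big_nil; apply: tops0.
by rewrite !big_cons; apply: topsD.
Qed.

Lemma brmon_tops pos m j : injective pos -> between pos ->
  tops pos (m + U_(j)) (br 'X_[m] 'X_j) (omf m j).
Proof.
move=> pinj pbet; rewrite (is_derE _ (br_der pb 'X_j)); apply: tops_sum => i.
rewrite mderivX; case: (posnP (m i)) => [->|mi].
  by rewrite mulr0n scale0r mul0r; apply: tops0.
have -> : (m + U_(j) = (m - U_(i)) + (U_(i) + U_(j)))%MM.
  by apply/mnmP => k; rewrite !mnmDE mnmBE !mnm1E; case: (i =P k) => [<-|_]; lia.
have := topsM pinj (topsZ (t := (m i)%:R) (@topsX K _ pos (m - U_(i)))) (@brXX_tops pos i j pinj pbet).
by rewrite mulr1 mulr_natl.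
Qed.

Lemma br_low pos f b j : injective pos -> between pos -> low pos f b ->
  low pos (f + U_(j)) (br b 'X_j).
Proof.
move=> pinj pbet; apply: (inmon_ind (T := fun a => low pos (f + U_(j)) (br a 'X_j))).
  split=> [|t a c ha hc]; first by rewrite (br0l pb); case: (low_lin K pos (f + U_(j))).
  by rewrite (brDl pb) (brZl pb); apply: lowD => //; apply: lowZ.
move=> m mf; have := topsS pinj (lto_addr U_(j) mf) (@brmon_tops pos m j pinj pbet).
by rewrite /tops scale0r subr0.
Qed.

Lemma brv_tops pos f v j : injective pos -> between pos -> lead pos v f ->
  tops pos (f + U_(j)) (br v 'X_j) (v@_f * omf f j).
Proof.
move=> pinj pbet /lead_tops vf.
have -> : br v 'X_j = v@_f *: br 'X_[f] 'X_j + br (v - v@_f *: 'X_[f]) 'X_j.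
  by rewrite (brBl pb) (brZl pb) addrC subrK.
rewrite -[_ * _]addr0; apply: topsD; first exact/topsZ/brmon_tops.
by apply: low_tops; apply: br_low.
Qed.

(** Homogeneous Poisson-normal elements, tested on generators. *)
Definition normal A v : Prop :=
  [/\ polysub A v, v != 0, homogeneous act v
    & forall j, j \in A -> exists p, br v 'X_j = p * v].

Lemma prime_normal A v :
  homogeneous_poisson_prime br act (polysub A) v -> normal A v.
Proof.
case=> hv pv; split; [exact: (pp_mem pv)|exact: (pp_neq0 pv)|exact: hv|].
move=> j jA; have [|p [_ ->]] := pp_normal pv (a := 'X_j); last by exists p.
exact: polysubX.
Qed.

(** The leading term of [br v x_j] is [omf f j x_j] times that of [v], and leading
    terms divide. *)
Lemma normal_quot pos v p f j : injective pos -> between pos -> lead pos v f ->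
  br v 'X_j = p * v -> tops pos U_(j) p (omf f j).
Proof.
move=> pinj pbet vf e; have := @brv_tops pos f v j pinj pbet vf.
rewrite e addmC => h; have [h1 h2] := tops_quot pinj vf h.
suff -> : omf f j = p@_U_(j) by [].
have v0 : v@_f != 0 by rewrite -mcoeff_msupp; case: vf.
by apply: (mulfI v0); rewrite -h2 mulrC.
Qed.

(** Let [k] be the top index where two exponents differ. In the sum of [omf _ k]
    and the weight for [h_k], the generators before [x_k] contribute zero, those
    after it contribute equally to both sides, and [x_k] contributes a non-zero
    multiple of its exponent. *)
Lemma exponent_inj A f g :
  (forall xi : {ffun 'I_r -> K}, wtf (pairing xi) f = wtf (pairing xi) g) ->
  (forall j, j \in A -> omf f j = omf g j) ->
  (forall i, i \notin A -> f i = g i) -> f = g.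
Proof.
move=> ew eo eA; case: (eqVneq f g) => // fg.
have main f' g' : (forall xi : {ffun 'I_r -> K}, wtf (pairing xi) f' = wtf (pairing xi) g') ->
    (forall j, j \in A -> omf f' j = omf g' j) ->
    (forall i, i \notin A -> f' i = g' i) -> ~ lto idpos f' g'.
  move=> e1 e2 e3 [k [k1 k2]]; have kA : k \in A.
    by apply: contraLR k1 => /e3 ->; rewrite ltnn.
  have [hs hsP] := hk_exist Rpcgl wP; have [k0 klam] := hsP k.
  suff e : f' k = g' k by move: k1; rewrite e ltnn.
  apply: (natmul_inj0 charK k0).
  have sE h : omf h k + wtf (pairing (hs k)) h = pairing (hs k) k *+ h k +
      \sum_(i < N | (k < i)%N) (om i k + pairing (hs k) i) *+ h i.
    rewrite /omf /wtf -big_split /= (bigD1 k) //= /om ltnn mul0rn add0r.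
    congr (_ + _); rewrite big_mkcond [RHS]big_mkcond; apply: eq_bigr => i _.
    rewrite -mulrnDl; case: (ltngtP k i) => [ki|ik|/val_inj ->].
    - by rewrite (_ : i != k) //; apply/eqP => e; rewrite e ltnn in ki.
    - by rewrite klam // addNr mul0rn; case: ifP.
    - by rewrite eqxx.
  have := sE f'; rewrite e1 e2 // sE => /esym.
  rewrite [X in _ + X = _](_ : _ = \sum_(i < N | (k < i)%N) (om i k + pairing (hs k) i) *+ g' i).
    by move/addIr.
  by apply: eq_bigr => i ki; rewrite k2.
case: (lto_total idpos fg) => h; first by case: (main _ _ ew eo eA h).
by case: (main _ _ (fun xi => esym (ew xi)) (fun j jA => esym (eo j jA))
  (fun i iA => esym (eA i iA)) h).
Qed.

(** The quotients of the brackets with the generators by [v], and the weight of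
    [v], do not depend on the order. *)
Lemma normal_lead A v pos pos' f f' : normal A v ->
  injective pos -> between pos -> injective pos' -> between pos' ->
  lead pos v f -> lead pos' v f' -> f = f'.
Proof.
move=> [vA v0 hv nv] pinj pbet pinj' pbet' vf vf'.
apply: (@exponent_inj A).
- by move=> xi; exact: (homog_wt Rpcgl wP xi hv vf.1 vf'.1).
- move=> j /nv [p e]; have := tops_coef (normal_quot pinj pbet vf e).
  by rewrite (tops_coef (normal_quot pinj' pbet' vf' e)).
- have z g i : g \in msupp v -> i \notin A -> g i = 0%N.
    by move=> gv iA; apply/eqP; apply: contraNT iA; apply: vA gv.
  by move=> i iA; rewrite !(z _ _ _ iA) //; [case: vf'|case: vf].
Qed.

(** Bounding the quotient by [x_j] both for the order and for the reversed one
    leaves [x_j] and a constant; the weight of [x_j] excludes the constant. *)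
Lemma normal_scalar A v f j : normal A v -> lead idpos v f -> j \in A ->
  br v 'X_j = (omf f j *: 'X_j) * v.
Proof.
move=> nv vf jA; have [vA v0 hv hn] := nv; have [p e] := hn j jA.
have [f' vf'] := lead_ex revpos_inj v0.
have t1 := normal_quot (@id_inj N) (@id_between N) vf e.
have t2 := normal_quot revpos_inj revpos_between vf' e.
have pE : p = omf f j *: 'X_j + (p@_0)%:MP.
  have p01 m : m \in msupp p -> m = U_(j)%MM \/ m = 0%MM.
    move=> mp; case: (tops_le t1 mp) => [->|[k [k1 k2]]]; first by left.
    case: (tops_le t2 mp) => [->|[k' [k1' k2']]]; first by left.
    move: k1 k1'; rewrite !mnm1E; case: eqP => // jk; case: eqP => // jk'.
    subst k k'; rewrite !ltnS leqn0 => /eqP m0 _; right; apply/mnmP => i.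
    rewrite mnm0E; case: (ltngtP i j) => [ij|ij|/val_inj -> //].
      rewrite k2' ?mnm1E; last by rewrite /revpos; have := ltn_ord i; lia.
      by case: eqP => // ji; rewrite ji ltnn in ij.
    rewrite k2 // mnm1E; case: eqP => // ji; by rewrite ji ltnn in ij.
  apply/mpolyP => m; rewrite mcoeffD mcoeffZ mcoeffX mcoeffC.
  case: (eqVneq U_(j)%MM m) => [<-|mj].
    by rewrite mnm1_eq0 mulr0 addr0 mulr1 (tops_coef t1).
  rewrite mulr0 add0r; case: (eqVneq m 0%MM) => [->|m0]; first by rewrite mulr1.
  rewrite mulr0; apply/eqP; rewrite mcoeff_eq0; apply/negP => /p01 [mE|mE].
    by rewrite mE eqxx in mj.
  by rewrite mE eqxx in m0.
move: (p@_0) pE => c pE; rewrite e pE; suff -> : c = 0 by rewrite addr0.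
have [h hT h1] := character_nontrivial Rpcgl wP j.
have fv : f \in msupp v by case: vf.
have brZr t a b : br a (t *: b) = t *: br a b.
  by rewrite anti (brZl pb) -scalerN -anti.
have := act_bracket (pcgl_action Rpcgl) v 'X_j hT.
rewrite (homog_act Rpcgl wP hv fv hT) wP // (brZl pb) brZr e pE.
rewrite mulrDl -scalerAl mul_mpolyC.
have aL := act_lin Rpcgl hT.
have -> : act h (omf f j *: ('X_j * v) + c *: v) =
    omf f j *: act h ('X_j * v) + c *: act h v.
  by rewrite aL (linZ aL).
rewrite (act_ringM (pcgl_action Rpcgl)) // wP // (homog_act Rpcgl wP hv fv hT).
set x := character _ _; set y := mchar _ _ _.
have y0 : y != 0 by rewrite /y mcharE // character_neq0.
move=> E; have {}E : ((x - 1) * y * c) *: v = 0.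
  rewrite !mulrBl mul1r scalerBl; apply/eqP; rewrite subr_eq0; apply/eqP.
  move: E; rewrite -scalerAl -scalerAr !scalerDr !scalerA.
  rewrite (_ : omf f j * x * y = y * x * omf f j); last by ring.
  by move/addrI => E; rewrite [y * c]mulrC E; congr (_ *: _); ring.
by move/eqP: E; rewrite scaler_eq0 (negbTE v0) orbF !mulf_eq0 subr_eq0 (negbTE h1) (negbTE y0) => /eqP.
Qed.

(** Normal elements with the same leading term have the same brackets with the
    generators, so their difference is normal: its leading monomial would be
    the common one, which cancels. *)
Lemma normal_unique A u z f : normal A u -> normal A z ->
  lead idpos u f -> lead idpos z f -> u@_f = z@_f -> u = z.
Proof.
move=> nu nz uf zf e; apply/eqP; rewrite -subr_eq0; apply/negPn/negP => d0.
have [uA _ hu _] := nu; have [zA _ hz _] := nz.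
have fu : f \in msupp u by case: uf.
have fz : f \in msupp z by case: zf.
have hd : homogeneous act (u - z).
  move=> h hT; exists (mchar w f h).
  have -> : act h (u - z) = act h u - act h z.
    have := act_lin Rpcgl hT (-1) z u; rewrite !scaleN1r => e'.
    by rewrite addrC e' addrC.
  by rewrite (homog_act Rpcgl wP hu fu hT) (homog_act Rpcgl wP hz fz hT) scalerBr.
have bd j : j \in A -> br (u - z) 'X_j = (omf f j *: 'X_j) * (u - z).
  move=> jA; rewrite (brBl pb) (normal_scalar nu uf jA) (normal_scalar nz zf jA).
  by rewrite mulrBr.
have [f' df'] := lead_ex (@id_inj N) d0.
have ff' : f = f'.
  have f'uz : f' \in msupp u \/ f' \in msupp z.
    by case: df' => /msuppB_le; rewrite mem_cat => /orP [] h _; [left|right].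
  apply: (@exponent_inj A).
  - by move=> xi; case: f'uz => h; [apply: (homog_wt Rpcgl wP xi hu)|
      apply: (homog_wt Rpcgl wP xi hz)].
  - move=> j jA; have := tops_coef (normal_quot (@id_inj N) (@id_between N) df' (bd j jA)).
    by rewrite mcoeffZ mcoeffX eqxx mulr1.
  - have nz' g i : g \in msupp u \/ g \in msupp z -> i \notin A -> g i = 0%N.
      move=> guz iA; apply/eqP; apply: contraNT iA => gi.
      by case: guz => h; [apply: uA h gi|apply: zA h gi].
    by move=> i iA; rewrite !(nz' _ _ _ iA) //; left.
have := df'.1; rewrite -ff' mcoeff_msupp mcoeffB e subrr eqxx //.
Qed.

Lemma interval_stable (lo hi : nat) a b : polysub (iset N lo hi) a ->
  polysub (iset N lo hi) b -> polysub (iset N lo hi) (br a b).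
Proof.
move=> ha hb; have hXX k i : k \in iset N lo hi -> i \in iset N lo hi -> (i < k)%N ->
    polysub (iset N lo hi) (br 'X_k 'X_i).
  move=> hk hi' ik; rewrite (brXX Rpcgl ik).
  apply: (linclosedD (polysub_lin K _)).
    by apply: (linclosedZ _ (polysub_lin K _)); apply: polysubM; apply: polysubX.
  by apply: polysubS (deltaX Rsym ik) => l; move: hk hi'; rewrite !inE; lia.
have hN c : polysub (iset N lo hi) c -> polysub (iset N lo hi) (- c).
  exact: (linclosedN (polysub_lin K _)).
apply: (@is_der_stable _ _ (iset N lo hi) _ (br^~ b)) => // [|i hi'].
  exact: is_der_sub (br_der pb b).
rewrite anti; apply: (hN _).
apply: (@is_der_stable _ _ (iset N lo hi) _ (br^~ 'X_i)) => // [|k hk].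
  exact: is_der_sub (br_der pb 'X_i).
case: (ltngtP i k) => [ik|ki|/val_inj ->]; first exact: hXX.
  by rewrite anti; apply: hN; apply: hXX.
by rewrite (pb_alt pb); case: (polysub_lin K (iset N lo hi)).
Qed.

End Antisymmetric.

Section AntisymmetricCase.
Variables (K : fieldType) (n r : nat).
Hypothesis charK : [pchar K] =i pred0.
Local Notation N := n.+1.
Local Notation R := {mpoly K[N]}.
Variables (br : R -> R -> R) (act lie : {ffun 'I_r -> K} -> R -> R).
Variables (sigma delta : 'I_N -> R -> R) (lam : 'I_N -> 'I_N -> K).
Hypothesis Rpcgl : pcgl br act lie sigma delta lam.
Hypothesis Rsym : symmetric_pcgl lie delta lam.
Variable w : 'I_N -> 'I_r -> int.
Hypothesis wP : forall i h, in_torus h -> act h 'X_i = character (w i) h *: 'X_i.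
Hypothesis anti : forall a b, br a b = - br b a.
Variables (tau : 'S_N) (etatau : 'I_N -> int) (ytau : 'I_N -> R).
Hypothesis tauXi : Xi tau.
Hypothesis ytauP : prime_sequence br act tau etatau ytau.

Local Notation idpos := (@nat_of_ord N).
Local Notation taupos := (opos (rk tau)).

Let taupos_inj : injective taupos.
Proof. exact: (opos_inj (rkK tau)). Qed.

Lemma anti_same_lead v f f' :
  homogeneous_poisson_prime br act (polysub [set: 'I_N]) v ->
  lead idpos v f -> lead taupos v f' -> f = f'.
Proof.
move=> /prime_normal nv; apply: (normal_lead charK Rpcgl Rsym wP anti nv).
- exact: id_inj.
- exact: id_between.
- exact: taupos_inj.
- exact: Xi_between tauXi.
Qed.

(** For the original order and for its reverse the leading monomial of [ytau k] is
    the same product, and these two orders bound from above and below the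
    generators that occur in [ytau k]. *)
Lemma anti_interval_good k (lo hi : 'I_N) :
  class_exp (rk tau) etatau k lo != 0%N -> class_exp (rk tau) etatau k hi != 0%N ->
  (forall i, class_exp (rk tau) etatau k i != 0%N -> (lo <= i <= hi)%N) ->
  [/\ homogeneous_poisson_prime br act (polysub (iset N lo hi)) (ytau k),
      leading_term (ytau k) 1 (class_exp (rk tau) etatau k)
    & forall z, homogeneous_poisson_prime br act (polysub (iset N lo hi)) z ->
        leading_term z 1 (class_exp (rk tau) etatau k) -> z = ytau k].
Proof.
set f := class_exp _ _ _ => flo fhi hf; set u := ytau k.
have hu : homogeneous_poisson_prime br act (polysub (upto tau k)) u.
  exact: seq_prime_self ytauP k.
have nu := prime_normal hu; have [uA u0 _ _] := nu.
have tf : lead taupos u f := seq_lead (tauK tau) (rkK tau) ytauP k.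
have lead_all pos : injective pos -> between pos -> lead pos u f.
  move=> pinj pbet; have [g ug] := lead_ex pinj u0.
  by rewrite (normal_lead charK Rpcgl Rsym wP anti nu taupos_inj (Xi_between tauXi) pinj pbet tf ug).
have idf := lead_all _ (@id_inj N) (@id_between N).
have revf := lead_all _ (@revpos_inj N) (@revpos_between N).
have uI : polysub (iset N lo hi) u.
  move=> m i mu mi; rewrite inE; apply/andP; split; rewrite leqNgt; apply/negP => hi'.
    move/negP: mi; apply; apply/eqP; apply: (lead_top0 revf mu) => j ij.
    apply/eqP/negPn/negP => /hf /andP [lj _]; move: ij; rewrite /revpos.
    by have := ltn_ord j; lia.
  move/negP: mi; apply; apply/eqP; apply: (lead_top0 idf mu) => j ij.
  by apply/eqP/negPn/negP => /hf /andP [_ jh]; lia.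
have IA : {subset iset N lo hi <= upto tau k}.
  have inA j : f j != 0%N -> (rk tau j <= k)%N.
    by rewrite mnmE; case: (_ <= _)%N.
  exact: iset_upto (inA _ flo) (inA _ fhi).
have pI : homogeneous_poisson_prime br act (polysub (iset N lo hi)) u.
  split; first by case: hu.
  apply: (prime_restrict IA hu.2 uI) => a Ia.
  exact: (interval_stable Rpcgl Rsym anti).
have coefu : u@_f = 1 := seq_coef (tauK tau) (rkK tau) ytauP k.
split=> //; first by split; [exact: oner_neq0|exact: coefu|exact: idf.2].
move=> z pz [_ cz lz].
have idz : lead idpos z f by split=> //; rewrite mcoeff_msupp cz oner_neq0.
apply: (normal_unique charK Rpcgl Rsym wP anti (prime_normal pz) (prime_normal pI) idz idf).
by rewrite cz coefu.
Qed.

End AntisymmetricCase.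

(** * Rigidity of the bracket *)

Section Rigidity.
Variables (K : fieldType) (N : nat).
Hypothesis charK : [pchar K] =i pred0.
Local Notation R := {mpoly K[N]}.
Variable br : R -> R -> R.
Hypothesis pb : poisson_bracket br.
Implicit Types (a b c d p q : R) (f g : R -> R) (S : R -> Prop).

Lemma two_neq0 : 2%:R != 0 :> R.
Proof.
have -> : 2%:R = (2%:R : K)%:MP :> R by rewrite rmorph_nat.
by rewrite mpolyC_eq0; move/pcharf0P: charK => ->.
Qed.

Lemma addrr_inj a b : a + a = b + b -> a = b.
Proof. by move=> e; apply: (mulfI two_neq0); rewrite !mulr_natl !mulr2n. Qed.

Lemma anti_on S a b : linclosed S -> (forall d, is_der S (br d)) -> S a -> S b ->
  br a b = - br b a.
Proof.
move=> hS hd Sa Sb; have Sab := linclosedD hS Sa Sb.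
have := pb_alt pb (a + b); rewrite (is_derD (hd _)) // !(brDl pb) !(pb_alt pb).
by rewrite add0r addr0 addrC => /eqP; rewrite addr_eq0 => /eqP.
Qed.

Section RigidSubalgebra.
Variable S : R -> Prop.
Hypotheses (Slin : linclosed S) (Smul : mulclosed S).
Hypothesis Sbr : forall a b, S a -> S b -> S (br a b).
Hypothesis Sder : forall d, is_der S (br d).

Let S0 : S 0. Proof. by case: Slin. Qed.

(** Put [c2 = br b c] and [c' = - br c b]. The Jacobi identity for [- b], [b],
    [c] shows that [br b] agrees on [c2] and [c'], hence so does [br (b ^+ 2)].
    Comparing the Jacobi identities for [a], [b], [c2] and [a], [b], [c'], and
    then those with [b ^+ 2] in place of [b], leaves only the terms below. *)
Lemma rigid_core a b c : S a -> S b -> br a b * br (br b c + br c b) b = 0.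
Proof.
move=> Sa Sb; pose c2 := br b c; pose c' := - br c b.
have e1 : br b c2 = br b c'.
  have := pb_jacobi pb (- b) b c.
  rewrite !(brNl pb) (pb_alt pb) oppr0 (is_der0 S0 (Sder c)) addr0.
  by rewrite (is_derN S0 (Sder c)) // => /eqP; rewrite addrC subr_eq0 => /eqP.
have cmp b1 : br b1 c2 = br b1 c' ->
    br b1 (br c2 a) + br c2 (br a b1) = br b1 (br c' a) + br c' (br a b1).
  move=> e; have := pb_jacobi pb a b1 c2; have := pb_jacobi pb a b1 c'.
  by rewrite e -!addrA => <- /addrI ->.
have E1 := cmp b e1.
have E2 : br (b * b) (br c2 a) + br c2 (br a (b * b)) =
    br (b * b) (br c' a) + br c' (br a (b * b)).
  by apply: cmp; rewrite !(brMl pb) e1.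
have Sab := Sbr Sa Sb.
move: E2; rewrite !(brMl pb) !(Sder a).2 // ![br _ (_ * _ + _ * _)](is_derD (Sder _));
  try exact: Smul.
rewrite ![br _ (br a b * b)](Sder _).2 // ![br _ (b * br a b)](Sder _).2 //.
move: E1; set x := br b (br c2 a); set x' := br b (br c' a).
set z := br c2 (br a b); set z' := br c' (br a b) => E1 E2.
set C := br c2 b in E2 *; set C' := br c' b in E2 *.
have -> : br (br b c + br c b) b = C - C' by rewrite /C /C' -(brBl pb) /c2 /c' opprK.
apply: addrr_inj; rewrite addr0.
transitivity (x * b + b * x + (z * b + br a b * C + (C * br a b + b * z)) -
  (x' * b + b * x' + (z' * b + br a b * C' + (C' * br a b + b * z'))) -
  (b + b) * ((x + z) - (x' + z'))); first by ring.
by rewrite E2 E1 !subrr mulr0 subr0.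
Qed.

(** Let [V b = br b c + br c b], a derivation of [S] into [R]. By [rigid_core],
    [V b] commutes with [b] if [b] does not commute with all of [S], and adding
    [s'] or [- s'] to [b] removes this condition. Polarization, and then the choice
    of a square for one of the two elements, gives [br b1 b2 * V b1 = 0]. So
    [V] vanishes on elements that do not commute with all of [S], and the other
    elements are differences of two such. *)
Lemma rigidity s s' b c : S s -> S s' -> br s s' != 0 -> S b -> br b c = - br c b.
Proof.
move=> Ss Ss' nss Sb; pose V b := br b c + br c b.
suff : V b = 0 by move/eqP; rewrite addr_eq0 => /eqP.
have Vder : is_der S V.
  apply: is_der_eq (is_der_comb 1 1 (is_der_sub (fun _ _ => I) (br_der pb c)) (Sder c)) => //.
  by move=> a _; rewrite !mul1r.
have core a b1 : S a -> S b1 -> br a b1 * br (V b1) b1 = 0 by exact: rigid_core.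
clearbody V; have SD := linclosedD Slin; have SB := linclosedB Slin.
have VD a a' : S a -> S a' -> V (a + a') = V a + V a' by exact: is_derD.
have VB a a' : S a -> S a' -> V (a - a') = V a - V a'.
  by move=> Sa Sa'; rewrite VD ?(is_derN S0 Vder) //; apply: linclosedN.
have brD d a a' : S a -> S a' -> br d (a + a') = br d a + br d a'.
  exact: (is_derD (Sder d)).
have brB d a a' : S a -> S a' -> br d (a - a') = br d a - br d a'.
  by move=> Sa Sa'; rewrite brD ?(is_derN S0 (Sder d)) //; apply: linclosedN.
have P1 a b1 : S a -> S b1 -> br a b1 != 0 -> br (V b1) b1 = 0.
  move=> Sa Sb1 n1; have /eqP := core _ _ Sa Sb1.
  by rewrite mulf_eq0 (negbTE n1) => /eqP.
have Ps' := P1 _ _ Ss Ss' nss.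
have P b1 : S b1 -> br (V b1) b1 = 0.
  move=> Sb1; case: (eqVneq (br s b1) 0) => [z1|]; last exact: P1.
  have := P1 s (b1 + s') Ss (SD _ _ Sb1 Ss'); rewrite brD // z1 add0r => /(_ nss).
  have := P1 s (b1 - s') Ss (SB _ _ Sb1 Ss'); rewrite brB // z1 sub0r oppr_eq0.
  move=> /(_ nss); rewrite VB // VD // brB // brD // !(brDl pb) !(brNl pb) Ps'.
  move=> h1 h2; apply: addrr_inj; rewrite addr0.
  by rewrite -[RHS](addr0 0) -[X in _ = X + _]h1 -[X in _ = _ + X]h2; ring.
have Q b1 b2 : S b1 -> S b2 -> br (V b1) b2 + br (V b2) b1 = 0.
  move=> S1 S2; have := P (b1 + b2) (SD _ _ S1 S2).
  by rewrite VD // !brD // !(brDl pb) !P // add0r addr0 addrC.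
have W b1 b2 : S b1 -> S b2 -> br b1 b2 * V b1 = 0.
  move=> S1 S2; have := Q b2 (b1 * b1) S2 (Smul S1 S1).
  rewrite (Sder _).2 // Vder.2 // (brDl pb) !(brMl pb) => h.
  apply: addrr_inj; rewrite addr0 -[RHS]h.
  rewrite (_ : br (V b2) b1 = - br (V b1) b2); first by ring.
  by apply/eqP; rewrite -addr_eq0; apply/eqP; apply: Q.
have Vnc b1 b2 : S b1 -> S b2 -> br b1 b2 != 0 -> V b1 = 0.
  by move=> S1 S2 n1; have /eqP := W _ _ S1 S2; rewrite mulf_eq0 (negbTE n1) => /eqP.
have Vs : V s = 0 by exact: Vnc nss.
case: (eqVneq (br b s') 0) => [z|]; last exact: Vnc.
have := Vnc (b + s) s' (SD _ _ Sb Ss) Ss'; rewrite (brDl pb) z add0r => /(_ nss).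
by rewrite VD // Vs addr0.
Qed.

End RigidSubalgebra.
End Rigidity.

(** * Propagation of antisymmetry *)

Section Extension.
Variables (K : fieldType) (N r : nat).
Hypothesis charK : [pchar K] =i pred0.
Local Notation R := {mpoly K[N]}.
Local Notation mon := 'X_{1..N}.
Variables (br : R -> R -> R) (act lie : {ffun 'I_r -> K} -> R -> R).
Variables (sigma delta : 'I_N -> R -> R) (lam : 'I_N -> 'I_N -> K).
Hypothesis Rpcgl : pcgl br act lie sigma delta lam.
Hypothesis Rsym : symmetric_pcgl lie delta lam.
Implicit Types (a b c d p q : R) (i j l : 'I_N) (k : nat) (S : R -> Prop).

Local Notation below := (@below N).
Let pb := pbr Rpcgl.

(** As the bracket is a derivation in its first argument, it suffices to test
    the second one against generators. *)
Lemma second_der S : linclosed S -> mulclosed S ->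
  (forall i, is_der S (br 'X_i)) -> forall c, is_der S (br c).
Proof.
move=> Sl Sm hX c; apply: (@mpoly_alg_ind _ _ (fun c => is_der S (br c))) => //.
- split=> [|t a b ha hb].
    by split=> *; rewrite ?(br0l pb) ?scaler0 ?addr0 ?mul0r ?mulr0 ?addr0.
  apply: is_der_eq (is_der_comb t%:MP 1 ha hb) => // d _.
  by rewrite (brDl pb) (brZl pb) mul_mpolyC mul1r.
- move=> a b ha hb; apply: is_der_eq (is_der_comb b a ha hb) => // d _.
  by rewrite (brMl pb) mulrC.
- by split=> *; rewrite ?(br1l pb) ?scaler0 ?addr0 ?mul0r ?mulr0 ?addr0.
Qed.

Definition anti_below k : Prop :=
  forall a, polysub (below k) a -> forall c, br a c = - br c a.

Lemma is_der_opp S f : is_der S f -> is_der S (fun a : R => - f a).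
Proof.
move=> [fl fm]; split=> [t a b Sa Sb|a b Sa Sb]; first by rewrite fl // opprD scalerN.
by rewrite fm // opprD mulNr mulrN.
Qed.

Lemma anti_second i S : linclosed S -> mulclosed S ->
  (forall c, br 'X_i c = - br c 'X_i) -> is_der S (br 'X_i).
Proof.
move=> Sl Sm h; apply: is_der_eq (is_der_opp (is_der_sub (fun _ _ => I) (br_der pb 'X_i))) => //.
Qed.

Lemma anti_below_gen k : (forall i, (i < k)%N -> forall c, br 'X_i c = - br c 'X_i) ->
  anti_below k.
Proof.
move=> h a ka c; have der := second_der (polysub_lin K _) (@polysubM K N (below k)).
have {}der d : is_der (polysub (below k)) (br d).
  apply: der => i; case: (ltnP i k) => ik.
    by apply: anti_second (h i ik); [exact: polysub_lin|exact: polysubM].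
  apply: is_der_sub (brX_der Rpcgl i) => b; apply: polysubS; exact: belowS.
apply: (is_der_ext (f := br^~ c) (g := fun a => - br c a)) ka.
- exact: is_der_sub (br_der pb c).
- exact/is_der_opp/der.
- by move=> i; rewrite inE => /h.
Qed.

Lemma antiX_stable k i j : (forall i' c, (i' < k)%N -> br 'X_i' c = - br c 'X_i') ->
  (i <= k)%N -> (j <= k)%N -> polysub (below k.+1) (br 'X_i 'X_j).
Proof.
move=> h ik jk; have st i' j' : (i' < j')%N -> (j' <= k)%N ->
    polysub (below k.+1) (br 'X_j' 'X_i').
  move=> ij' jk'; apply: polysubS (brXX_stable Rpcgl Rsym ij'); exact: belowS.
case: (ltngtP i j) => [ij|ji|/val_inj ->].
- rewrite h; last by lia.
  by apply: (linclosedN (polysub_lin K _)); apply: st.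
- exact: st.
- by rewrite (pb_alt pb); case: (polysub_lin K (below k.+1)).
Qed.

(** From [R_(k-1)] to [R_k]: the identity [br d d = 0] gives the derivation property
    of [br x_k] on [R_k], and [rigidity] does the rest. *)
Lemma anti_belowS (k : 'I_N) a b : anti_below k -> polysub (below k) a ->
  polysub (below k) b -> br a b != 0 -> anti_below k.+1.
Proof.
move=> hk ka kb nab.
have hX i c : (i < k)%N -> br 'X_i c = - br c 'X_i.
  by move=> ik; apply: hk; apply: polysubX; rewrite inE.
have Sl := polysub_lin K (below k.+1); have Sm := @polysubM K N (below k.+1).
pose e (d : R) := \sum_(i < N | (i < k)%N) mderiv i d * br 'X_k 'X_i.
have e_der S : is_der S e.
  have h : is_der S (fun d => \sum_(i < N) (if (i < k)%N then br 'X_k 'X_i else 0) * mderiv i d).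
    apply: is_der_sum => i; apply: is_der_scale.
    exact: is_der_sub (fun _ _ => I) (@is_der_mderiv K N i).
  have eE d : e d = \sum_(i < N) (if (i < k)%N then br 'X_k 'X_i else 0) * mderiv i d.
    rewrite /e big_mkcond; apply: eq_bigr => i _.
    by case: ifP => _; rewrite ?mul0r // mulrC.
  by split=> [t c d Sc Sd|c d Sc Sd]; rewrite !eE; [apply: h.1|apply: h.2].
have eX d : polysub (below k.+1) d -> br 'X_k d = e d.
  move=> kd; case: (eqVneq (mderiv k d) 0) => [dk0|dk].
    have kd' : polysub (below k) d.
      apply: polysubS (mderiv0_polysub charK kd dk0) => i; rewrite !inE -val_eqE /=.
      lia.
    apply: (is_der_ext (brX_der Rpcgl k)) kd' => //.
    move=> i; rewrite inE => ik; rewrite /e (bigD1 i) //= mderivXX eqxx mul1r.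
    by rewrite big1 ?addr0 // => i' /andP [_ /negbTE ii]; rewrite mderivXX ii mul0r.
  apply: (mulfI dk).
  have sumE (F : 'I_N -> R) : \sum_i mderiv i d * F i =
      \sum_(i < N | (i < k)%N) mderiv i d * F i + mderiv k d * F k.
    rewrite (bigD1 k) //= addrC; congr (_ + _).
    rewrite big_mkcond [RHS]big_mkcond; apply: eq_bigr => i _.
    case: (ltngtP i k) => [ik|ki|/val_inj ->]; last by rewrite eqxx.
      by rewrite (_ : i != k) //; apply/eqP => ik'; rewrite ik' ltnn in ik.
    by rewrite (mderiv_polysub0 kd) ?mul0r ?if_same // inE; lia.
  have := pb_alt pb d; rewrite {1}(is_derE d (br_der pb d)) sumE.
  move/eqP; rewrite addrC addr_eq0 => /eqP ->.
  have -> : \sum_(i < N | (i < k)%N) mderiv i d * br 'X_i d =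
      - \sum_(i < N | (i < k)%N) \sum_(j < N | (j < k)%N)
          mderiv i d * (mderiv j d * br 'X_j 'X_i) - mderiv k d * e d.
    rewrite /e mulr_sumr -!sumrN -big_split; apply: eq_bigr => i ik /=.
    rewrite hX // (is_derE d (br_der pb 'X_i)) sumE mulrN mulrDr opprD mulr_sumr.
    by congr (_ - _); ring.
  set s := (X in - (- X - _)); suff -> : s = 0 by rewrite oppr0 sub0r opprK.
  apply: (addrr_inj charK); rewrite addr0; apply/eqP; rewrite addr_eq0; apply/eqP.
  rewrite {1}/s exchange_big -sumrN; apply: eq_bigr => i ik.
  rewrite -sumrN; apply: eq_bigr => j jk.
  by rewrite (hX i) //; ring.
have der : forall c, is_der (polysub (below k.+1)) (br c).
  apply: second_der => // i; case: (ltngtP i k) => [ik|ki|/val_inj ->].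
  - by apply: anti_second => // c; apply: hX.
  - apply: is_der_sub (brX_der Rpcgl i) => d; apply: polysubS; exact: belowS.
  - by apply: is_der_eq (e_der _) => // d /eX.
have Sbr c d : polysub (below k.+1) c -> polysub (below k.+1) d ->
    polysub (below k.+1) (br c d).
  move=> kc kd; apply: (@is_der_stable _ _ (below k.+1) _ (br^~ d)) => //.
    exact: is_der_sub (fun _ _ => I) (br_der pb d).
  move=> i; rewrite inE ltnS => ik.
  apply: (@is_der_stable _ _ (below k.+1) _ (br 'X_i)) => // j; rewrite inE ltnS => jk.
  by apply: antiX_stable => // i' c'; apply: hX.
have Sa : polysub (below k.+1) a by apply: polysubS ka; exact: belowS.
have Sb : polysub (below k.+1) b by apply: polysubS kb; exact: belowS.
by move=> c kc d; exact: (rigidity charK pb Sl Sm Sbr der d Sa Sb nab kc).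
Qed.

Lemma anti_all k a b : (k <= N)%N -> anti_below k -> polysub (below k) a ->
  polysub (below k) b -> br a b != 0 -> forall c d, br c d = - br d c.
Proof.
move=> kN hk ka kb nab.
have main e : (k + e <= N)%N -> anti_below (k + e).
  elim: e => [|e IH] ke; first by rewrite addn0.
  have keN : (k + e < N)%N by lia.
  rewrite addnS; apply: (@anti_belowS (Ordinal keN) a b) => //=.
  - by apply: IH; lia.
  - by apply: polysubS ka; apply: belowS; lia.
  - by apply: polysubS kb; apply: belowS; lia.
move=> c d; have h := main (N - k)%N; rewrite subnKC // in h; apply: h => //.
by apply: polysubS (@polysubT K N c) => i _; rewrite inE.
Qed.

End Extension.

(** * Antisymmetry from two non-central variables *)

Section TwoNonCentral.
Variables (K : fieldType) (N r : nat).
Hypothesis charK : [pchar K] =i pred0.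
Local Notation R := {mpoly K[N]}.
Local Notation mon := 'X_{1..N}.
Variables (br : R -> R -> R) (act lie : {ffun 'I_r -> K} -> R -> R).
Variables (sigma delta : 'I_N -> R -> R) (lam : 'I_N -> 'I_N -> K).
Hypothesis Rpcgl : pcgl br act lie sigma delta lam.
Hypothesis Rsym : symmetric_pcgl lie delta lam.
Variable w : 'I_N -> 'I_r -> int.
Hypothesis wP : forall i h, in_torus h -> act h 'X_i = character (w i) h *: 'X_i.
Variables (eta : 'I_N -> int) (y : 'I_N -> R).
Hypothesis yP : prime_sequence br act id eta y.
Implicit Types (a b c p q v : R) (m f g : mon) (i j k l : 'I_N).

Local Notation below := (@below N).
Local Notation central := (central br).
Let pb := pbr Rpcgl.

Variables l1 l2 : 'I_N.
Hypotheses (l12 : (l1 < l2)%N) (c1 : forall k, (k < l1)%N -> central k).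
Hypotheses (nc1 : ~~ central l1).
Hypothesis c12 : forall k, (l1 < k)%N -> (k < l2)%N -> central k.
Hypothesis nc2 : ~~ central l2.

Local Notation B := (polysub (below l2)).

Let Blin : linclosed B := polysub_lin K (below l2).
Let Bmul : mulclosed B := @polysubM K N (below l2).

Lemma BX i : (i < l2)%N -> B ('X_i : R).
Proof. by move=> il; apply: polysubX; rewrite inE. Qed.

Lemma pred_none k : (k < l2)%N -> k != l1 -> pred_eta eta k = None.
Proof.
move=> kl kl1; apply: (central_first Rpcgl Rsym wP yP).
case: (ltngtP k l1) => [kk|kk|/val_inj e]; [exact: c1|exact: c12|].
by rewrite e eqxx in kl1.
Qed.

Lemma frontier k : (k < l2)%N -> (forall k', pred_eta eta k' = Some k -> (l2 <= k')%N) ->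
  poisson_prime br B (y k).
Proof.
move=> kl hk; have ll : (l2.-1 < N)%N by have := ltn_ord l2; lia.
have lE : (Ordinal ll).+1 = l2 by rewrite /= prednK //; lia.
rewrite -lE; apply: (y_frontier yP) => /=; first by lia.
rewrite /succ_gt; case e: (succ_eta eta k) => [k'|] //=.
by have := hk _ (succ_pred e); lia.
Qed.

Lemma frontierX i b : (i < l2)%N -> i != l1 -> pred_eta eta l1 <> Some i -> B b ->
  B (br 'X_i b).
Proof.
move=> il il1 np Bb; have yi : y i = 'X_i by apply: (ps_first yP); apply: pred_none.
have hp : poisson_prime br B (y i).
  apply: frontier => // k' e; rewrite leqNgt; apply/negP => kl.
  have [k1|k1] := eqVneq k' l1; first by rewrite k1 in e.
  by rewrite pred_none in e.
have [p [Bp]] := pp_normal hp Bb; rewrite yi => ->.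
by apply: Bmul => //; apply: BX.
Qed.

Lemma frontier_l1 b : B b -> B (br (y l1) b).
Proof.
move=> Bb; have hp : poisson_prime br B (y l1).
  apply: frontier => // k' e; rewrite leqNgt; apply/negP => kl.
  have [k1|k1] := eqVneq k' l1; last by rewrite pred_none in e.
  by have [] := pred_etaP e; rewrite k1 ltnn.
have [p [Bp ->]] := pp_normal hp Bb; apply: Bmul => //; exact: (pp_mem hp).
Qed.

(** Polynomials in thin monomials are few enough for brackets with them to stay in
    [R_(l2-1)], and yet contain the elements [x_j] and [x_j^2 x_l1], which do not
    commute. *)
Definition thin j m : Prop :=
  (forall i, m i != 0%N -> (i <= l1)%N) /\ (2 * m l1 <= m j)%N.

Lemma thin_below j b : inmon (thin j) b -> B b.
Proof.
move=> hb m i mb mi; rewrite inE; have [h _] := hb m mb.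
exact: leq_ltn_trans (h i mi) l12.
Qed.

Lemma mderiv_stable (A : {set 'I_N}) i b : polysub A b -> polysub A (mderiv i b).
Proof.
apply: (is_der_stable (B := A)) => // [|k kA].
  exact: is_der_sub (fun _ _ => I) (@is_der_mderiv K N i).
rewrite mderivXX; case: eqP => _; first exact: polysub1.
by case: (polysub_lin K A).
Qed.

Lemma euler_coef i b m : ('X_i * mderiv i b)@_m = b@_m *+ m i.
Proof.
case: (posnP (m i)) => [mi|mi].
  by rewrite mi mulr0n mulrC (@mcoeffMX0 _ _ _ _ _ i) // mnm1E eqxx mi.
have mE : m = (U_(i) + (m - U_(i)))%MM.
  by apply/mnmP => k; rewrite mnmDE mnmBE mnm1E; case: (i =P k) => [<-|_]; lia.
rewrite {1}mE mcoeff_XM mcoeff_deriv mnmBE mnm1E eqxx addmC -mE.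
by congr (_ *+ _); lia.
Qed.

(** A prime element of [R_(l2-1)] divides its brackets. For a generator that is
    a prime element this is what is wanted. If the class of [x_l1] is [x_j], [x_l1],
    the prime element [x_j x_l1 - g x^m] yields a linear relation between [br x_j b]
    and [br x_l1 b] modulo [R_(l2-1)], and [br b b = 0] yields another one. The
    determinant of the two is [x_j d_j b - x_l1 d_l1 b]. If it vanishes, each
    monomial of [b] has the same degree in [x_j] and in [x_l1], so that a thin [b]
    does not involve [x_l1] and [br x_l1 b] is given by the presentation. *)
Lemma thin_stable : exists j, [/\ (j < l1)%N, br 'X_l1 'X_j != 0 &
  forall b, inmon (thin j) b -> forall i, (i < l2)%N -> B (br 'X_i b)].
Proof.
case e: (pred_eta eta l1) => [j|]; last first.
  have [j jl nj] : exists2 j : 'I_N, (j < l1)%N & br 'X_l1 'X_j != 0.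
    apply: NNPP => h; move/negP: nc1; apply; apply/centralP => j jl.
    by apply/eqP/negPn/negP => nj; apply: h; exists j.
  exists j; split=> // b /thin_below Bb i il.
  have [->|il1] := eqVneq i l1; last by apply: frontierX => //; rewrite e.
  by rewrite -(ps_first yP e); apply: frontier_l1.
have [jl _ _] := pred_etaP e; have jl2 : (j < l2)%N by lia.
have [g [m [yE g0 lam0 hm]]] := pair_structure charK Rpcgl Rsym wP yP c1 e.
have nj : br 'X_l1 'X_j != 0.
  apply: contraNneq lam0 => z; rewrite -(lam_coef Rpcgl Rsym jl) z mcoeff0 //.
exists j; split=> // b hb; have Bb := thin_below hb.
have other i : (i < l2)%N -> i != l1 -> i != j -> B (br 'X_i b).
  by move=> il il1 ij; apply: frontierX => //; rewrite e => -[] ji; rewrite ji eqxx in ij.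
have rho : B ('X_l1 * br 'X_j b + 'X_j * br 'X_l1 b).
  have -> : 'X_l1 * br 'X_j b + 'X_j * br 'X_l1 b = br (y l1) b + g *: br 'X_[m] b.
    by rewrite yE (brBl pb) (brZl pb) subrK (brMl pb) mulrC.
  apply: (linclosedD Blin); first exact: frontier_l1.
  apply: (linclosedZ _ Blin).
  have mA : polysub [set k : 'I_N | (j < k < l1)%N] ('X_[m] : R).
    by move=> m' k; rewrite msuppX inE => /eqP -> /hm; rewrite inE.
  apply: (is_der_stable (f := br^~ b)) mA.
  - exact: is_der_sub (fun _ _ => I) (br_der pb b).
  - by move=> k; rewrite !inE; lia.
  - move=> k; rewrite inE => /andP [jk kl]; apply: other; first by lia.
      by apply/eqP => ke; rewrite ke ltnn in kl.
    by apply/eqP => ke; rewrite ke ltnn in jk.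
have rho' : B (mderiv j b * br 'X_j b + mderiv l1 b * br 'X_l1 b).
  have := is_derE b (br_der pb b); rewrite (pb_alt pb).
  rewrite (bigD1 j) //= (bigD1 l1) /=; last by apply/eqP => l1j; rewrite l1j ltnn in jl.
  rewrite addrA => /esym/eqP; rewrite addr_eq0 => /eqP ->.
  apply: (linclosedN Blin); rewrite big_seq_cond; elim/big_rec: _ => [|i a]; first by case: Blin.
  case/and3P=> _ ij il1 Ba; apply: (linclosedD Blin) => //.
  case: (ltnP i l2) => il.
    by apply: Bmul; [apply: mderiv_stable|apply: other].
  by rewrite (mderiv_polysub0 Bb) ?mul0r ?inE; [case: Blin|lia].
pose D := 'X_j * mderiv j b - 'X_l1 * mderiv l1 b.
have Dg : B (br 'X_j b * D).
  have -> : br 'X_j b * D = 'X_j * (mderiv j b * br 'X_j b + mderiv l1 b * br 'X_l1 b)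
      - mderiv l1 b * ('X_l1 * br 'X_j b + 'X_j * br 'X_l1 b) by rewrite /D; ring.
  apply: (linclosedB Blin); apply: Bmul => //; first exact: BX.
  exact: mderiv_stable.
have gh : B (br 'X_j b) /\ B (br 'X_l1 b).
  have [D0|Dn0] := eqVneq D 0.
    have bl1 : polysub (below l1) b.
      move=> f i fb fi; have [h1 h2] := hb f fb; rewrite inE ltn_neqAle (h1 i fi) andbT.
      apply: contraNneq fi => /val_inj il1; subst i.
      have : D@_f = 0 by rewrite D0 mcoeff0.
      rewrite mcoeffB !euler_coef => /eqP; rewrite subr_eq0 => /eqP.
      have fb0 : b@_f != 0 by rewrite -mcoeff_msupp.
      by move/(natmul_inj0 charK fb0) => fj; apply/eqP; lia.
    have hB : B (br 'X_l1 b).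
      apply: (polysubS (@belowS N l1.+1 l2 l12)).
      apply: (is_der_stable (brX_der Rpcgl l1)) bl1; first by apply: belowS.
      by move=> i; rewrite inE; apply: (brXX_stable Rpcgl Rsym).
    split=> //; apply: (@polysub_quot _ _ _ _ 'X_l1); first exact: mX_neq0.
    have -> : br 'X_j b * 'X_l1 = ('X_l1 * br 'X_j b + 'X_j * br 'X_l1 b) -
      'X_j * br 'X_l1 b by ring.
    by apply: (linclosedB Blin) => //; apply: Bmul => //; apply: BX.
  have gB := polysub_quot Dn0 Dg; split=> //.
  apply: (@polysub_quot _ _ _ _ 'X_j); first exact: mX_neq0.
  have -> : br 'X_l1 b * 'X_j = ('X_l1 * br 'X_j b + 'X_j * br 'X_l1 b) -
    'X_l1 * br 'X_j b by ring.
  by apply: (linclosedB Blin) => //; apply: Bmul => //; apply: BX.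
move=> i il; have [->|ij] := eqVneq i j; first by case: gh.
have [->|il1] := eqVneq i l1; first by case: gh.
exact: other.
Qed.

Section Thin.
Variable j : 'I_N.
Hypotheses (jl : (j < l1)%N) (nj : br 'X_l1 'X_j != 0).
Hypothesis stab : forall b, inmon (thin j) b -> forall i, (i < l2)%N -> B (br 'X_i b).

Local Notation S := (inmon (K := K) (thin j)).
Local Notation wj := ('X_j * 'X_j * 'X_l1 : R).

Let Slin : linclosed S := @inmon_lin K N (thin j).

Lemma thin_mul : mulclosed S.
Proof.
move=> a b ha hb; apply: (inmonM (P := thin j) (Q := thin j)) ha hb.
move=> m m' [h1 h2] [h1' h2']; split=> [i|]; last by rewrite !mnmDE; lia.
by rewrite mnmDE addn_eq0 negb_and => /orP [/h1|/h1'].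
Qed.

Lemma thinX i : (i < l1)%N -> S ('X_i : R).
Proof.
move=> il m; rewrite msuppX inE => /eqP ->; split=> [k|].
  by rewrite mnm1E; case: (i =P k) => [<-|//] _; exact: ltnW.
by rewrite !mnm1E; case: (i =P l1) => [e|_]; [rewrite e ltnn in il|].
Qed.

Lemma thin1 : S (1 : R).
Proof. by move=> m; rewrite msupp1 inE => /eqP ->; split=> [i|]; rewrite !mnm0E. Qed.

Lemma thinw : S wj.
Proof.
rewrite -!mpolyXD => m; rewrite msuppX inE => /eqP ->; split=> [k|].
  rewrite !mnmDE !mnm1E; case: (j =P k) => [<-|_]; first by move=> _; exact: ltnW.
  by case: (l1 =P k) => [<-|].
rewrite !mnmDE !mnm1E !eqxx (_ : (j == l1) = false); last by apply/eqP => e; have := jl; rewrite e ltnn.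
by case: eqP => e //; have := jl; rewrite -e ltnn.
Qed.

(** The thin polynomials are generated by [x_i] for [i < l1] and [x_j^2 x_l1]. *)
Lemma thin_ind (T : R -> Prop) a : linclosed T -> mulclosed T -> T 1 ->
  (forall i, (i < l1)%N -> T 'X_i) -> T wj -> S a -> T a.
Proof.
move=> Tl Tm T1 TX Tw; apply: inmon_ind => // m [h1 h2].
have jl1 : j != l1 by apply/eqP => e; have := jl; rewrite e ltnn.
have -> : 'X_[m] = wj ^+ m l1 * 'X_j ^+ (m j - 2 * m l1) *
    \prod_(i < N | (i != j) && (i != l1)) 'X_i ^+ m i :> R.
  rewrite mpolyXE_id (bigD1 j) //= (bigD1 l1) /=; last by rewrite eq_sym.
  rewrite mulrA; congr (_ * _).
  have -> : 'X_j ^+ m j = 'X_j ^+ (m l1) * 'X_j ^+ (m l1) * 'X_j ^+ (m j - 2 * m l1) :> R.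
    by rewrite -!exprD; congr (_ ^+ _); lia.
  by rewrite !exprMn; ring.
have TXn := mulclosedXn _ T1 Tm.
apply: (Tm _ _); first by apply: (Tm _ _); apply: TXn => //; apply: TX.
apply: mulclosed_prod => // i /andP [ij il].
have [->|mi] := eqVneq (m i) 0%N; first by rewrite expr0.
apply: mulclosedXn => //; apply: TX; rewrite ltn_neqAle h1 // andbT.
by apply: contra_neq il => /val_inj.
Qed.

(** Write [E = br x_l2], a derivation of [R_(l2-1)]. Subtracting [2 a] times the
    Jacobi identity for [a], [b], [x_l2] from the one for [a ^+ 2], [b], [x_l2]
    expresses [2 E a * br a b] by brackets whose first argument is [b], and these
    are derivations in [b]. *)
Lemma second_quot a b : B a -> B (br a b) ->
  br 'X_l2 a * br a b + br 'X_l2 a * br a b =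
  a * br b (br 'X_l2 a) + a * br b (br 'X_l2 a) - br b (a * br 'X_l2 a + a * br 'X_l2 a).
Proof.
move=> Ba Bab; have E := brX_der Rpcgl l2; set x := br 'X_l2 a.
have J1 := pb_jacobi pb a b 'X_l2; have := pb_jacobi pb (a * a) b 'X_l2.
rewrite !(brMl pb) !E.2 // (is_derD E); try exact: Bmul.
rewrite !E.2 // -/x => J2; move: J1; rewrite -/x.
set p := br a (br b 'X_l2) in J2 *; set q := br 'X_l2 (br a b) in J2 *.
move=> J1; have -> : a * x + a * x = x * a + a * x by ring.
apply/eqP; rewrite -subr_eq0; apply/eqP.
rewrite -[RHS](subrr 0) -[X in _ = X - _]J2 -[X in _ = _ - X](mulr0 (a + a)) -J1.
ring.
Qed.

Lemma is_der_cancel p (f : R -> R) : p != 0 -> is_der S (fun b => p * f b) -> is_der S f.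
Proof.
move=> p0 [h1 h2]; split=> [t a b Sa Sb|a b Sa Sb]; apply: (mulfI p0).
  by rewrite h1 // mulrDr scalerAr.
by rewrite h2 //; ring.
Qed.

(** By [second_quot], [br a] is a derivation on thin polynomials when [E a] is
    non-zero; as [x_l2] is not central this holds for some generator [x_i0], and
    any [x_i] with [E x_i = 0] is the difference of [x_i + x_i0] and [x_i0]. *)
Lemma thin_der c : is_der S (br c).
Proof.
apply: (second_der Rpcgl Slin thin_mul).
have key a : B a -> (forall b, S b -> B (br a b)) -> br 'X_l2 a != 0 -> is_der S (br a).
  move=> Ba Bab na; apply: (@is_der_cancel (br 'X_l2 a + br 'X_l2 a)).
    apply/eqP => z; move/eqP: na; apply; apply: (addrr_inj charK).
    by rewrite z addr0.
  have h : is_der S (fun b => (a + a) * br b (br 'X_l2 a) +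
      (-1) * br b (a * br 'X_l2 a + a * br 'X_l2 a)).
    by apply: is_der_comb; apply: is_der_sub (fun _ _ => I) (br_der pb _).
  apply: is_der_eq h => //; last exact: thin_mul.
  by move=> b Sb; rewrite [RHS]mulrDl second_quot //; [ring|exact: Bab].
have [i0 il0 n0] : exists2 i0 : 'I_N, (i0 < l2)%N & br 'X_l2 'X_i0 != 0.
  apply: NNPP => h; move/negP: nc2; apply; apply/centralP => i il.
  by apply/eqP/negPn/negP => ni; apply: h; exists i.
have der0 : is_der S (br 'X_i0).
  by apply: key => //; [exact: BX|move=> b Sb; apply: stab].
move=> i; case: (ltnP i l2) => il; last first.
  apply: is_der_sub (brX_der Rpcgl i) => b /thin_below; apply: polysubS.
  exact: belowS.
have [z|ni] := eqVneq (br 'X_l2 'X_i) 0; last first.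
  by apply: key => //; [exact: BX|move=> b Sb; apply: stab].
have deri : is_der S (br ('X_i + 'X_i0)).
  apply: key.
  - by apply: (linclosedD Blin); apply: BX.
  - by move=> b Sb; rewrite (brDl pb); apply: (linclosedD Blin); apply: stab.
  - by rewrite (is_derD (brX_der Rpcgl l2)) ?z ?add0r //; apply: BX.
apply: is_der_eq (is_der_comb 1 (-1) deri der0) => //; last exact: thin_mul.
by move=> b Sb; rewrite (brDl pb); ring.
Qed.

Lemma thin_anti a b : S a -> S b -> br a b = - br b a.
Proof. by apply: (anti_on pb) => //; exact: thin_der. Qed.

Lemma br_thinw i : br wj 'X_i = ('X_j * 'X_l1 + 'X_j * 'X_l1) * br 'X_j 'X_i +
  'X_j * 'X_j * br 'X_l1 'X_i.
Proof. by rewrite !(brMl pb); ring. Qed.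

Lemma thin_br a b : S a -> S b -> S (br a b).
Proof.
have brXX0 i i' : (i < l1)%N -> (i' < l1)%N -> br 'X_i 'X_i' = 0.
  move=> il il'; case: (ltngtP i' i) => [ii|ii|/val_inj ->].
  - exact/(centralP _ _ (c1 il)).
  - by rewrite thin_anti ?(centralP _ _ (c1 il') _ ii) ?oppr0 //; apply: thinX.
  - exact: (pb_alt pb).
have wX i : (i < l1)%N -> S (br wj 'X_i).
  move=> il; rewrite br_thinw brXX0 // mulr0 add0r (brXX Rpcgl il) mulrDr.
  apply: (linclosedD Slin).
    rewrite -scalerAr; apply: (linclosedZ _ Slin).
    have -> : 'X_j * 'X_j * ('X_i * 'X_l1) = 'X_i * wj by ring.
    by apply: thin_mul; [exact: thinX|exact: thinw].
  apply: thin_mul; first by apply: thin_mul; apply: thinX.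
  move=> m md; have h k : m k != 0%N -> (i < k < l1)%N.
    by move=> mk; have := deltaX Rsym il md mk; rewrite inE; lia.
  split=> [k /h|]; first by case/andP=> _ /ltnW.
  have -> : m l1 = 0%N by apply/eqP/negPn/negP => /h; rewrite ltnn andbF.
  by rewrite muln0.
have S0 : S (0 : R) by case: Slin.
have SN c : S c -> S (- c) by exact: (linclosedN Slin).
have fst a0 b0 : S b0 -> (forall i, (i < l1)%N -> S (br 'X_i b0)) -> S (br wj b0) ->
    S a0 -> S (br a0 b0).
  move=> Sb0 hX hw Sa.
  suff [] : S a0 /\ S (br a0 b0) by [].
  move: Sa; apply: (@thin_ind (fun c => S c /\ S (br c b0))).
  - split=> [|t c d [Sc hc] [Sd hd]]; first by rewrite (br0l pb).
    by split; [apply: Slin.2|rewrite (brDl pb) (brZl pb); apply: Slin.2].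
  - move=> c d [Sc hc] [Sd hd]; split; first exact: thin_mul.
    by rewrite (brMl pb); apply: (linclosedD Slin); apply: thin_mul.
  - by rewrite (br1l pb); split=> //; exact: thin1.
  - by move=> i il; split; [exact: thinX|exact: hX].
  - by split; [exact: thinw|].
move=> Sa Sb.
suff [] : S b /\ S (br a b) by [].
move: Sb; apply: (@thin_ind (fun b => S b /\ S (br a b))).
- split=> [|t c d [Sc hc] [Sd hd]]; first by rewrite (is_der0 S0 (thin_der a)).
  by split; [apply: Slin.2|rewrite (thin_der a).1 //; apply: Slin.2].
- move=> c d [Sc hc] [Sd hd]; split; first exact: thin_mul.
  by rewrite (thin_der a).2 //; apply: (linclosedD Slin); apply: thin_mul.
- by rewrite (is_der1 thin1 (thin_der a)); split=> //; exact: thin1.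
- move=> i il; split; first exact: thinX.
  apply: fst => // [|i' il'|]; [exact: thinX|by rewrite brXX0|exact: wX].
- split; first exact: thinw.
  apply: fst => // [|i il|]; [exact: thinw| |by rewrite (pb_alt pb)].
  by rewrite thin_anti; [apply/SN/wX|exact: thinX|exact: thinw].
Qed.

Lemma thin_anti_all b c : S b -> br b c = - br c b.
Proof.
have Sj := thinX jl; apply: (rigidity charK pb Slin thin_mul thin_br thin_der _ thinw Sj).
by rewrite br_thinw (pb_alt pb) mulr0 add0r !mulf_neq0 ?mX_neq0.
Qed.

(** The bracket with [x_j^2 x_l1] determines the bracket with [x_l1], since
    [x_j^2] can be cancelled. *)
Lemma thin_all_anti c d : br c d = - br d c.
Proof.
have hX i a : (i < l1)%N -> br 'X_i a = - br a 'X_i.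
  by move=> il; apply: thin_anti_all; exact: thinX.
have hXl i : (i < l1)%N -> br 'X_l1 'X_i = - br 'X_i 'X_l1.
  by move=> il; rewrite (hX i _ il) opprK.
have wE a : br a wj = ('X_j * 'X_l1 + 'X_j * 'X_l1) * br a 'X_j + 'X_j * 'X_j * br a 'X_l1.
  apply: (is_der_extT (f := br^~ wj) (g := fun a => ('X_j * 'X_l1 + 'X_j * 'X_l1) * br a 'X_j +
    'X_j * 'X_j * br a 'X_l1)); first exact: (br_der pb).
    by apply: is_der_comb; exact: (br_der pb).
  move=> i; case: (ltngtP i l1) => [il|li|/val_inj ->].
  - by rewrite (hX i _ il) br_thinw (hXl i il) (hX j 'X_i jl); ring.
  - have D := brX_der Rpcgl i.
    have Xj : polysub (below i) ('X_j : R) by apply: polysubX; rewrite inE; lia.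
    have Xl : polysub (below i) ('X_l1 : R) by apply: polysubX; rewrite inE; lia.
    have Xjj := polysubM Xj Xj.
    by rewrite !D.2 //; ring.
  - have := @thin_anti_all wj 'X_l1 thinw; rewrite br_thinw (pb_alt pb) mulr0 addr0.
    move=> /(congr1 -%R); rewrite opprK => <-; rewrite hX //; ring.
have hl a : br 'X_l1 a = - br a 'X_l1.
  have := @thin_anti_all wj a thinw; rewrite wE !(brMl pb) (hX j a jl) => e.
  have h : 'X_j * 'X_j * (br 'X_l1 a + br a 'X_l1) = 0.
    move/eqP: e; rewrite -subr_eq0 => /eqP e; rewrite -[RHS]e; ring.
  move/eqP: h; rewrite !mulf_eq0 !(negbTE (mX_neq0 _ _)) /= addr_eq0.
  by move/eqP.
have anti1 : anti_below br l1.+1.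
  apply: (anti_below_gen Rpcgl) => i; rewrite ltnS leq_eqVlt => /orP [/eqP/val_inj ->|il] a.
    exact: hl.
  exact: hX.
apply: (anti_all charK Rpcgl Rsym (ltn_ord l1) anti1 _ _ nj);
by apply: polysubX; rewrite inE; lia.
Qed.

End Thin.

(** The thin polynomials are closed under the bracket, and [rigidity] applies to
    them; this gives antisymmetry of the brackets with [x_i] for [i <= l1], which
    then spreads to the other generators. *)
Lemma two_noncentral_anti c d : br c d = - br d c.
Proof. by have [j [jl nj st]] := thin_stable; exact: thin_all_anti jl nj st c d. Qed.

End TwoNonCentral.

(** * At most one non-central variable *)

Section OneNonCentral.
Variables (K : fieldType) (n r : nat).
Hypothesis charK : [pchar K] =i pred0.
Local Notation N := n.+1.
Local Notation R := {mpoly K[N]}.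
Local Notation mon := 'X_{1..N}.
Variables (br : R -> R -> R) (act lie : {ffun 'I_r -> K} -> R -> R).
Variables (sigma delta : 'I_N -> R -> R) (lam : 'I_N -> 'I_N -> K).
Hypothesis Rpcgl : pcgl br act lie sigma delta lam.
Hypothesis Rsym : symmetric_pcgl lie delta lam.
Variable w : 'I_N -> 'I_r -> int.
Hypothesis wP : forall i h, in_torus h -> act h 'X_i = character (w i) h *: 'X_i.
Variables (eta : 'I_N -> int) (y : 'I_N -> R).
Hypothesis yP : prime_sequence br act id eta y.
Variables (tau : 'S_N) (etatau : 'I_N -> int) (ytau : 'I_N -> R).
Hypothesis tauXi : Xi tau.
Hypothesis ytauP : prime_sequence br act tau etatau ytau.
Implicit Types (m f g : mon) (i j k : 'I_N).

Local Notation central := (central br).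
Local Notation pairing := (pairing w).
Local Notation idpos := (@nat_of_ord N).
Local Notation taupos := (opos (rk tau)).
Let pb := pbr Rpcgl.
Let taupos_inj : injective taupos := opos_inj (rkK tau).

Variable l : 'I_N.
Hypothesis cen : forall i, i != l -> central i.

Let cenl k : (k < l)%N -> central k.
Proof. by move=> kl; apply: cen; apply: contraTneq kl => ->; rewrite ltnn. Qed.

Lemma one_pred_none i : i != l -> pred_eta eta i = None.
Proof. by move=> il; apply: (central_first Rpcgl Rsym wP yP); apply: cen. Qed.

Lemma one_y i : i != l -> y i = 'X_i.
Proof. by move/one_pred_none/(ps_first yP). Qed.

(** Only [x_l] can have a predecessor, as central generators start new classes. *)
Lemma one_class i i' : (i < i')%N -> eta i = eta i' -> i' = l /\ pred_eta eta l = Some i.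
Proof.
move=> ii e; have [e'|i'l] := eqVneq i' l; last first.
  by case: (pred_eta_None (one_pred_none i'l) ii e).
subst i'; split=> //; case p: (pred_eta eta l) => [j|]; last by case: (pred_eta_None p ii e).
have [jl ej jmax] := pred_etaP p; congr Some; apply: val_inj.
have := jmax i ii e; rewrite leq_eqVlt => /orP [/eqP/esym //|ij].
have jl' : j != l by apply/eqP => jl'; rewrite jl' ltnn in jl.
by case: (pred_eta_None (one_pred_none jl') ij); rewrite ej.
Qed.

Lemma one_class' i i' : i != i' -> eta i = eta i' ->
  exists2 j, pred_eta eta l = Some j & (i = j /\ i' = l) \/ (i = l /\ i' = j).
Proof.
move=> ii e; case: (ltngtP i i') => [h|h|/val_inj h]; last by rewrite h eqxx in ii.
  by have [h1 h2] := one_class h e; exists i => //; left.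
by have [h1 h2] := one_class h (esym e); exists i' => //; right.
Qed.

(** Only [y_l] can have a second term, and the generators of that term lie strictly
    between those of the first one. *)
Lemma one_tops k : exists f, forall pos, injective pos -> between pos ->
  tops pos f (y k) 1.
Proof.
have X i : exists f, forall pos, injective pos -> between pos -> tops pos f ('X_i : R) 1.
  by exists U_(i)%MM => pos _ _; exact: topsX.
have [->|kl] := eqVneq k l; last by rewrite one_y.
case e: (pred_eta eta l) => [j|]; last by rewrite (ps_first yP e).
have [g [m [-> _ _ hm]]] := pair_structure charK Rpcgl Rsym wP yP cenl e.
exists (U_(j) + U_(l))%MM => pos pinj pbet; apply: pair_lead => //.
by case: (pred_etaP e).
Qed.

Lemma full_prime v : homogeneous_poisson_prime br act (polysub [set: 'I_N]) v ->
  exists k (t : K), [/\ succ_eta eta k = None, t != 0 & v = t *: y k].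
Proof.
have idK : cancel (@id 'I_N) id by [].
rewrite -(upto_max idK idK) => /(ps_list yP) [k [t [_ sk t0 ->]]].
exists k, t; split=> //; move: sk; rewrite /succ_gt; case: (succ_eta eta k) => // i.
by rewrite ltnNge leq_ord.
Qed.

Lemma one_same_lead v f f' :
  homogeneous_poisson_prime br act (polysub [set: 'I_N]) v ->
  lead idpos v f -> lead taupos v f' -> f = f'.
Proof.
move=> /full_prime [k [t [_ t0 ->]]] vf vf'; have [g hg] := one_tops k.
have lead_g pos : injective pos -> between pos -> lead pos (t *: y k) g.
  move=> pinj pbet; apply: (tops_lead (c := t * 1)); first by rewrite mulr1.
  by apply: topsZ; apply: hg.
rewrite (lead_uniq (@id_inj N) vf (lead_g _ (@id_inj N) (@id_between N))).
by rewrite (lead_uniq taupos_inj vf' (lead_g _ taupos_inj (Xi_between tauXi))).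
Qed.

(** The weights of the central variables are linearly independent, because the
    pairings with the [h_k] form a triangular matrix; so is some minor of the
    integral matrix of the weights, and its adjugate provides a cocharacter
    that is trivial on all of these variables but one. *)
Lemma cocharacter_exists i : i != l -> exists nu : 'I_r -> int, exists d : nat,
  [/\ d != 0%N, \sum_x w i x * nu x = d
    & forall i', i' != l -> i' != i -> \sum_x w i' x * nu x = 0].
Proof.
move=> il; pose A := \matrix_(a < n, x < r) (w (lift l a) x)%:~R : 'M[K]_(n, r).
have [hs hsP] := hk_exist Rpcgl wP.
have Afree : row_free A.
  apply: inj_row_free => v vA; apply/eqP/negPn/negP => v0.
  have [a0 ha0] : exists a, v 0 a != 0.
    apply: NNPP => h; move/negP: v0; apply; apply/eqP/rowP => a; rewrite mxE.
    by apply/eqP/negPn/negP => va; apply: h; exists a.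
  case: (@arg_maxnP _ a0 (fun a => v 0 a != 0) (fun a => lift l a : nat) ha0) => a va amax.
  have [k0 klam] := hsP (lift l a); move/negP: va; apply.
  have : \sum_x (v *m A) 0 x * hs (lift l a) x = 0.
    by rewrite vA big1 // => x _; rewrite mxE mul0r.
  under eq_bigr => x _ do rewrite mxE mulr_suml.
  rewrite exchange_big /= (bigD1 a) //= [X in _ + X]big1 ?addr0.
    under eq_bigr => x _ do rewrite /A mxE -mulrA.
    by rewrite -mulr_sumr => /eqP; rewrite mulf_eq0 (negbTE k0) orbF.
  move=> b ba; under eq_bigr => x _ do rewrite /A mxE -mulrA.
  rewrite -mulr_sumr; have [->|vb] := eqVneq (v 0 b) 0; first by rewrite mul0r.
  have hb : (lift l b < lift l a)%N.
    have hle : (lift l b <= lift l a)%N by exact: amax.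
    rewrite ltn_neqAle hle andbT; apply: contra_neq ba => /val_inj.
    exact: lift_inj.
  have := klam _ hb; rewrite (central_lam Rpcgl Rsym (cen _) hb) ?neq_lift //; last first.
    by rewrite eq_sym neq_lift.
  by rewrite -/(pairing (hs (lift l a)) (lift l b)) => ->; rewrite mulr0.
have Afull : row_full A^T by rewrite /row_full mxrank_tr.
pose ph := fullrankfun Afull.
pose M := \matrix_(a < n, b < n) w (lift l a) (ph b) : 'M[int]_n.
have detM : \det M != 0.
  have : rowsub ph A^T \in unitmx := fullrowsub_unit Afull.
  have -> : rowsub ph A^T = (map_mx intr M)^T by apply/matrixP => a b; rewrite !mxE.
  rewrite unitmx_tr unitmxE unitfE det_map_mx; apply: contraNneq => ->.
  by rewrite rmorph0.
have [a iE] : exists a, i = lift l a.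
  by case: (unliftP l i) => [a ->|e]; [exists a|rewrite e eqxx in il].
pose adj := \det M *: \adj M.
pose nu x := \sum_(b < n | ph b == x) adj b a.
have sumE a' : \sum_x w (lift l a') x * nu x = \det M * ((\det M)%:M a' a : int).
  rewrite -mul_mx_adj mxE mulr_sumr.
  transitivity (\sum_b M a' b * adj b a); last first.
    apply: eq_bigr => b _; rewrite mulrCA; congr (_ * _).
    by rewrite /adj [LHS]mxE.
  rewrite /nu; under eq_bigr => x _ do rewrite mulr_sumr big_mkcond.
  rewrite exchange_big /=; apply: eq_bigr => b _.
  by rewrite -big_mkcond (big_pred1 (ph b)) ?mxE // => x; rewrite eq_sym.
exists nu, (`|\det M| ^ 2)%N; split.
- by rewrite expn_eq0 absz_eq0 (negbTE detM).
- by rewrite iE sumE mxE eqxx mulr1n -expr2 -abszX gez0_abs // Num.Theory.sqr_ge0.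
- move=> i' i'l i'i; case: (unliftP l i') => [a' e|e]; last by rewrite e eqxx in i'l.
  rewrite e sumE mxE; case: eqP => [ea|_]; last by rewrite mulr0n mulr0.
  by move: i'i; rewrite e iE ea eqxx.
Qed.

(** The value at [2] of such a cocharacter: in characteristic zero a positive power
    of [2] is not [1], so this torus element moves [x_i]. *)
Lemma torus_point i : i != l -> exists (h : {ffun 'I_r -> K}) (d : nat),
  [/\ in_torus h, d != 0%N, character (w i) h = 2%:R ^+ d
    & forall i', i' != l -> i' != i -> character (w i') h = 1].
Proof.
move=> il; have [nu [d [d0 nui nu0]]] := cocharacter_exists il.
have two0 : 2%:R != 0 :> K by have /pcharf0P -> := charK.
pose h : {ffun 'I_r -> K} := [ffun x => 2%:R ^ nu x].
have hE u : character u h = 2%:R ^ (\sum_x u x * nu x).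
  rewrite /character; elim/big_rec2: _ => [|x p q _ ->]; first by rewrite expr0z.
  by rewrite ffunE exprz_exp expfzDr // [nu x * _]mulrC.
exists h, d; split=> //.
- by move=> x; rewrite ffunE expfz_neq0.
- by rewrite hE nui -exprnP.
- by move=> i' i'l i'i; rewrite hE nu0 // expr0z.
Qed.

Lemma pair_interval j : pred_eta eta l = Some j -> polysub (iset N j l) (y l).
Proof.
move=> e; have [jl _ _] := pred_etaP e.
have [g [m [-> _ _ hm]]] := pair_structure charK Rpcgl Rsym wP yP cenl e.
apply: (linclosedB (polysub_lin K _)).
  by apply: polysubM; apply: polysubX; rewrite inE leqnn (ltnW jl).
apply: (linclosedZ _ (polysub_lin K _)) => m' k; rewrite msuppX inE => /eqP -> /hm.
by rewrite inE => /andP [/ltnW -> /ltnW].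
Qed.

(** The bracket commutes with the torus elements fixing [R_[j, l]] pointwise, and
    these detect every other generator. *)
Lemma pair_stable j a : pred_eta eta l = Some j -> polysub (iset N j l) a ->
  polysub (iset N j l) (br (y l) a).
Proof.
move=> e ja; have [jl _ _] := pred_etaP e.
have [g [m [yE g0 _ hm]]] := pair_structure charK Rpcgl Rsym wP yP cenl e.
have ju := pair_interval e.
move=> f i fb fi; rewrite inE; apply/negPn/negP => ni.
have il : i != l by apply: contraNneq ni => ->; rewrite leqnn (ltnW jl).
have [h [d [hT d0 hi h1]]] := torus_point il.
have mch f' : (forall k, f' k != 0%N -> character (w k) h = 1) -> mchar w f' h = 1.
  move=> hf; rewrite /mchar big1 // => k _.
  by have [->|/hf ->] := eqVneq (f' k) 0%N; rewrite ?expr0 ?expr1n.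
have hjl k : (j <= k <= l)%N -> k != l -> character (w k) h = 1.
  by move=> hk kl; apply: h1 => //; apply: contraNneq ni => <-.
have hl : character (w l) h = 1.
  have us f' : f' \in msupp (y l) -> act h (y l) = mchar w f' h *: y l.
    by move=> fy; apply: (homog_act Rpcgl wP (ps_homog yP l)).
  have ml : m l = 0%N by apply/eqP/negPn/negP => /hm; rewrite ltnn andbF.
  have bm : (U_(j) + U_(l))%MM != m.
    apply/eqP => /(congr1 (fun f' : mon => f' l)).
    by rewrite ml mnmDE !mnm1E eqxx addn1.
  have e1 : act h (y l) = mchar w (U_(j) + U_(l)) h *: y l.
    apply: us; rewrite mcoeff_msupp yE -mpolyXD mcoeffB mcoeffZ !mcoeffX eqxx.
    by rewrite [m == _]eq_sym (negbTE bm) mulr0 subr0 oner_neq0.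
  have e2 : act h (y l) = mchar w m h *: y l.
    apply: us; rewrite mcoeff_msupp yE -mpolyXD mcoeffB mcoeffZ !mcoeffX eqxx.
    by rewrite (negbTE bm) mulr1 sub0r oppr_eq0.
  have y0 : y l != 0 := pp_neq0 (y_prime yP l).
  have : mchar w (U_(j) + U_(l)) h = mchar w m h.
    move: e1; rewrite e2 => /eqP; rewrite -subr_eq0 -scalerBl scaler_eq0 (negbTE y0) orbF.
    by rewrite subr_eq0 => /eqP.
  rewrite mcharD !mcharU mch => [|k /hm hk]; last first.
    by apply: hjl; [lia|apply: contraTneq hk => ->; rewrite ltnn andbF].
  by rewrite hjl ?mul1r // ?leqnn ?(ltnW jl) //; apply: contraTneq jl => ->; rewrite ltnn.
have hall k : (j <= k <= l)%N -> character (w k) h = 1.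
  by move=> hk; have [->|kl] := eqVneq k l; [|apply: hjl].
have fixed v : polysub (iset N j l) v -> act h v = v.
  move=> jv; apply/mpolyP => f'; rewrite (mcoeff_act Rpcgl wP) //.
  have [fv|] := boolP (f' \in msupp v).
    rewrite mch ?mul1r // => k fk; apply: hall.
    by have := jv _ _ fv fk; rewrite inE.
  by rewrite mcoeff_msupp negbK => /eqP ->; rewrite mulr0.
have := act_bracket (pcgl_action Rpcgl) (y l) a hT; rewrite (fixed a) // (fixed (y l)) //.
move/(congr1 (mcoeff f)); rewrite (mcoeff_act Rpcgl wP) // => /eqP.
have b0 : (br (y l) a)@_f != 0 by rewrite -mcoeff_msupp.
rewrite -subr_eq0 -[X in _ - X]mul1r -mulrBl mulf_eq0 (negbTE b0) orbF.
rewrite subr_eq0 /mchar (bigD1 i) //= hi big1 ?mulr1 => [|k ki]; last first.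
  have [->|kl] := eqVneq k l; first by rewrite hl expr1n.
  by rewrite h1 ?expr1n.
rewrite -exprM -natrX => /eqP two.
have /eqP := natmul_inj0 charK (oner_neq0 K) (two : 1 *+ _ = 1 *+ 1).
by rewrite -[1%N](expn0 2) eqn_exp2l // muln_eq0 (negbTE d0) (negbTE fi).
Qed.

Lemma pair_leading j : pred_eta eta l = Some j -> leading_term (y l) 1 (U_(j) + U_(l)).
Proof.
move=> e; have [jl _ _] := pred_etaP e.
have [g [m [-> _ _ hm]]] := pair_structure charK Rpcgl Rsym wP yP cenl e.
have t := pair_lead (g := g) jl (@id_inj N) (@id_between N) hm.
split; [exact: oner_neq0|exact: tops_coef t|].
by case: (tops_lead (oner_neq0 K) t).
Qed.

Lemma below_pair j m : (j < l)%N -> (forall k, m k != 0%N -> (j <= k)%N) ->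
  revlex_lt m (U_(j) + U_(l)) -> m l = 0%N \/ m = U_(l)%MM.
Proof.
move=> jl hm [x [xf xgt]].
have jl' : (j == l) = false by apply: contraTF jl => /eqP ->; rewrite ltnn.
have lE : (U_(j) + U_(l))%MM l = 1%N by rewrite mnmDE !mnm1E eqxx jl'.
have jE : (U_(j) + U_(l))%MM j = 1%N by rewrite mnmDE !mnm1E eqxx eq_sym jl'.
have [xl|xl] := eqVneq x l.
  by left; move: xf; rewrite xl lE ltnS leqn0 => /eqP.
have xj : x = j.
  apply/eqP; apply: contraTT xf => xj.
  by rewrite mnmDE !mnm1E [j == x]eq_sym [l == x]eq_sym (negbTE xj) (negbTE xl).
subst x; move: xf; rewrite jE ltnS leqn0 => /eqP mj0.
right; apply/mnmP => i; rewrite mnm1E; have [<-|li] := eqVneq; first by rewrite xgt.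
case: (ltngtP j i) => [ji|ij|/val_inj <- //].
  rewrite xgt // mnmDE !mnm1E (negbTE li) addn0.
  by case: eqP ji => // ->; rewrite ltnn.
by apply/eqP; apply: contraTT ij => /hm; rewrite -leqNgt.
Qed.

(** By weights, a homogeneous element with leading term [x_j x_l] has at most
    one other term, which is that of [y_l]; as [pair_normal] computes its
    coefficient, normality determines the element. *)
Lemma pair_unique j z : pred_eta eta l = Some j -> homogeneous act z ->
  poisson_prime br (polysub (iset N j l)) (y l) ->
  poisson_prime br (polysub (iset N j l)) z ->
  leading_term z 1 (U_(j) + U_(l)) -> z = y l.
Proof.
move=> e hz py pz [_ zf lz]; have [jl _ _] := pred_etaP e.
have [_ yf _] := pair_leading e.
have [g [m [yE g0 lj0 hm]]] := pair_structure charK Rpcgl Rsym wP yP cenl e.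
set f := (U_(j) + U_(l))%MM in zf lz yf.
have ml : m l = 0%N by apply/eqP/negPn/negP => /hm; rewrite ltnn andbF.
have bm : m != f.
  by apply/eqP => mf; move: ml; rewrite mf mnmDE !mnm1E eqxx addn1.
have fz : f \in msupp z by rewrite mcoeff_msupp zf oner_neq0.
have fy : f \in msupp (y l) by rewrite mcoeff_msupp yf oner_neq0.
have my : m \in msupp (y l).
  rewrite mcoeff_msupp yE -mpolyXD mcoeffB mcoeffZ !mcoeffX eqxx.
  by rewrite -[(_ + _)%MM]/f [f == m]eq_sym (negbTE bm) mulr1 sub0r oppr_eq0.
have zE : z = 'X_j * 'X_l - (- z@_m) *: 'X_[m].
  rewrite scaleNr opprK -mpolyXD; apply/mpolyP => m'; rewrite mcoeffD mcoeffZ !mcoeffX.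
  have [<-|fm'] := eqVneq f m'; first by rewrite (negbTE bm) mulr0 addr0.
  rewrite add0r; have [<-|mm'] := eqVneq m m'; first by rewrite mulr1.
  rewrite mulr0; apply/eqP; rewrite mcoeff_eq0; apply/negP => m'z.
  have m'l : m' l = 0%N.
    have [||//|m'U] := @below_pair j m' jl.
    - by move=> k /(pp_mem pz _ _ m'z); rewrite inE => /andP [].
    - by apply: lz => //; rewrite eq_sym.
    (* then x_j would have weight zero *)
    have [hs hsP] := hk_exist Rpcgl wP; have [j0 _] := hsP j.
    have := homog_wt Rpcgl wP (hs j) hz fz m'z.
    by rewrite m'U wtfD !wtfU -[RHS]add0r => /addIr /eqP; rewrite (negbTE j0).
  move/eqP: mm'; apply; apply: (wt_eq_central charK Rpcgl Rsym wP (A := [set~ l])).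
  - move=> xi; rewrite -(homog_wt Rpcgl wP xi (ps_homog yP l) fy my).
    exact: (homog_wt Rpcgl wP xi hz fz m'z).
  - by move=> i'; rewrite !inE negbK => /eqP ->; rewrite m'l.
  - by move=> i'; rewrite !inE; apply: cen.
have coef v c : v = 'X_j * 'X_l - c *: 'X_[m] -> poisson_prime br (polysub (iset N j l)) v ->
    ('X_j * br 'X_l 'X_j)@_(m + U_(j)) = - (c * lam l j).
  move=> vE pv; have [|p [_ vp]] := pp_normal pv (a := 'X_j).
    by apply: polysubX; rewrite inE leqnn (ltnW jl).
  apply: (pair_normal Rpcgl Rsym (leqnn j) jl cenl _ vE vp).
  by move=> k' /hm /andP [/ltnW -> ->].
have := coef _ _ zE pz; rewrite (coef _ _ yE py) => /oppr_inj /(mulIf lj0) gz.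
by rewrite zE -gz yE.
Qed.

Lemma iset1 i j : j \in iset N i i -> j = i.
Proof. by rewrite inE -eqn_leq => /eqP /val_inj ->. Qed.

(** In [K[x_i]] the identity [{a, a} = 0] reads [a' {x_i, a} = 0]. *)
Lemma br_one_var i a : polysub (iset N i i) a -> br 'X_i a = 0.
Proof.
move=> ia; have := is_derE a (br_der pb a); rewrite (pb_alt pb) (bigD1 i) //= big1 ?addr0.
  move/esym/eqP; rewrite mulf_eq0 => /orP [/eqP di|/eqP //].
  suff -> : a = (a@_0)%:MP by apply: brXC Rpcgl _ _.
  apply/mpolyP => m; rewrite mcoeffC; have [<-|m0] := eqVneq 0%MM m; first by rewrite mulr1.
  rewrite mulr0; apply/eqP; rewrite mcoeff_eq0; apply: contra m0 => ma.
  apply/eqP/mnmP => k; rewrite mnm0E; apply/esym/eqP/negPn/negP => mk.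
  have := mderiv0_polysub charK ia di ma mk.
  by rewrite in_setD1 => /andP [/eqP ki /iset1].
move=> k ki; rewrite (mderiv_polysub0 ia) ?mul0r //.
by apply: contra ki => /iset1 ->.
Qed.

(** Weights exclude every monomial of [K[x_i]] but [x_i] itself. *)
Lemma homog_one_var i z : homogeneous act z -> polysub (iset N i i) z ->
  z@_U_(i) = 1 -> z = 'X_i.
Proof.
move=> hz iz z1; have [hs hsP] := hk_exist Rpcgl wP; have [i0 _] := hsP i.
apply/mpolyP => m; rewrite mcoeffX; have [<-|mi] := eqVneq; first by rewrite z1.
apply/eqP; rewrite mcoeff_eq0; apply: contra mi => mz.
have m0 k : k != i -> m k = 0%N.
  move=> ki; apply/eqP; apply: contraTT ki => mk.
  by rewrite negbK (iset1 (iz _ _ mz mk)).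
have iz' : U_(i)%MM \in msupp z by rewrite mcoeff_msupp z1 oner_neq0.
have := homog_wt Rpcgl wP (hs i) hz mz iz'.
rewrite wtfU /wtf (bigD1 i) //= big1 ?addr0 => [|k ki]; last by rewrite m0.
rewrite -[RHS]mulr1n => /(natmul_inj0 charK i0) mi.
apply/eqP/mnmP => k; rewrite mnm1E; have [<-|ik] := eqVneq; first by rewrite mi.
by rewrite m0 // eq_sym.
Qed.

Lemma one_same_eta i i' : (eta i == eta i') = (etatau (rk tau i) == etatau (rk tau i')).
Proof. exact: (classes_eq yP ytauP one_same_lead). Qed.

(** The class of [tau k] contributes either [x_(tau k)] alone, or both [x_j] and
    [x_l]. In the second case the class is complete, so that [ytau k] is a prime
    element of the whole algebra, and must be [y_l]. *)
Lemma one_interval_good k (lo hi : 'I_N) :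
  class_exp (rk tau) etatau k lo != 0%N -> class_exp (rk tau) etatau k hi != 0%N ->
  (forall i, class_exp (rk tau) etatau k i != 0%N -> (lo <= i <= hi)%N) ->
  [/\ homogeneous_poisson_prime br act (polysub (iset N lo hi)) (ytau k),
      leading_term (ytau k) 1 (class_exp (rk tau) etatau k)
    & forall z, homogeneous_poisson_prime br act (polysub (iset N lo hi)) z ->
        leading_term z 1 (class_exp (rk tau) etatau k) -> z = ytau k].
Proof.
set f := class_exp _ _ _ => flo fhi hf.
have fE i : (f i != 0%N) = ((rk tau i <= k)%N && (etatau (rk tau i) == etatau k)).
  by rewrite mnmE; case: (_ && _).
have uA : f (tau k) != 0%N by rewrite fE tauK leqnn eqxx.
have [hu pu] := seq_prime_self ytauP k.
have IA : {subset iset N lo hi <= upto tau k}.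
  by apply: iset_upto tauXi _ _ _ _ _; [move: flo|move: fhi]; rewrite fE => /andP [].
have [single|] := classic (forall i, f i != 0%N -> i = tau k).
  have u : ytau k = 'X_(tau k).
    apply: (ps_first ytauP); case e: (pred_eta etatau k) => [k'|] //.
    have [k'k ek' _] := pred_etaP e.
    have /perm_inj k'k' : tau k' = tau k by apply: single; rewrite fE tauK ek' eqxx ltnW.
    by rewrite k'k' ltnn in k'k.
  have f1 : f = U_(tau k)%MM.
    apply/mnmP => i; rewrite mnm1E; have [<-|ki] := eqVneq.
      by move: uA; rewrite mnmE; case: (_ && _).
    by apply/eqP; apply: contraNT ki => /single ->.
  move: IA hf; rewrite (single _ flo) (single _ fhi) u f1 => IA _.
  rewrite u in hu pu.
  split.
  - split=> //; apply: (prime_restrict IA pu); first by apply: polysubX; rewrite inE leqnn.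
    by move=> a /br_one_var ->; case: (polysub_lin K (iset N (tau k) (tau k))).
  - split; [exact: oner_neq0|by rewrite mcoeffX eqxx|].
    by move=> m; rewrite msuppX inE => ->.
  - move=> z [hz pz] [_ z1 _]; exact: homog_one_var hz (pp_mem pz) z1.
move=> ns; have [i fi ik] : exists2 i, f i != 0%N & i != tau k.
  apply: NNPP => nex; apply: ns => i fi; apply/eqP/negPn/negP => ik.
  by apply: nex; exists i.
have ei : eta i = eta (tau k).
  by apply/eqP; rewrite one_same_eta tauK; move: fi; rewrite fE => /andP [].
have [j e ijl] := one_class' ik ei.
have [jl ej _] := pred_etaP e.
have jl' : j != l by apply: contraTneq jl => ->; rewrite ltnn.
have [fj fl] : f j != 0%N /\ f l != 0%N.
  by case: ijl => -[<- <-].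
have fjl i' : f i' != 0%N -> i' = j \/ i' = l.
  have [->|i'l] := eqVneq i' l; [by right|rewrite fE => /andP [_ /eqP fi']; left].
  have [j' e'] : exists2 j', pred_eta eta l = Some j' & (i' = j' /\ l = l) \/ (i' = l /\ l = j').
    apply: one_class' => //; apply/eqP; rewrite one_same_eta fi'.
    by move: fl; rewrite fE => /andP [_]; rewrite eq_sym.
  rewrite e in e'; case: e' => <- [[]//|[i'l' _]].
  by rewrite i'l' eqxx in i'l.
have f2 : f = (U_(j) + U_(l))%MM.
  have f01 i' : f i' != 0%N -> f i' = 1%N by rewrite mnmE; case: (_ && _).
  apply/mnmP => i'; rewrite mnmDE !mnm1E.
  have [<-|ji] := eqVneq j i'; first by rewrite eq_sym (negbTE jl') f01.
  have [<-|li] := eqVneq l i'; first by rewrite f01.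
  by apply/eqP; apply: contraNT ji => /fjl [->|e'] //; rewrite e' eqxx in li.
have sk : succ_eta etatau k = None.
  case s: (succ_eta etatau k) => [k'|] //; have [kk' ek' _] := succ_etaP s.
  have fk' : f (tau k') = 0%N by rewrite mnmE tauK leqNgt kk'.
  have ll' : tau k' != l by apply/eqP => e'; rewrite -e' fk' in fl.
  have e' : eta (tau k') = eta l.
    by apply/eqP; rewrite one_same_eta tauK ek' eq_sym; move: fl; rewrite fE => /andP [].
  have [j' ej' [[jj' _]|[e'' _]]] := one_class' ll' e'; last by rewrite e'' eqxx in ll'.
  by move: fk' fj; rewrite jj'; move: ej'; rewrite e => -[<-] ->.
have fu : (ytau k)@_f = 1 := seq_coef (tauK tau) (rkK tau) ytauP k.
have [_ yf _] := pair_leading e; rewrite -f2 in yf.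
have uy : ytau k = y l.
  have : homogeneous_poisson_prime br act (polysub [set: 'I_N]) (ytau k).
    rewrite -(upto_max (tauK tau) (rkK tau)).
    by apply: (seq_prime ytauP); [exact: leq_ord|rewrite /succ_gt sk].
  case/full_prime=> k' [t [_ t0 uE]]; have [k'l|k'l] := eqVneq k' l.
    by move: fu; rewrite uE k'l mcoeffZ yf mulr1 => ->; rewrite scale1r.
  move: fu; rewrite uE one_y // mcoeffZ mcoeffX; case: eqP => [kf|_]; last first.
    by rewrite mulr0 => /eqP; rewrite eq_sym oner_eq0.
  by move: fl; rewrite -kf mnm1E (negbTE k'l).
have [lj hl] : lo = j /\ hi = l.
  have /andP [lj _] := hf j fj; have /andP [_ lh] := hf l fl.
  have := fjl _ flo; have := fjl _ fhi.
  case=> [hj|hl]; first by rewrite hj leqNgt jl in lh.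
  by case=> [lo_j|lo_l] //; rewrite lo_l leqNgt jl in lj.
rewrite {}lj {}hl uy f2 in hu pu IA *.
have pI : poisson_prime br (polysub (iset N j l)) (y l).
  by apply: (prime_restrict IA pu (pair_interval e)) => a; apply: pair_stable.
split=> //; first exact: pair_leading.
by move=> z [hz pz]; exact: pair_unique.
Qed.

End OneNonCentral.

(** * Counting the non-central generators *)

Lemma noncentral_dichotomy (K : fieldType) (n : nat)
    (br : {mpoly K[n.+1]} -> {mpoly K[n.+1]} -> {mpoly K[n.+1]}) :
  (exists l, forall i, i != l -> central br i) \/
  exists l1 l2 : 'I_n.+1, [/\ (l1 < l2)%N, ~~ central br l1, ~~ central br l2,
    forall k : 'I_n.+1, (k < l1)%N -> central br k
    & forall k : 'I_n.+1, (l1 < k)%N -> (k < l2)%N -> central br k].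
Proof.
case: (pickP (fun i => ~~ central br i)) => [i0 nc0|call]; last first.
  by left; exists ord0 => i _; apply/negPn; rewrite call.
have {i0 nc0} [l1 nc1 min1] := @arg_minnP _ i0 (fun i => ~~ central br i) (@nat_of_ord _) nc0.
case: (pickP (fun i => (i != l1) && ~~ central br i)) => [i1 nc'|c1]; last first.
  by left; exists l1 => i il; have := c1 i; rewrite il => /negbFE.
have {i1 nc'} [l2 /andP [l21 nc2] min2] :=
  @arg_minnP _ i1 (fun i => (i != l1) && ~~ central br i) (@nat_of_ord _) nc'.
right; exists l1, l2; split=> //.
- by rewrite ltn_neqAle eq_sym l21 min1.
- by move=> k kl; apply: contraLR kl => /min1; rewrite -leqNgt.
- move=> k lk; apply: contraLR => nck; rewrite -leqNgt min2 // nck andbT.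
  by apply: contraTneq lk => ->; rewrite ltnn.
Qed.

(* The length is N = n.+1, which is positive because k ranges over [1, N];
   unique P z means that z is the one and only element with property P. *)
Theorem theorem8p3 (K : fieldType) (charK : [pchar K] =i pred0) (n r : nat)
  (br : {mpoly K[n.+1]} -> {mpoly K[n.+1]} -> {mpoly K[n.+1]})
  (act lie : {ffun 'I_r -> K} -> {mpoly K[n.+1]} -> {mpoly K[n.+1]})
  (sigma delta : 'I_n.+1 -> {mpoly K[n.+1]} -> {mpoly K[n.+1]})
  (lam : 'I_n.+1 -> 'I_n.+1 -> K)
  (Rpcgl : pcgl br act lie sigma delta lam)
  (Rsym : symmetric_pcgl lie delta lam)
  (eta : 'I_n.+1 -> int) (y : 'I_n.+1 -> {mpoly K[n.+1]})
  (yP : prime_sequence br act id eta y)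
  (tau : 'S_n.+1) (tauXi : Xi tau)
  (etatau : 'I_n.+1 -> int) (ytau : 'I_n.+1 -> {mpoly K[n.+1]})
  (ytauP : prime_sequence br act tau etatau ytau)
  (k : 'I_n.+1) :
  ((tau ord0 <= tau k)%N ->
     exists (m : nat) (i : 'I_n.+1),
       [/\ is_max (fun l => exists2 j, pred_iter eta l (tau k) = Some j
                                       & j \in upto tau k) m,
           pred_iter eta m (tau k) = Some i
         & unique (interval_prime br act eta i (tau k)) (ytau k)])
  /\
  ((tau k <= tau ord0)%N ->
     exists (m : nat) (j : 'I_n.+1),
       [/\ is_max (fun l => exists2 i, succ_iter eta l (tau k) = Some i
                                       & i \in upto tau k) m,
           succ_iter eta m (tau k) = Some j
         & unique (interval_prime br act eta (tau k) j) (ytau k)]).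
Proof.
have [w wP] := weights_exist Rpcgl.
have [[l cen]|[l1 [l2 [l12 nc1 nc2 c1 c12]]]] := noncentral_dichotomy br.
- apply: (reduction yP tauXi ytauP).
  + exact: (one_same_lead charK Rpcgl Rsym wP yP tauXi cen).
  + exact: (one_interval_good charK Rpcgl Rsym wP yP tauXi ytauP cen).
- have anti := two_noncentral_anti charK Rpcgl Rsym wP yP l12 c1 nc1 c12 nc2.
  apply: (reduction yP tauXi ytauP).
  + exact: (anti_same_lead charK Rpcgl Rsym wP anti tauXi).
  + exact: (anti_interval_good charK Rpcgl Rsym wP anti tauXi ytauP).
Qed.
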